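(* Work in the general setting under Assumption 2, assume the integrated tail of $\log\max(A_1,B_1)$ is subexponential, and fix $\gamma=(\gamma_1,\gamma_2)$ with $\gamma_1>0$ such that $\mathbb E Y_1<0$ and $Y_1$ belongs to $S^*$. Fix $\delta\in(0,1)$ and let $a_*\le0$ satisfy $$-\delta\le\frac{\bar v(u)^2-\bar w(u)^2}{\mathbb P(Y_1>-u)\,\bar w(u)}\qquad\text{for all }u\le a_*.$$ For $x>1$ define $$L_T(x)=\mathbb 1_{\{T(x)<\infty\}}\prod_{k=1}^{\tau_\gamma(x)}\frac{w_\gamma(S_{k-1}(\gamma)+a_* )}{v_\gamma(S_k(\gamma)+a_* )}.$$ Then $\tilde{\mathbb E}_x[L_T(x)]=\mathbb P(Z>x)$ for every $x>1$, and $$\sup_{x>1}\frac{\tilde{\mathbb E}_x[L_T(x)^2]}{\mathbb P(Z>x)^2}<\infty.$$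
   Context: General setting: Let $(\Psi_n,A_n,B_n,D_n)_{n\ge1}$ be i.i.d., each $\Psi_n:\mathbb R\to(0,\infty)$ a random Lipschitz function with $\mathrm{Lip}(\Psi_n)=\sup_{t_1\ne t_2}|\Psi_n(t_1)-\Psi_n(t_2)|/|t_1-t_2|$, and $(A_n,B_n,D_n)$ real random variables with, a.s., $A_nz+B_n-D_n\le\Psi_n(z)\le A_nz^++B_n^++D_n$ for all $z$ ($y^+=\max(y,0)$, $\log^+y=\max(\log y,0)$). Let $\Psi_{k:n}=\Psi_k\circ\cdots\circ\Psi_n$, $Z^{(0)}=0$, $Z^{(n)}=\Psi_{1:n}(0)$, $Z=\lim_n Z^{(n)}$, $T(x)=\inf\{n\ge0:Z^{(n)}>x\}$. Assumption 2: $Z^{(n)}$ nondecreasing in $n$ a.s., and (a) $A_1,D_1>0$ a.s., $\mathbb E\log A_1>-\infty$, $\mathbb E\log\mathrm{Lip}(\Psi_1)<0$, $\mathbb E\log^+|B_1^++D_1|<\infty$, $\mathbb E\log^+|B_1-D_1|<\infty$; (b) $\mathbb E[(\log^+\max(A_1,B_1))^{1+\eta}]<\infty$ for some $\eta>0$; (c) $\mathbb P(\max(A_1,B_1^++D_1)>x)\sim\mathbb P(\max(A_1,B_1)>x)$, $\mathbb P(\max(A_1,B_1-D_1)>x)\sim\mathbb P(\max(A_1,B_1)>x)$, $\mathbb P(A_1>x,B_1-D_1\le-x)=o(\mathbb P(\max(A_1,B_1)>x))$. Integrated tail $\bar F_I(t)=\int_t^\infty\mathbb P(\log\max(A_1,B_1)>s)ds$;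 it is subexponential if $\bar F_I(0)\in(0,\infty)$ and the law on $[0,\infty)$ with tail $\bar F_I/\bar F_I(0)$ is subexponential. Random walk: $Y_n=\max(\log^+(B_n^++D_n)-\gamma_2,\log A_n)+\gamma_1$, $S_0(\gamma)=0$, $S_n(\gamma)=\sum_{k=1}^nY_k$, $s(x)=\log x-\gamma_2+\log(1-e^{-\gamma_1})$, $\tau_\gamma(x)=\inf\{n\ge0:S_n(\gamma)>s(x)\}$. Class $S^*$: a random variable $X$ is in $S^*$ if $\mathbb E X^+<\infty$ and $\int_0^t\mathbb P(X>t-s)\mathbb P(X>s)ds\sim2\mathbb E[X^+]\mathbb P(X>t)$ as $t\to\infty$. Importance sampling: let $W_\gamma\ge0$ be independent of everything with $\mathbb P(W_\gamma>t)=\min\big[1,-\frac{1}{\mathbb EY_1}\int_t^\infty\mathbb P(Y_1>s)ds\big]$, $t\ge0$; set $\bar v(u)=\mathbb P(W_\gamma>-u)$, $\bar w(u)=\mathbb P(Y_1+W_\gamma>-u)$, $v_\gamma(z)=\bar v(z-s(x))$, $w_\gamma(y)=\bar w(y-s(x))$ (these depend on $x$). Let $\mathcal F_n=\sigma(\Psi_k,A_k,B_k,D_k:k\le n)$ and $M_n=\prod_{k=1}^n v_\gamma(S_k(\gamma)+a_* )/w_\gamma(S_{k-1}(\gamma)+a_* )$ (a mean-one $\mathcal F_n$-martingale). $\tilde{\mathbb P}_x$ is the probability measure on $\mathcal F_\infty$ with $\tilde{\mathbb P}_x(E)=\mathbb E[\mathbb 1_EM_{n\wedge\tau_\gamma(x)}]$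 for $E\in\mathcal F_n$, $n\ge0$; equivalently, under $\tilde{\mathbb P}_x$ the increments of $S(\gamma)$ before $\tau_\gamma(x)$ follow the kernel $Q(y,dz)=\mathbb P(y+Y_1\in dz)v_\gamma(z+a_* )/w_\gamma(y+a_* )$ and after $\tau_\gamma(x)$ the tuples $(\Psi_n,A_n,B_n,D_n)$ have their original law. $\tilde{\mathbb E}_x$ is its expectation. *)

(* Defs.v *)
From HB Require Import structures.
From mathcomp Require Import all_boot all_order all_algebra.
From mathcomp Require Import all_classical all_reals all_analysis.
Set Implicit Arguments. Unset Strict Implicit. Unset Printing Implicit Defensive.
Import Order.TTheory GRing.Theory Num.Theory.
Import numFieldNormedType.Exports.
Local Open Scope classical_set_scope.
Local Open Scope ring_scope.

Section Generic.
Context {R : realType}.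

(* log^+ y = max(log y, 0)  (ln y = 0 for y <= 0 in MathComp, so log^+ y = 0 there) *)
Definition logp (y : R) : R := Num.max (ln y) 0.

Definition elog (x : \bar R) : \bar R :=
  match x with
  | r%:E => if (0 < r)%R then (ln r)%:E else -oo
  | +oo => +oo
  | -oo => -oo
  end%E.

Definition Lip (f : R -> R) : \bar R :=
  ereal_sup [set ((`|f p.1 - f p.2| / `|p.1 - p.2|)%:E) |
                  p in [set p : R * R | p.1 != p.2]].

Definition asym_equiv (f g : R -> R) : Prop :=
  (f x / g x) @[x --> (+oo : set_system R)] --> (1 : R).

Definition asym_negl (f g : R -> R) : Prop :=
  (f x / g x) @[x --> (+oo : set_system R)] --> (0 : R).

Definition first_hit (p : pred nat) : option nat :=
  match pselect (exists n, p n) with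
  | left h => Some (ex_minn h)
  | right _ => None
  end.

(* Subexponential law on [0,oo): G((-oo,0)) = 0 and
   P(X1 + X2 > t) / P(X1 > t) -> 2 with X1, X2 i.i.d. ~ G, where
   P(X1 + X2 > t) = \int G((t-u,oo)) dG(u). *)
Definition subexponential (G : probability R R) : Prop :=
  G [set s | s < 0] = 0%E /\
  (fine (\int[G]_u G [set s : R | (t - u < s)%R]) / fine (G [set s : R | t < s]))
     @[t --> (+oo : set_system R)] --> (2 : R).

End Generic.

Section Model.
Context {R : realType} {d : measure_display} {T : measurableType d}.
Variable P : probability T R.

Definition tailP (X : T -> R) (t : R) : R := fine (P [set w | t < X w]).

Definition in_Sstar (X : T -> R) : Prop :=
  (\int[P]_w (Num.max (X w) 0)%:E < +oo)%E /\
  asym_equiv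
    (fun t => fine (\int[lebesgue_measure]_(s in [set s : R | 0 <= s <= t])
                      (tailP X (t - s) * tailP X s)%:E))
    (fun t => 2 * fine (\int[P]_w (Num.max (X w) 0)%:E) * tailP X t).

(* The i.i.d. tuples (Psi_n, A_n, B_n, D_n), n >= 1 of the paper are indexed
   here by n - 1 : nat, i.e. Psi 0 = Psi_1, A 0 = A_1, etc. *)
Variables (Psi : nat -> T -> R -> R) (A B D : nat -> T -> R).

(* cylinder parameters: finitely many (time, Borel set) pairs for Psi_k,
   and Borel sets for A_k, B_k, D_k *)
Definition cyl_param := (seq (R * set R) * set R * set R * set R)%type.

Definition cyl_param_ok (c : cyl_param) : Prop :=
  let: (ps, BA, BB, BD) := c in
  (forall i, (i < size ps)%N -> measurable (nth (0, setT) ps i).2) /\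
  measurable BA /\ measurable BB /\ measurable BD.

Definition cyl (k : nat) (c : cyl_param) : set T :=
  let: (ps, BA, BB, BD) := c in
  [set w | (forall i, (i < size ps)%N ->
              (nth (0, setT) ps i).2 (Psi k w (nth (0, setT) ps i).1)) /\
           BA (A k w) /\ BB (B k w) /\ BD (D k w)].

(* (Psi_k, A_k, B_k, D_k)_k are i.i.d.: identically distributed and mutually
   independent, tested on the pi-system of cylinder events (which generates
   sigma(Psi_k, A_k, B_k, D_k)). *)
Definition iid_tuples : Prop :=
  (forall k c, cyl_param_ok c -> P (cyl k c) = P (cyl 0 c)) /\
  (forall (I : seq nat) (c : nat -> cyl_param), uniq I ->
     (forall k, cyl_param_ok (c k)) ->
     fine (P [set w | forall k, k \in I -> cyl k (c k) w]) =
     \prod_(k <- I) fine (P (cyl k (c k)))).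

Definition measurable_model : Prop :=
  (forall n t, measurable_fun setT (fun w => Psi n w t)) /\
  (forall n, measurable_fun setT (A n)) /\
  (forall n, measurable_fun setT (B n)) /\
  (forall n, measurable_fun setT (D n)).

(* F_n = sigma(Psi_k, A_k, B_k, D_k : k <= n)  (paper indexing) *)
Definition filtr (n : nat) : set (set T) :=
  <<s [set E | exists k c, (k < n)%N /\ cyl_param_ok c /\ E = cyl k c] >>.

Definition Zn (n : nat) (w : T) : R := foldr (fun k z => Psi k w z) 0 (iota 0 n).

Definition Zlim (w : T) : \bar R := limn (fun n => (Zn n w)%:E).

Definition T_finite (x : R) (w : T) : Prop := exists n, x < Zn n w.

Definition assumption2 : Prop :=
  (forall n w t, 0 < Psi n w t) /\
  (forall n w, (Lip (Psi n w) < +oo)%E) /\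
  (forall n, {ae P, forall w, forall z,
      A n w * z + B n w - D n w <= Psi n w z /\
      Psi n w z <= A n w * Num.max z 0 + Num.max (B n w) 0 + D n w}) /\
  {ae P, forall w, forall n, Zn n w <= Zn n.+1 w} /\
  {ae P, forall w, 0 < A 0 w /\ 0 < D 0 w} /\
  (* E log A_1 > -oo *)
  (\int[P]_w (Num.max (- ln (A 0 w)) 0)%:E < +oo)%E /\
  (* E log Lip(Psi_1) < 0  (expectation well defined and negative) *)
  (\int[P]_w maxe (elog (Lip (Psi 0 w))) 0%E < +oo)%E /\
  (\int[P]_w elog (Lip (Psi 0 w)) < 0)%E /\
  (\int[P]_w (logp `|Num.max (B 0 w) 0 + D 0 w|)%:E < +oo)%E /\
  (\int[P]_w (logp `|B 0 w - D 0 w|)%:E < +oo)%E /\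
  (exists eta : R, 0 < eta /\
     (\int[P]_w ((logp (Num.max (A 0 w) (B 0 w))) `^ (1 + eta))%:E < +oo)%E) /\
  asym_equiv (tailP (fun w => Num.max (A 0 w) (Num.max (B 0 w) 0 + D 0 w)))
             (tailP (fun w => Num.max (A 0 w) (B 0 w))) /\
  asym_equiv (tailP (fun w => Num.max (A 0 w) (B 0 w - D 0 w)))
             (tailP (fun w => Num.max (A 0 w) (B 0 w))) /\
  asym_negl (fun x => fine (P [set w | x < A 0 w /\ B 0 w - D 0 w <= - x]))
            (tailP (fun w => Num.max (A 0 w) (B 0 w))).

Definition FI (t : R) : \bar R :=
  \int[lebesgue_measure]_(s in [set s : R | t <= s])
     (tailP (fun w => ln (Num.max (A 0 w) (B 0 w))) s)%:E.

Definition integrated_tail_subexp : Prop :=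
  (0 < FI 0 < +oo)%E /\
  exists G : probability R R,
    G [set s | s < 0] = 0%E /\
    (forall t, 0 <= t -> G [set s | t < s] = (fine (FI t) / fine (FI 0))%:E) /\
    subexponential G.

Variables (g1 g2 : R).

(* Y_{k+1} (paper) = Y k *)
Definition Y (k : nat) (w : T) : R :=
  Num.max (logp (Num.max (B k w) 0 + D k w) - g2) (ln (A k w)) + g1.

Definition Sw (n : nat) (w : T) : R := \sum_(k < n) Y k w.

Definition sx (x : R) : R := ln x - g2 + ln (1 - expR (- g1)).

Definition tau (x : R) (w : T) : option nat := first_hit (fun n => sx x < Sw n w).

Definition EY : R := fine (\int[P]_w (Y 0 w)%:E).

(* tail of W_gamma: P(W > t) (W >= 0, so P(W > t) = 1 for t < 0) *)
Definition Wtail (t : R) : R :=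
  if t < 0 then 1
  else Num.min 1 (- EY^-1 *
         fine (\int[lebesgue_measure]_(s in [set s : R | t <= s]) (tailP (Y 0) s)%:E)).

(* bar v(u) = P(W > -u);  bar w(u) = P(Y_1 + W > -u) = E[ bar v(u + Y_1) ]
   (W independent of Y_1) *)
Definition vbar (u : R) : R := Wtail (- u).
Definition wbar (u : R) : R := fine (\int[P]_w (vbar (u + Y 0 w))%:E).

Definition vg (x z : R) : R := vbar (z - sx x).
Definition wg (x y : R) : R := wbar (y - sx x).

Variable astar : R.

Definition Mstop (x : R) (n : nat) (w : T) : R :=
  let m := match tau x w with Some t => minn n t | None => n end in
  \prod_(k < m) (vg x (Sw k.+1 w + astar) / wg x (Sw k w + astar)).

Definition is_tilde_measure (x : R) (Q : probability T R) : Prop :=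
  forall n E, filtr n E ->
    (Q E = \int[P]_w ((indic E w : R) * Mstop x n w)%:E)%E.

(* L_T(x); on the (null) event {T(x) < oo, tau_gamma(x) = oo} it is set to 0 *)
Definition LT (x : R) (w : T) : R :=
  if `[< T_finite x w >] then
    match tau x w with
    | Some t => \prod_(k < t) (wg x (Sw k w + astar) / vg x (Sw k.+1 w + astar))
    | None => 0
    end
  else 0.

End Model.

(* Main.v *)
(* On the log scale, Z^(n) > x forces the walk S to have passed s(x), up to a
   null set; hence T(x) >= tau(x) and the likelihood ratio at tau(x) is
   unbiased.  Its second moment satisfies a recursion along S, for which the
   function equal to vbar^2 up to level 0 and to 1 - delta above is a
   supersolution by the hypothesis on a_*; so it is at most a constant times
   vbar(a_* - s(x))^2.

   It remains to bound P(Z > x) below by a multiple of vbar(a_* - s(x)), that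
   is, of the integrated tail of Y_1.  With probability bounded below, the
   perpetuity built from the first 2k tuples stays below a constant while the
   product of the A's is at least exp(-2Ck); independently, a jump of
   max(A, B - D) above a multiple of x exp(2Ck) then lifts Z above x.
   A renewal-type argument adds these events up over k, and the resulting
   series is a Riemann sum for the integrated tail: class S* makes the tail of
   Y_1 long, so that it is comparable with that of log max(A_1, B_1). *)
Require Import Defs.
From HB Require Import structures.
From mathcomp Require Import all_boot all_order all_algebra.
From mathcomp Require Import all_classical all_reals all_analysis.
From mathcomp Require Import measurable_realfun.
From mathcomp Require Import ring lra.
Import Order.TTheory GRing.Theory Num.Theory.
Import numFieldNormedType.Exports.
Local Open Scope classical_set_scope.
Local Open Scope ring_scope.

Set Implicit Arguments.
Unset Strict Implicit.
Unset Printing Implicit Defensive.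

(** Independence is given only on finite cylinders, so it is extended to the sigma-algebras of
    disjoint index sets; [freezing] then plays the role of conditional expectation throughout,
    without an independent copy of the tuples.

    The second moment is computed under [P]: where the walk first passes [s(x)] at time [n], the
    density of the tilted law is the inverse of the likelihood ratio, so one of the two factors
    cancels. The constants in [s(x)] come from a geometric series: each increment of the walk
    contains the excess [g1], so each composition gains a factor [expR (- g1)].

    The lower bound rests on a negative mean of [ln A], which follows from that of [log Lip]: a
    function above a line of slope [a > 0] has Lipschitz constant at least [a]. The perpetuity is
    then tight by a drift argument for [ln (1 + r)]. The jump events overlap; the overlap is
    harmless as long as [P(Z > x)] is small, and for the remaining [x] the comparison with
    [vbar <= 1] is immediate. *)

Section MeasurableHalfLines.
Context {R : realType} {d : measure_display} {T : measurableType d}.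
Implicit Types (X : T -> R) (r : R).

Lemma measurable_ltr_cst X r : measurable_fun setT X -> measurable [set w | X w < r].
Proof.
move=> mX; have := mX measurableT `]-oo, r[%classic (measurable_itv _).
by rewrite setTI; congr measurable; apply/seteqP; split => w /=; rewrite in_itv.
Qed.

Lemma measurable_gtr_cst X r : measurable_fun setT X -> measurable [set w | r < X w].
Proof.
move=> mX; have := mX measurableT `]r, +oo[%classic (measurable_itv _).
by rewrite setTI; congr measurable; apply/seteqP; split => w /=; rewrite in_itv/= andbT.
Qed.

Lemma measurable_ler_cst X r : measurable_fun setT X -> measurable [set w | X w <= r].
Proof.
move=> mX; have := mX measurableT `]-oo, r]%classic (measurable_itv _).
by rewrite setTI; congr measurable; apply/seteqP; split => w /=; rewrite in_itv.
Qed.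

Lemma measurable_ger_cst X r : measurable_fun setT X -> measurable [set w | r <= X w].
Proof.
move=> mX; have := mX measurableT `[r, +oo[%classic (measurable_itv _).
by rewrite setTI; congr measurable; apply/seteqP; split => w /=; rewrite in_itv/= andbT.
Qed.

Variable P : probability T R.

Lemma integral_prob_cst r : (\int[P]_w r%:E = r%:E)%E.
Proof.
rewrite integral_cst// -[RHS]mule1; congr (_ * _)%E; exact: probability_setT.
Qed.

End MeasurableHalfLines.

Lemma archi_mul {R : realType} (x m : R) : 0 < m -> exists N : nat, x < N%:R * m.
Proof.
move=> m0; exists (Num.bound `|x / m|); rewrite -ltr_pdivrMr//.
by apply: (le_lt_trans (ler_norm _)); exact: archi_boundP.
Qed.

(** * Independence: from cylinder events to sigma-algebras of disjoint index sets *)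

Section Cylinders.
Context {R : realType} {d : measure_display} {T : measurableType d}.
Variable P : probability T R.
Variables (Psi : nat -> T -> R -> R) (A B D : nat -> T -> R).
Hypothesis mmodel : measurable_model Psi A B D.
Hypothesis iid : iid_tuples P Psi A B D.

Let cyl := cyl Psi A B D.

Definition triv_cyl : cyl_param := ([::], [set: R], [set: R], [set: R]).

Definition capc (c c' : @cyl_param R) : cyl_param :=
  let: (ps, BA, BB, BD) := c in let: (ps', BA', BB', BD') := c' in
  (ps ++ ps', BA `&` BA', BB `&` BB', BD `&` BD').

Lemma cyl_capc k c c' : cyl k (capc c c') = cyl k c `&` cyl k c'.
Proof.
case: c => [[[ps BA] BB] BD]; case: c' => [[[ps' BA'] BB'] BD'].
apply/seteqP; split => w /=.
- move=> [h [[? ?] [[? ?] [? ?]]]]; split; (split; last by []) => i li.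
    by have := h i; rewrite size_cat nth_cat li; apply; exact: ltn_addr.
  have := h (size ps + i)%N; rewrite size_cat nth_cat ltn_add2l.
  by rewrite (ltnNge (_ + _)) leq_addr/= addKn; exact.
- move=> [[h [? [? ?]]] [h' [? [? ?]]]]; split => // i; rewrite size_cat nth_cat => li.
  case: ltnP => [|le]; first exact: h.
  by apply: h'; rewrite ltn_subLR.
Qed.

Lemma cyl_triv k : cyl k triv_cyl = setT.
Proof. by apply/seteqP; split => // w _; split. Qed.

Lemma cyl_param_ok_triv : cyl_param_ok triv_cyl.
Proof. by split. Qed.

Lemma cyl_param_ok_cap c c' :
  cyl_param_ok c -> cyl_param_ok c' -> cyl_param_ok (capc c c').
Proof.
case: c => [[[ps BA] BB] BD]; case: c' => [[[ps' BA'] BB'] BD'].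
move=> [h [? [? ?]]] [h' [? [? ?]]]; split.
  move=> i; rewrite size_cat nth_cat => li; case: ltnP => [|le]; first exact: h.
  by apply: h'; rewrite ltn_subLR.
by split; [exact: measurableI|split; exact: measurableI].
Qed.

Lemma capc_triv : capc triv_cyl triv_cyl = triv_cyl.
Proof. by rewrite /capc/= !setTI. Qed.

Lemma measurable_cyl k c : cyl_param_ok c -> measurable (cyl k c).
Proof.
case: c => [[[ps BA] BB] BD] [h [mA [mB mD]]].
have [m1 [m2 [m3 m4]]] := mmodel.
rewrite (_ : cyl _ _ = \bigcap_(i in [set i | (i < size ps)%N])
    ((fun w => Psi k w (nth (0, setT) ps i).1) @^-1` (nth (0, setT) ps i).2) `&`
   (A k @^-1` BA `&` (B k @^-1` BB `&` D k @^-1` BD))); last first.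
  by apply/seteqP; split => w.
apply: measurableI.
  apply: bigcap_measurableType => i /= li.
  by rewrite -[X in measurable X]setTI; apply: m1 => //; exact: h.
rewrite -[A k @^-1` _]setTI -[B k @^-1` _]setTI -[D k @^-1` _]setTI.
by apply: measurableI; [exact: m2|apply: measurableI; [exact: m3|exact: m4]].
Qed.

Definition gen (I : set nat) : set (set T) :=
  [set E | exists k c, I k /\ cyl_param_ok c /\ E = cyl k c].

(** The events of [gen I] are not closed under intersection, these are. One family [c] over all of
    [nat], trivial outside [I] and from [N] on, makes an intersection of two events a pointwise
    [capc]. *)
Definition pi_gen (I : set nat) : set (set T) :=
  [set E | exists (N : nat) (c : nat -> @cyl_param R), [/\ forall k, cyl_param_ok (c k),
     forall k, ~ (I k /\ (k < N)%N) -> c k = triv_cyl &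
     E = [set w | forall k, cyl k (c k) w]]].

Lemma gen_sub_pi I : gen I `<=` pi_gen I.
Proof.
move=> E [k [c [Ik [okc ->]]]].
exists k.+1, (fun j => if j == k then c else triv_cyl); split.
- by move=> j; case: ifP => _ //; exact: cyl_param_ok_triv.
- by move=> j nj; case: eqP => // jk; case: nj; rewrite jk.
- apply/seteqP; split => w /=.
    by move=> h j; case: eqP => [->//|_]; rewrite cyl_triv.
  by move=> /(_ k); rewrite eqxx.
Qed.

(** Every range [M >= N] is allowed because the extra cylinders are trivial; two events with
    different bounds can thus be written over a common range. *)
Lemma pi_gen_prob I E : pi_gen I E -> exists N, exists2 c,
  E = [set w | forall k, cyl k (c k) w] &
  [/\ forall k, cyl_param_ok (c k), forall k, ~ (I k /\ (k < N)%N) -> c k = triv_cyl &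
      forall M, (N <= M)%N -> P E = (\prod_(k < M) fine (P (cyl k (c k))))%:E].
Proof.
move=> [N [c [okc tc ->]]]; exists N, c => //; split => // M NM.
have [_ /(_ (iota 0 M) c (iota_uniq _ _) okc)] := iid.
have <- : [set w | forall k, cyl k (c k) w] =
         [set w | forall k, k \in iota 0 M -> cyl k (c k) w].
  apply/seteqP; split => w /= h k; first by move=> _; exact: h.
  have [kM|Mk] := ltnP k M; first by apply: h; rewrite mem_iota.
  rewrite tc ?cyl_triv// => -[_ kN]; move: (leq_trans kN NM).
  by rewrite ltnNge Mk.
move=> e; have -> : \prod_(k < M) fine (P (cyl k (c k))) =
  \prod_(k <- iota 0 M) fine (P (cyl k (c k))).
  by rewrite -(big_mkord xpredT (fun k => fine (P (cyl k (c k)))))/= /index_iota subn0.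
rewrite -[RHS]/((_ : R)%:E) -e fineK// fin_num_measure//.
rewrite (_ : [set _ | _] = \bigcap_k cyl k (c k)).
  by apply: bigcap_measurable => [|k _]; [exists 0%N|exact: measurable_cyl].
by apply/seteqP; split => w h k; [move=> _|]; apply: h.
Qed.

Lemma measurable_pi_gen I : pi_gen I `<=` measurable.
Proof.
move=> E [N [c [okc tc ->]]].
rewrite (_ : [set _ | _] = \bigcap_k cyl k (c k)).
  by apply: bigcap_measurable => [|k _]; [exists 0%N|exact: measurable_cyl].
by apply/seteqP; split => w h k; [move=> _|]; apply: h.
Qed.

Lemma pi_genT I : pi_gen I setT.
Proof.
exists 0%N, (fun=> triv_cyl); split; [|by []|].
  by move=> k; exact: cyl_param_ok_triv.
by apply/seteqP; split => // w _ k; rewrite cyl_triv.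
Qed.

Lemma setI_closed_pi_gen I : setI_closed (pi_gen I).
Proof.
move=> _ _ [N [c [okc tc ->]]] [N' [c' [okc' tc' ->]]].
exists (maxn N N'), (fun k => capc (c k) (c' k)); split.
- by move=> k; exact: cyl_param_ok_cap.
- move=> k nk; rewrite tc ?tc' ?capc_triv// => -[Ik kN]; apply: nk; split => //.
    by rewrite leq_max kN orbT.
  by rewrite leq_max kN.
- apply/seteqP; split => w /=.
    by move=> [h h'] k; rewrite cyl_capc; split.
  by move=> h; split => k; have := h k; rewrite cyl_capc => -[].
Qed.

(** At each time at least one of the two cylinders is trivial, by disjointness, so the product over
    a common range splits factor by factor. *)
Lemma pi_gen_indep I J E F : (forall k, I k -> J k -> False) ->
  pi_gen I E -> pi_gen J F -> P (E `&` F) = (P E * P F)%E.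
Proof.
move=> IJ piE piF.
have [N [c Ee [okc tc pE]]] := pi_gen_prob piE.
have [M [c' Fe [okc' tc' pF]]] := pi_gen_prob piF.
have piEF : pi_gen (I `|` J) (E `&` F).
  apply: setI_closed_pi_gen.
    by exists N, c; split => // k nk; apply: tc => -[? ?]; apply: nk; split => //; left.
  by exists M, c'; split => // k nk; apply: tc' => -[? ?]; apply: nk; split => //; right.
rewrite (pE (maxn N M)) ?leq_maxl// (pF (maxn N M)) ?leq_maxr// -EFinM -big_split/=.
have [_ /(_ (iota 0 (maxn N M)) (fun k => capc (c k) (c' k)) (iota_uniq _ _)
  (fun k => cyl_param_ok_cap (okc k) (okc' k)))] := iid.
have <- : E `&` F =
  [set w | forall k, k \in iota 0 (maxn N M) -> cyl k (capc (c k) (c' k)) w].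
  rewrite Ee Fe; apply/seteqP; split => w /=.
    by move=> [h h'] k _; rewrite cyl_capc; split.
  move=> h; split => k.
    have [kM|Mk] := ltnP k (maxn N M).
      by have := h k; rewrite mem_iota cyl_capc => /(_ kM) [].
    rewrite tc ?cyl_triv// => -[_ kN]; move: Mk; rewrite geq_max leqNgt kN//.
  have [kM|Mk] := ltnP k (maxn N M).
    by have := h k; rewrite mem_iota cyl_capc => /(_ kM) [].
  by rewrite tc' ?cyl_triv// => -[_ kN]; move: Mk; rewrite geq_max => /andP[_]; rewrite leqNgt kN.
move=> e.
rewrite -[LHS]fineK; last first.
  by rewrite fin_num_measure//; exact: measurable_pi_gen piEF.
rewrite e; congr (_%:E).
rewrite -[RHS](big_mkord xpredT
  (fun k => fine (P (cyl k (c k))) * fine (P (cyl k (c' k)))))/= /index_iota subn0.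
apply: eq_bigr => k _; rewrite -/cyl cyl_capc.
have [Ik|nIk] := pselect (I k).
  by rewrite (tc' k) ?cyl_triv ?setIT ?probability_setT/= ?mulr1// => -[/IJ]; exact.
by rewrite (tc k) ?cyl_triv ?setTI ?probability_setT/= ?mul1r// => -[].
Qed.

Lemma sigma_gen_sub_pi I : <<s gen I >> `<=` <<s pi_gen I >>.
Proof. by apply: sub_smallest2r; [exact: smallest_sigma_algebra|exact: gen_sub_pi]. Qed.

Lemma sigma_gen_measurable I : <<s gen I >> `<=` measurable.
Proof.
apply: smallest_sub; first exact: sigma_algebra_measurable.
by apply: subset_trans (@gen_sub_pi I) (@measurable_pi_gen I).
Qed.

Lemma sigma_gen_mono I J : I `<=` J -> <<s gen I >> `<=` <<s gen J >>.
Proof.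
move=> IJ; apply: sub_smallest2r; first exact: smallest_sigma_algebra.
by move=> E [k [c [Ik h]]]; exists k, c; split => //; exact: IJ.
Qed.

(** The finite measures [P] restricted to [E] and [P] scaled by [P E] agree on a pi-system that
    contains the whole space, hence on the sigma-algebra generated by it. *)
Lemma pi_sigma_indep I E F : measurable E ->
  (forall F', pi_gen I F' -> P (F' `&` E) = (P E * P F')%E) ->
  <<s gen I >> F -> P (F `&` E) = (P E * P F)%E.
Proof.
move=> mE EF /(@sigma_gen_sub_pi I) sF.
have fE : (0 <= fine (P E))%R by rewrite fine_ge0// measure_ge0.
have := @g_sigma_algebra_measure_unique _ R T (pi_gen I) (@measurable_pi_gen I)
  (fun=> setT) (fun=> pi_genT I) _ (mrestr P mE) (mscale (NngNum fE) P)
  (@setI_closed_pi_gen I) _ _ F sF.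
have mE' X : mscale (NngNum fE) P X = (P E * P X)%E.
  by rewrite /mscale/= fineK// fin_num_measure.
have rE X : mrestr P mE X = P (X `&` E) by [].
move=> H; rewrite -rE -mE'; apply: H.
- by rewrite bigcup_const//; exists 0%N.
- by move=> X piX; apply: etrans (EF _ piX) (esym (mE' X)).
- move=> _; rewrite -[X in (X < _)%E]/(P (setT `&` E)) setTI.
  by rewrite (le_lt_trans (probability_le1 P mE))// ltry.
Qed.

Lemma sigma_gen_indep I J E F : (forall k, I k -> J k -> False) ->
  <<s gen I >> E -> <<s gen J >> F -> P (E `&` F) = (P E * P F)%E.
Proof.
move=> IJ sE sF.
have mE := sigma_gen_measurable sE; have mF := sigma_gen_measurable sF.
rewrite muleC; apply: (pi_sigma_indep mF) sE => E' piE'.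
rewrite setIC muleC; apply: pi_sigma_indep sF; first exact: measurable_pi_gen piE'.
by move=> F' piF'; rewrite setIC; exact: (pi_gen_indep IJ).
Qed.

End Cylinders.

(** * Integrating out one tuple while the others are held fixed *)

Section Freezing.
Context {R : realType} {d : measure_display} {T : measurableType d}.
Variable P : probability T R.
Variables (Psi : nat -> T -> R -> R) (A B D : nat -> T -> R).
Hypothesis mmodel : measurable_model Psi A B D.
Hypothesis iid : iid_tuples P Psi A B D.

(** The sample space with the smaller sigma-algebra of the tuples indexed by [I]: measurability with
    respect to past or future becomes ordinary measurability on another type. *)
Definition sigmaT (I : set nat) := g_sigma_algebraType (gen Psi A B D I).

Definition ABD (k : nat) (w : T) : R * R * R := (A k w, B k w, D k w).

Lemma measurable_to_sigmaT I : measurable_fun setT (id : T -> sigmaT I).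
Proof. by move=> _ Y mY; rewrite setTI; exact: sigma_gen_measurable mmodel _ _ mY. Qed.

Lemma measurable_from_sigmaT I d' (T' : measurableType d') (f : T -> T') :
  measurable_fun setT (f : sigmaT I -> T') -> measurable_fun setT f.
Proof. by move=> mf _ Y mY; apply: sigma_gen_measurable mmodel _ _ _; exact: mf. Qed.

Lemma measurable_sigmaT_mono I J d' (T' : measurableType d') (f : T -> T') :
  I `<=` J -> measurable_fun setT (f : sigmaT I -> T') ->
  measurable_fun setT (f : sigmaT J -> T').
Proof.
by move=> IJ mf _ Y mY; apply: (sigma_gen_mono IJ); exact: mf.
Qed.

Lemma measurable_sigmaT_of (I : set nat) k (f : T -> R) (g : set R -> @cyl_param R) :
  I k -> (forall Y, measurable Y -> cyl_param_ok (g Y)) ->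
  (forall Y, f @^-1` Y = cyl Psi A B D k (g Y)) ->
  measurable_fun setT (f : sigmaT I -> R).
Proof.
move=> Ik okg fg _ Y mY; rewrite setTI; apply: sub_sigma_algebra.
by exists k, (g Y); split => //; split; [exact: okg|rewrite -fg].
Qed.

Lemma measurable_sigmaT_A (I : set nat) k : I k ->
  measurable_fun setT (A k : sigmaT I -> R).
Proof.
move=> Ik; apply: (measurable_sigmaT_of (g := fun Y => ([::], Y, setT, setT)) Ik) => Y.
  by move=> mY; split.
by apply/seteqP; split => w //= [_ []].
Qed.

Lemma measurable_sigmaT_B (I : set nat) k : I k ->
  measurable_fun setT (B k : sigmaT I -> R).
Proof.
move=> Ik; apply: (measurable_sigmaT_of (g := fun Y => ([::], setT, Y, setT)) Ik) => Y.
  by move=> mY; split.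
by apply/seteqP; split => w //= [_ [_ []]].
Qed.

Lemma measurable_sigmaT_D (I : set nat) k : I k ->
  measurable_fun setT (D k : sigmaT I -> R).
Proof.
move=> Ik; apply: (measurable_sigmaT_of (g := fun Y => ([::], setT, setT, Y)) Ik) => Y.
  by move=> mY; split.
by apply/seteqP; split => w //= [_ [_ []]].
Qed.

Lemma measurable_sigmaT_Psi (I : set nat) k t : I k ->
  measurable_fun setT ((fun w => Psi k w t) : sigmaT I -> R).
Proof.
move=> Ik; apply: (measurable_sigmaT_of (g := fun Y => ([:: (t, Y)], setT, setT, setT)) Ik) => Y.
  by move=> mY; split => //= -[].
apply/seteqP; split => w /=; first by move=> Yt; split => // -[].
by move=> [/(_ 0%N isT)].
Qed.

Lemma measurable_sigmaT_ABD (I : set nat) k : I k ->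
  measurable_fun setT (ABD k : sigmaT I -> R * R * R).
Proof.
move=> Ik; apply: measurable_fun_pair; last exact: measurable_sigmaT_D.
by apply: measurable_fun_pair; [exact: measurable_sigmaT_A|exact: measurable_sigmaT_B].
Qed.

Lemma measurable_ABD k : measurable_fun setT (ABD k).
Proof. exact: (measurable_from_sigmaT (@measurable_sigmaT_ABD setT k Logic.I)). Qed.

Definition box3 : set (set (R * R * R)) :=
  [set S | exists a b c, [/\ measurable a, measurable b, measurable c & S = a `*` b `*` c]].

Lemma measurable_box3 : measurable `<=` <<s box3 >>.
Proof.
have m3 : measurable_fun setT (id : g_sigma_algebraType box3 -> R * R * R).
  have H (f : R * R * R -> R) : (forall Y, measurable Y -> box3 (f @^-1` Y)) ->
    measurable_fun setT (f : g_sigma_algebraType box3 -> R).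
    by move=> h _ Y mY; rewrite setTI; apply: sub_sigma_algebra; exact: h.
  have -> : id = fun x : R * R * R => ((fst \o fst) x, (snd \o fst) x, snd x).
    by apply/funext => -[[]].
  apply: measurable_fun_pair; first apply: measurable_fun_pair; apply: H => Y mY.
  - exists Y, setT, setT; split => //.
    by apply/seteqP; split => -[[a b] c] //= [[]].
  - exists setT, Y, setT; split => //.
    by apply/seteqP; split => -[[a b] c] //= [[]].
  - exists setT, setT, Y; split => //.
    by apply/seteqP; split => -[[a b] c] //= [[]].
by move=> S mS; have := m3 measurableT S mS; rewrite setTI.
Qed.

(** Boxes are cylinders without a constraint on [Psi], where equality in law is assumed; they form a
    generating pi-system. *)
Lemma law_ABD k S : measurable S -> P (ABD k @^-1` S) = P (ABD 0 @^-1` S).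
Proof.
move=> mS.
have mX j := isMeasurableFun.Build _ _ _ _ (ABD j) (@measurable_ABD j).
pose X j : {mfun T >-> (R * R * R)%type} := HB.pack (ABD j) (mX j).
apply: (@g_sigma_algebra_measure_unique _ R _ box3 _ (fun=> setT) _ _
  (distribution P (X k)) (distribution P (X 0%N)) _ _ _ S (measurable_box3 mS)).
- by move=> _ [a [b [c [ma mb mc ->]]]]; apply: measurableX => //; exact: measurableX.
- by move=> _; exists setT, setT, setT; split => //; apply/seteqP; split.
- by rewrite bigcup_const//; exists 0%N.
- move=> _ _ [a [b [c [ma mb mc ->]]]] [a' [b' [c' [ma' mb' mc' ->]]]].
  exists (a `&` a'), (b `&` b'), (c `&` c'); split; try exact: measurableI.
  by apply/seteqP; split => -[[x y] z] /=; tauto.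
- move=> _ [a [b [c [ma mb mc ->]]]].
  have E j : distribution P (X j) (a `*` b `*` c) = P (cyl Psi A B D j ([::], a, b, c)).
    congr (P _); apply/seteqP; split => w /=; first by move=> [[? ?] ?]; split.
    by move=> [_ [? [? ?]]].
  apply: etrans (E k) (etrans _ (esym (E 0%N))).
  by apply: iid.1; split.
- by move=> _; rewrite -[X in (X < _)%E]/(P setT) probability_setT ltry.
Qed.

(** By independence the pair of the identity into [sigmaT I] and tuple [j] has a product law, so
    Tonelli applies. The inner integral is over [P] itself with tuple 0, which has the law of tuple
    [j]. *)
Lemma freezing (I : set nat) j (f : sigmaT I * (R * R * R) -> \bar R) : ~ I j ->
  measurable_fun setT f -> (forall x, 0 <= f x)%E ->
  (\int[P]_w f (w, ABD j w) = \int[P]_w \int[P]_w' f (w, ABD 0 w'))%E.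
Proof.
move=> nIj mf f0.
have mX0 := isMeasurableFun.Build _ _ _ _ (ABD 0) (@measurable_ABD 0).
pose X0 : {mfun T >-> (R * R * R)%type} := HB.pack (ABD 0) mX0.
have mI := isMeasurableFun.Build _ _ _ _ (id : T -> sigmaT I) (@measurable_to_sigmaT I).
pose J : {mfun T >-> sigmaT I} := HB.pack (id : T -> sigmaT I) mI.
have mpair : @measurable_fun _ _ T (sigmaT I * (R * R * R))%type setT
      (fun w => (w, ABD j w)).
  by apply: measurable_fun_pair; [exact: measurable_to_sigmaT|exact: measurable_ABD].
have mV := isMeasurableFun.Build _ _ _ _ _ mpair.
pose V : {mfun T >-> (sigmaT I * (R * R * R))%type} := HB.pack (fun w : T => (w, ABD j w) : sigmaT I * (R * R * R)) mV.
have <- : (\int[distribution P V]_y f y = \int[P]_w f (w, ABD j w))%E.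
  by rewrite ge0_integral_distribution.
pose m1 := distribution P J; pose m2 := distribution P X0.
transitivity (\int[m1 \x m2]_y f y)%E.
  apply: eq_measure_integral => S mS _.
  apply: (esym (product_measure_unique _ mS)) => E F mE mF.
  rewrite -[RHS]/(P E * P (ABD 0 @^-1` F))%E -(law_ABD j)//.
  rewrite -[LHS]/(P ((fun w => (w, ABD j w)) @^-1` (E `*` F))).
  rewrite [X in P X](_ : _ = E `&` (ABD j @^-1` F)); last first.
    by apply/seteqP; split.
  apply: (sigma_gen_indep mmodel iid (I := I) (J := [set j])).
  - by move=> k Ik /= kj; apply: nIj; rewrite -kj.
  - exact: mE.
  - have := @measurable_sigmaT_ABD [set j] j erefl measurableT F mF.
    by rewrite setTI.
rewrite fubini_tonelli1//.
rewrite /fubini_F/= ge0_integral_distribution//=.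
- apply: eq_integral => w _ /=; rewrite ge0_integral_distribution//.
  exact: measurableT_comp mf (measurable_pair1 _).
- exact: measurable_fun_fubini_tonelli_F.
- by move=> y; apply: integral_ge0.
Qed.

End Freezing.

(** * Measurability of random compositions and of pointwise limits *)

Section Composition.
Context {R : realType}.

Lemma Lip_lt_pinfty (f : R -> R) : (Lip f < +oo)%E ->
  exists2 L, 0 <= L & forall x y, `|f x - f y| <= L * `|x - y|.
Proof.
move=> Lf.
have L0 : (0 <= Lip f)%E.
  apply: le_trans (ereal_sup_ubound (_ : _ (`|f 0 - f 1| / `|0 - 1|)%:E)).
    by rewrite lee_fin divr_ge0.
  by exists (0, 1) => //=; rewrite eq_sym oner_eq0.
have Lfin : (Lip f)%E \is a fin_num by rewrite ge0_fin_numE.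
exists (fine (Lip f)); first exact: fine_ge0.
move=> x y; have [->|xy] := eqVneq x y; first by rewrite !subrr normr0 mulr0.
rewrite -ler_pdivrMr ?normr_gt0 ?subr_eq0// -lee_fin fineK//.
by apply: ereal_sup_ubound; exists (x, y).
Qed.

Lemma floor_approx (x : R) m :
  x - m.+1%:R^-1 <= (Num.floor (x * m.+1%:R))%:~R / m.+1%:R <= x.
Proof.
have m0 : (0 : R) < m.+1%:R by rewrite ltr0n.
have /andP[h1 h2] := floor_itv (x * m.+1%:R).
rewrite ler_pdivrMr// h1 andbT ler_pdivlMr// mulrBl mulVf ?gt_eqF//.
by rewrite lerBlDr -[1]/(1%:~R : R) -intrD ltW.
Qed.

(** Rounding [X] down to a multiple of [1 / (m + 1)] leaves countably many arguments, each
    measurable by hypothesis; Lipschitz continuity gives convergence as [m] grows. *)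
Lemma caratheodory_comp d (T : measurableType d) (f : T -> R -> R) (X : T -> R) :
  (forall t, measurable_fun setT (f ^~ t)) -> (forall w, (Lip (f w) < +oo)%E) ->
  measurable_fun setT X -> measurable_fun setT (fun w => f w (X w)).
Proof.
move=> mf Lf mX.
pose h m w := f w ((Num.floor (X w * m.+1%:R))%:~R / m.+1%:R).
apply: (@measurable_fun_cvg _ _ _ _ h).
  move=> m _ Y mY; rewrite setTI.
  rewrite (_ : _ @^-1` Y = \bigcup_(z : int) ((X @^-1` [set t | z%:~R <= t * m.+1%:R < (z + 1)%:~R]) `&`
      ((f ^~ (z%:~R / m.+1%:R)) @^-1` Y))); last first.
    apply/seteqP; split => w /=.
      move=> hw; exists (Num.floor (X w * m.+1%:R)) => //; split => //=.
      by have := floor_itv (X w * m.+1%:R).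
    by move=> [z _ [/= /floor_def e] ]; rewrite /h e.
  apply: countable_bigcupT_measurable => // z.
  apply: measurableI; rewrite -[X in measurable X]setTI; last exact: mf.
  apply: mX => //.
  have mm : measurable_fun setT (fun t : R => t * m.+1%:R).
    by apply: measurable_funM => //.
  have := mm measurableT `[z%:~R, (z+1)%:~R[%classic (measurable_itv _).
  by rewrite setTI; congr measurable; apply/seteqP; split => t /=; rewrite in_itv.
move=> w _.
have [L L0 HL] := Lip_lt_pinfty (Lf w).
apply/cvgrPdist_le => e e0.
have := @cvg_harmonic R => /cvgrPdist_lt /(_ (e / (L + 1))).
have L1 : 0 < L + 1 by rewrite ltr_wpDl.
rewrite divr_gt0// => /(_ isT); apply: filterS => m.
rewrite sub0r normrN ger0_norm ?harmonic_ge0// => hm.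
apply: (le_trans (HL _ _)).
have /andP[h1 h2] := floor_approx (X w) m.
rewrite ger0_norm ?subr_ge0//.
apply: (@le_trans _ _ ((L + 1) * m.+1%:R^-1)).
  apply: ler_pM => //; first by rewrite subr_ge0.
    by rewrite lerDl.
  by rewrite lerBlDr -lerBlDl.
by rewrite mulrC -ler_pdivlMr// ltW.
Qed.

(** [limn] has the default value [point] where the sequence has no limit, so the event is split
    according to whether upper and lower limits agree. It is used for [Zlim], whose sequence is
    monotone only almost surely. *)
Lemma measurable_lt_limn d (T : measurableType d) (u : nat -> T -> \bar R) (x : \bar R) :
  (forall n, measurable_fun setT (u n)) ->
  measurable [set w | (x < limn (fun n => u n w))%E].
Proof.
move=> mu.
pose S w := limn_esup (u ^~ w); pose I w := limn_einf (u ^~ w).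
have mS : measurable_fun setT S by exact: measurable_fun_limn_esup.
have mI : measurable_fun setT I.
  rewrite /I /limn_einf; apply: measurableT_comp => //.
  by apply: measurable_fun_limn_esup => n; exact: measurableT_comp.
have cvgE w : S w = I w -> limn (u ^~ w) = S w.
  rewrite /S /I limn_esup_lim limn_einf_lim => SI; apply/cvg_lim => //.
  apply: (@squeeze_cvge _ _ _ _ (einfs (u ^~ w)) (u ^~ w) (esups (u ^~ w))).
  - apply: nearW => n; apply/andP; split.
      by apply: ereal_inf_lbound; exists n => /=.
    by apply: ereal_sup_ubound; exists n => /=.
  - by rewrite SI; exact: is_cvg_einfs.
  - exact: is_cvg_esups.
have ncvgE w : S w != I w -> limn (u ^~ w) = point.
  move=> SI; apply: getPN => l ul.
  by move/eqP: SI; apply; rewrite /S /I; have [-> ->] := cvg_limn_einf_sup ul.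
have -> : [set w | (x < limn (fun n => u n w))%E] =
    ([set w | S w = I w] `&` [set w | (x < S w)%E]) `|`
    ([set w | S w != I w] `&` [set w | (x < point)%E]).
  apply/seteqP; split => w /=.
    have [SI|SI] := eqVneq (S w) (I w); first by rewrite cvgE// => h; left.
    by rewrite ncvgE// => h; right.
  by move=> [[SI h]|[SI h]]; [rewrite cvgE|rewrite ncvgE].
apply: measurableU; apply: measurableI.
- by rewrite -[X in measurable X]setTI; exact: measurable_eqe.
- by rewrite -[X in measurable X]setTI; apply: measurable_lte => //; exact: measurable_cst.
- by rewrite -[X in measurable X]setTI; exact: measurable_neqe.
- have [h|h] := pselect (x < point :> \bar R)%E.
    by rewrite (_ : [set _ | _] = setT)//; apply/seteqP; split.
  by rewrite (_ : [set _ | _] = set0)//; apply/seteqP; split.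
Qed.

End Composition.

(** * Partial iterations and the perpetuity as functions of a block of tuples *)

Section ModelMeasurability.
Context {R : realType} {d : measure_display} {T : measurableType d}.
Variables (Psi : nat -> T -> R -> R) (A B D : nat -> T -> R).
Hypothesis LipPsi : forall n w, (Lip (Psi n w) < +oo)%E.

(** [Zfrom 0 n] is [Zn n]; a free starting index allows induction by removing the outermost map. *)
Definition Zfrom (j n : nat) (w : T) : R := foldr (fun k z => Psi k w z) 0 (iota j n).

Lemma measurable_Zfrom (I : set nat) j n : (forall k, (j <= k < j + n)%N -> I k) ->
  measurable_fun setT (Zfrom j n : sigmaT Psi A B D I -> R).
Proof.
elim: n j => [|n IH] j Ik; first exact: measurable_cst.
apply: (@caratheodory_comp R _ (sigmaT Psi A B D I) (Psi j) (Zfrom j.+1 n)).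
- by move=> t; apply: measurable_sigmaT_Psi; apply: Ik; rewrite leqnn addnS ltnS leq_addr.
- by move=> w; exact: LipPsi.
- by apply: IH => k /andP[jk kn]; apply: Ik; rewrite ltnW//= addnS -addSn.
Qed.

Definition drift_b (k : nat) (w : T) : R := Num.max (D k w - B k w) 0.

(* The perpetuity by which the lower bound A z + B - D on each Psi lets the
   iteration fall short of the product of the A's (see [foldr_Psi_ge]). *)
Definition perp (j n : nat) (w : T) : R :=
  foldr (fun k r => Num.max (A k w) 0 * r + drift_b k w) 0 (iota j n).

Lemma drift_b_ge0 k w : 0 <= drift_b k w.
Proof. by rewrite le_max lexx orbT. Qed.

Lemma perp_ge0 j n w : 0 <= perp j n w.
Proof.
rewrite /perp; elim: (iota j n) => //= k s IH.
by rewrite addr_ge0 ?mulr_ge0// ?drift_b_ge0// le_max lexx orbT.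
Qed.

Lemma perpSr j n w : perp j n w <= perp j n.+1 w.
Proof.
elim: n j => [|n IH] j; first exact: (perp_ge0 j 1 w).
by rewrite [leLHS]/= [leRHS]/= lerD2r ler_wpM2l//; [rewrite le_max lexx orbT|exact: IH].
Qed.

Lemma measurable_perp (I : set nat) j n : (forall k, (j <= k < j + n)%N -> I k) ->
  measurable_fun setT (perp j n : sigmaT Psi A B D I -> R).
Proof.
elim: n j => [|n IH] j Ik; first exact: measurable_cst.
have Ij : I j by apply: Ik; rewrite leqnn addnS ltnS leq_addr.
apply: measurable_funD; last first.
  apply: measurable_maxr; last exact: measurable_cst.
  by apply: measurable_funB; [exact: measurable_sigmaT_D|exact: measurable_sigmaT_B].
apply: measurable_funM.
  by apply: measurable_maxr; [exact: measurable_sigmaT_A|exact: measurable_cst].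
by apply: IH => k /andP[jk kn]; apply: Ik; rewrite ltnW//= addnS -addSn.
Qed.

End ModelMeasurability.

(** The logarithm of [1 + a + b <= 3 max(1, a) max(1, b)]. *)
Lemma ln1D_le {R : realType} (a b : R) : 0 <= a -> 0 <= b ->
  ln (1 + a + b) <= ln 3 + (Num.max (ln a) 0 + Num.max (ln b) 0).
Proof.
have maxE (c : R) : 0 <= c -> 1 <= expR (Num.max (ln c) 0) /\ c <= expR (Num.max (ln c) 0).
  move=> c0; split; first by rewrite -expR0 ler_expR le_max lexx orbT.
  move: c0; rewrite le_eqVlt => /predU1P[<-|c0]; first exact: expR_ge0.
  by rewrite -[leLHS]lnK// ler_expR le_max lexx.
move=> a0 b0; have [ha1 ha] := maxE _ a0; have [hb1 hb] := maxE _ b0.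
have e : ln 3 + (Num.max (ln a) 0 + Num.max (ln b) 0) =
  ln (3 * (expR (Num.max (ln a) 0) * expR (Num.max (ln b) 0))).
  by rewrite lnM ?posrE ?mulr_gt0 ?expR_gt0// lnM ?posrE ?expR_gt0// !expRK.
rewrite e ler_ln ?posrE ?mulr_gt0 ?expR_gt0 -?addrA ?ltr_pwDl ?addr_ge0//.
by set u := expR _ in ha1 ha *; set v := expR _ in hb1 hb *; nra.
Qed.

(** * Tightness of the perpetuity under a negative logarithmic drift *)

Section Perpetuity.
Context {R : realType} {d : measure_display} {T : measurableType d}.
Variable P : probability T R.
Variables (Psi : nat -> T -> R -> R) (A B D : nat -> T -> R).
Hypothesis mmodel : measurable_model Psi A B D.
Hypothesis iid : iid_tuples P Psi A B D.
Hypothesis A_gt0 : {ae P, forall w, 0 < A 0 w}.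
Hypothesis lnA_neg : (\int[P]_w (Num.max (- ln (A 0 w)) 0)%:E < +oo)%E.
Hypothesis lnA_pos : (\int[P]_w (Num.max (ln (A 0 w)) 0)%:E < +oo)%E.
Hypothesis lnA_mean : (\int[P]_w (ln (A 0 w))%:E < 0)%E.
Hypothesis logBD : (\int[P]_w (logp `|B 0 w - D 0 w|)%:E < +oo)%E.

Let a w := Num.max (A 0 w) 0.
Let b := drift_b B D 0.

Let a_ge0 w : 0 <= a w. Proof. by rewrite le_max lexx orbT. Qed.
Let b_ge0 w : 0 <= b w. Proof. exact: drift_b_ge0. Qed.
Let mA : measurable_fun setT (A 0). Proof. by case: mmodel => _ []. Qed.
Let mB : measurable_fun setT (B 0). Proof. by case: mmodel => _ [_ []]. Qed.
Let mD : measurable_fun setT (D 0). Proof. by case: mmodel => _ [_ []]. Qed.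
Let ma : measurable_fun setT a.
Proof. by apply: measurable_maxr => //; exact: measurable_cst. Qed.
Let mb : measurable_fun setT b.
Proof. by apply: measurable_maxr; [exact: measurable_funB|exact: measurable_cst]. Qed.

Let ln_a w : ln (a w) = ln (A 0 w).
Proof. by rewrite /a; case: leP => // A0; rewrite !ln0. Qed.

(** An integrable majorant of [ln (1 + a + b)], and thereby of every [f k]. *)
Let G w : R := ln 3 + (Num.max (ln (A 0 w)) 0 + logp `|B 0 w - D 0 w|).

Let mlnA : measurable_fun setT (fun w => ln (A 0 w)).
Proof. exact: measurableT_comp (@measurable_ln R) mA. Qed.

Let mlogBD : measurable_fun setT (fun w => logp `|B 0 w - D 0 w|).
Proof.
apply: measurable_maxr; last exact: measurable_cst.
apply: measurableT_comp (@measurable_ln R) _; apply: measurableT_comp => //.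
exact: measurable_funB.
Qed.

Let ge0_integrable (f : T -> R) : measurable_fun setT f -> (forall w, 0 <= f w) ->
  (\int[P]_w (f w)%:E < +oo)%E -> P.-integrable setT (EFin \o f).
Proof.
move=> mf f0 foo; apply/integrableP; split; first exact/measurable_EFinP.
by under eq_integral do rewrite /= ger0_norm//.
Qed.

Lemma integrable_lnA : P.-integrable setT (fun w => (ln (A 0 w))%:E).
Proof.
have i1 : P.-integrable setT (EFin \o (fun w => Num.max (ln (A 0 w)) 0)).
  apply: ge0_integrable => //; last by move=> w; rewrite le_max lexx orbT.
  by apply: measurable_maxr => //; exact: measurable_cst.
have i2 : P.-integrable setT (EFin \o (fun w => Num.max (- ln (A 0 w)) 0)).
  apply: ge0_integrable => //; last by move=> w; rewrite le_max lexx orbT.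
  apply: measurable_maxr; [exact: measurableT_comp|exact: measurable_cst].
apply: eq_integrable (integrableB measurableT i1 i2) => // w _ /=.
rewrite -EFinB; congr (_%:E).
set x := ln _; have [x0|x0] := leP x 0.
  by rewrite max_l ?oppr_ge0// sub0r opprK.
by rewrite max_r ?subr0// oppr_le0 ltW.
Qed.

Let integrable_G : P.-integrable setT (EFin \o G).
Proof.
have i1 : P.-integrable setT (EFin \o (fun w => Num.max (ln (A 0 w)) 0)).
  apply: ge0_integrable => //; last by move=> w; rewrite le_max lexx orbT.
  by apply: measurable_maxr => //; exact: measurable_cst.
have i2 : P.-integrable setT (EFin \o (fun w => logp `|B 0 w - D 0 w|)).
  by apply: ge0_integrable => // w; rewrite le_max lexx orbT.
have i3 := finite_measure_integrable_cst P (ln 3 : R) measurableT.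
by have := integrableD measurableT i3 (integrableD measurableT i1 i2).
Qed.

Let ln1ab_le w : ln (1 + a w + b w) <= G w.
Proof.
apply: le_trans (ln1D_le (a_ge0 w) (b_ge0 w)) _.
rewrite /G ln_a lerD2l lerD2l /logp ge_max [X in _ && X]le_max lexx orbT andbT.
have : b w <= `|B 0 w - D 0 w|.
  by rewrite /b /drift_b ge_max normr_ge0 andbT -opprB -normrN ler_norm.
have [b0 bBD|b0 _] := ltP 0 (b w); last by rewrite ln0// le_max lexx orbT.
by rewrite le_max ler_ln ?posrE ?bBD// (lt_le_trans b0).
Qed.

(** For [r >= k] one has [1 + a r + b <= (1 + r) (a + (1 + b) / (1 + k))], so [f k] bounds the
    increment of [ln (1 + r)] above level [k]; as [k] grows it tends to [ln (A 0)] wherever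
    [A 0 > 0]. *)
Let f k w : R := ln (a w + (1 + b w) / (1 + k%:R)).

Let f_arg_gt0 k w : 0 < a w + (1 + b w) / (1 + k%:R).
Proof. by rewrite ltr_wpDl// divr_gt0// ltr_pwDl. Qed.

Let mf k : measurable_fun setT (f k).
Proof.
apply: measurableT_comp (@measurable_ln R) _; apply: measurable_funD => //.
by apply: measurable_funM; [apply: measurable_funD|]; exact: measurable_cst || exact: mb.
Qed.

Let f_le k w : f k w <= ln (1 + a w + b w).
Proof.
have k1 : (0 : R) < 1 + k%:R by rewrite ltr_pwDl.
rewrite ler_ln ?posrE// -?addrA ?ltr_pwDl ?addr_ge0//.
rewrite [leRHS]addrCA lerD2l ler_pdivrMr// ler_peMr ?addr_ge0//.
by rewrite lerDl.
Qed.

Let f_ge k w : - ln (1 + k%:R) <= f k w.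
Proof.
have k1 : (0 : R) < 1 + k%:R by rewrite ltr_pwDl.
rewrite -lnV ?posrE// ler_ln ?posrE ?invr_gt0// ler_wpDl//.
by rewrite -[leLHS]mul1r ler_wpM2r ?invr_ge0 ?(ltW k1)// lerDl.
Qed.

Let ln1ab_ge0 w : 0 <= ln (1 + a w + b w).
Proof. by rewrite ln_ge0// -addrA lerDl addr_ge0. Qed.

Let integrable_f k : P.-integrable setT (EFin \o f k).
Proof.
have i3 := finite_measure_integrable_cst P (ln (1 + k%:R) : R) measurableT.
apply: le_integrable (integrableD measurableT i3 integrable_G) => //.
  by apply/measurable_EFinP; exact: mf.
move=> w _ /=; rewrite lee_fin.
have h1 := f_le k w; have h2 := f_ge k w; have h3 := ln1ab_le w; have h4 := ln1ab_ge0 w.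
have h5 : 0 <= ln (1 + k%:R : R) by rewrite ln_ge0// lerDl.
rewrite [leRHS]ger0_norm; last lra.
by rewrite ler_norml; apply/andP; split; lra.
Qed.

(** Dominated convergence: the integrals tend to the negative mean of [ln (A 0)], with the bound
    [ln (A 0) <= f k <= G] giving the majorant. *)
Lemma drift_negative : exists k, (\int[P]_w (f k w)%:E < 0)%E.
Proof.
have cv : {ae P, forall w, [set: T] w -> (f k w)%:E @[k --> \oo] --> (ln (A 0 w))%:E}.
  apply: filterS A_gt0 => w A0 _; apply: cvg_EFin; first exact: nearW.
  have -> : ln (A 0 w) = ln (a w + (1 + b w) * 0) by rewrite mulr0 addr0 ln_a.
  have c1 : a w + (1 + b w) / (1 + k%:R) @[k --> \oo] --> a w + (1 + b w) * 0.
    apply: cvgD; first exact: cvg_cst.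
    apply: cvgMr; rewrite (_ : (fun k => _) = harmonic); first exact: cvg_harmonic.
    by apply/funext => k; rewrite /= nat1r.
  have c2 : {for (a w + (1 + b w) * 0), continuous (@ln R)}.
    by apply: continuous_ln; rewrite mulr0 addr0 lt_max A0.
  exact: (cvg_comp _ _ c1 c2).
have ig : P.-integrable setT (fun w => (`|ln (A 0 w)| + G w)%:E).
  have := integrableD measurableT (integrable_abse integrable_lnA) integrable_G.
  by apply: eq_integrable.
have dom : {ae P, forall w, forall k, [set: T] w -> (`|(f k w)%:E| <= (`|ln (A 0 w)| + G w)%:E)%E}.
  apply: filterS A_gt0 => w A0 k _; rewrite lee_fin.
  have h1 : f k w <= G w by apply: le_trans (ln1ab_le w); exact: f_le.
  have h2 : ln (A 0 w) <= f k w.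
    rewrite -ln_a ler_ln ?posrE// ?lt_max ?A0// lerDl divr_ge0 ?addr_ge0//.
  have h3 := le_trans (ln1ab_ge0 w) (ln1ab_le w).
  have h4 := ler_norm (- ln (A 0 w)); rewrite normrN in h4.
  have h5 := normr_ge0 (ln (A 0 w)).
  by rewrite ler_norml; apply/andP; split; lra.
have [_ _ lim] := dominated_convergence measurableT
  (fun k => proj2 (measurable_EFinP _ _) (mf k)) (proj2 (measurable_EFinP _ _) mlnA) cv ig dom.
apply: contrapT => /forallNP nf.
have := lnA_mean; apply/negP; rewrite -leNgt.
rewrite -(cvg_lim _ lim)//; apply: lime_ge; first by apply/cvg_ex; exists (\int[P]_w (ln (A 0 w))%:E)%E.
by apply: nearW => k; have /negP := nf k; rewrite -leNgt.
Qed.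

(** A Foster-Lyapunov inequality for [ln (1 + r)]: above [r0] the mean falls by [m], the size of the
    drift of [f k]; below [r0] it rises by at most the mean of [ln (1 + a + b)], which together with
    [m] makes up [C]. *)
Lemma perp_drift : exists m C r0 : R, [/\ 0 < m, 0 <= C, 0 < r0 & forall r, 0 <= r ->
  (\int[P]_w (ln (1 + (a w * r + b w)))%:E + m%:E <= (ln (1 + r) + C * (r < r0)%R%:R)%:E)%E].
Proof.
have [k fk] := drift_negative.
have kfin := integrable_fin_num measurableT (integrable_f k).
pose m := - fine (\int[P]_w (f k w)%:E)%E.
have m0 : 0 < m by rewrite oppr_gt0 -lte_fin fineK.
have iL : P.-integrable setT (fun w => (ln (1 + a w + b w))%:E).
  apply: le_integrable integrable_G => //.
    apply/measurable_EFinP; apply: measurableT_comp (@measurable_ln R) _.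
    by apply: measurable_funD => //; apply: measurable_funD => //; exact: measurable_cst.
  move=> w _ /=; rewrite lee_fin (ger0_norm (ln1ab_ge0 w)) ger0_norm//.
  exact: le_trans (ln1ab_ge0 w) (ln1ab_le w).
have Lfin := integrable_fin_num measurableT iL.
pose c := fine (\int[P]_w (ln (1 + a w + b w))%:E)%E.
have c0 : 0 <= c by rewrite fine_ge0// integral_ge0// => w _; rewrite lee_fin.
have mL r : measurable_fun setT (fun w => (ln (1 + (a w * r + b w)))%:E).
  apply/measurable_EFinP; apply: measurableT_comp (@measurable_ln R) _.
  apply: measurable_funD; first exact: measurable_cst.
  by apply: measurable_funD => //; apply: measurable_funM => //; exact: measurable_cst.
have arg0 r w : 0 <= r -> 0 < 1 + (a w * r + b w).
  by move=> r0; rewrite ltr_pwDl// addr_ge0// mulr_ge0.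
have bound r (h : T -> R) : 0 <= r -> P.-integrable setT (EFin \o h) ->
  (forall w, ln (1 + (a w * r + b w)) <= ln (1 + r) + h w) ->
  (\int[P]_w (ln (1 + (a w * r + b w)))%:E <= (ln (1 + r))%:E + \int[P]_w (h w)%:E)%E.
  move=> r0 ih le_h.
  have i3 := finite_measure_integrable_cst P (ln (1 + r) : R) measurableT.
  have -> : ((ln (1 + r))%:E + \int[P]_w (h w)%:E =
    \int[P]_w ((ln (1 + r))%:E + (h w)%:E))%E.
    rewrite (integralD measurableT i3 ih).
    rewrite -[X in (_ = X + _)%E]/(\int[P]_x cst (ln (1 + r))%:E x)%E integral_cst//.
    congr (_ + _)%E; rewrite -[LHS]mule1; congr (_ * _)%E.
    exact/esym/probability_setT.
  apply: ge0_le_integral => //.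
  - by move=> w _; rewrite lee_fin ln_ge0// lerDl addr_ge0// mulr_ge0.
  - apply: emeasurable_funD; first exact: measurable_cst.
    by have /integrableP[] := ih.
  - by move=> w _; rewrite -EFinD lee_fin.
exists m, (c + m), k.+1%:R; split; rewrite ?addr_ge0// ?ltW//.
move=> r r0; case: ltP => rk /=.
- rewrite mulr1 addrA EFinD leeD2r// EFinD -[X in (_ + X)%E]/((fine _)%:E) fineK//.
  apply: (bound r (fun w => ln (1 + a w + b w)) r0 iL) => w.
  have l1 : 0 < 1 + r by rewrite ltr_pwDl.
  have l2 : 0 < 1 + a w + b w by rewrite -addrA ltr_pwDl// addr_ge0.
  rewrite -lnM ?posrE// ler_ln ?posrE ?mulr_gt0// ?arg0//.
  have := a_ge0 w; have := b_ge0 w.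
  by move: (a w) (b w) => x y y0 x0; nra.
- rewrite mulr0 addr0.
  have -> : ((ln (1 + r))%:E = (ln (1 + r))%:E + \int[P]_w (f k w)%:E + m%:E)%E.
    by rewrite -[X in (_ + X + _)%E]fineK// -!EFinD /m; congr (_%:E); ring.
  rewrite leeD2r//; apply: (bound r (f k) r0 (integrable_f k)) => w.
  have k1 : (0 : R) < 1 + k%:R by rewrite ltr_pwDl.
  have l1 : 0 < 1 + r by rewrite ltr_pwDl.
  rewrite /f -lnM ?posrE// ler_ln ?posrE ?mulr_gt0// ?arg0//.
  have : (1 + b w) <= (1 + r) * ((1 + b w) / (1 + k%:R)).
    rewrite mulrCA ler_peMr ?addr_ge0// ler_pdivlMr// mul1r lerD2l.
    by rewrite (le_trans _ rk)// ler_nat.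
  have := a_ge0 w; set v := _ / _; move: (a w) (b w) v => x y v x0; nra.
Qed.

Let phi (r : R) (x : R * R * R) := Num.max x.1.1 0 * r + Num.max (x.2 - x.1.2) 0.

Let measurable_phi d' (T' : measurableType d') (X : T' -> R) (Y : T' -> R * R * R) :
  measurable_fun setT X -> measurable_fun setT Y ->
  measurable_fun setT (fun t => phi (X t) (Y t)).
Proof.
move=> mX mY.
have m1 : measurable_fun setT (fun t => (Y t).1) by exact: measurableT_comp measurable_fst mY.
apply: measurable_funD.
  apply: measurable_funM => //; apply: measurable_maxr; last exact: measurable_cst.
  exact: measurableT_comp measurable_fst m1.
apply: measurable_maxr; last exact: measurable_cst.
apply: measurable_funB; first exact: measurableT_comp measurable_snd mY.
exact: measurableT_comp measurable_snd m1.
Qed.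

(** The inner perpetuity involves only tuples after [i], so tuple [i] is frozen out against the
    future. *)
Let perp_step (g : R -> \bar R) i n : measurable_fun setT g -> (forall r, 0 <= g r)%E ->
  (\int[P]_w g (perp A B D i n.+1 w) =
   \int[P]_w \int[P]_w' g (phi (perp A B D i.+1 n w) (ABD A B D 0 w')))%E.
Proof.
move=> mg g0.
pose I := [set k | (i < k)%N].
have := @freezing _ _ _ P Psi A B D mmodel iid I i
  (fun x => g (phi (perp A B D i.+1 n x.1) x.2)).
apply.
- by rewrite /I /= ltnn.
- apply: measurableT_comp mg _; apply: measurable_phi; last exact: measurable_snd.
  apply: measurableT_comp _ measurable_fst.
  by apply: measurable_perp => k /andP[].
- by move=> x; exact: g0.
Qed.

(** Peeling off the first tuple turns the test function [g] into [g'], the same for both starting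
    indices, so the induction must range over all test functions. *)
Lemma perp_law (g : R -> \bar R) j n : measurable_fun setT g -> (forall r, 0 <= g r)%E ->
  (\int[P]_w g (perp A B D j n w) = \int[P]_w g (perp A B D 0 n w))%E.
Proof.
elim: n j g => [//|n IH] j g mg g0.
pose g' r := (\int[P]_w' g (phi r (ABD A B D 0 w')))%E.
have mg' : measurable_fun setT g'.
  apply: (@measurable_fun_fubini_tonelli_F _ _ _ _ R P
    (fun x : R * T => g (phi x.1 (ABD A B D 0 x.2)))) => //.
  apply: measurableT_comp mg _; apply: measurable_phi; first exact: measurable_fst.
  by apply: measurableT_comp _ measurable_snd; exact: measurable_ABD mmodel 0%N.
have g'0 r : (0 <= g' r)%E by apply: integral_ge0.
exact: etrans (perp_step j n mg g0) (etrans (IH j.+1 g' mg' g'0)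
  (esym (etrans (perp_step 0%N n mg g0) (IH 1%N g' mg' g'0)))).
Qed.

Let measurable_perpT n : measurable_fun setT (perp A B D 0 n).
Proof.
apply: (measurable_from_sigmaT mmodel (I := setT)).
by apply: measurable_perp.
Qed.

(* The drift inequality for ln (1 + perp) forces the time-averages of
   P(perp n < r0), hence by monotonicity each of these probabilities, to stay
   above m / C. *)
Lemma perp_tight : exists r0 p0 : R, [/\ 0 < r0, 0 < p0 &
  forall n, p0 <= fine (P [set w | perp A B D 0 n w < r0])].
Proof.
have [m [C [r0 [m0 C0 r00 dr]]]] := perp_drift.
pose lg (r : R) := Num.max (ln (1 + r)) 0.
have lgE r : 0 <= r -> lg r = ln (1 + r).
  by move=> r_ge0; rewrite /lg max_l// ln_ge0// lerDl.
have lg0 r : 0 <= lg r by rewrite le_max lexx orbT.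
have mlg : measurable_fun setT lg.
  apply: measurable_maxr; last exact: measurable_cst.
  apply: measurableT_comp (@measurable_ln R) _.
  by apply: measurable_funD; [exact: measurable_cst|exact: measurable_id].
have mlgE : measurable_fun setT (EFin \o lg) by exact/measurable_EFinP.
have mS n : measurable [set w | perp A B D 0 n w < r0].
  exact: measurable_ltr_cst (measurable_perpT n).
pose V n := (\int[P]_w (lg (perp A B D 0 n w))%:E)%E.
pose q n := P [set w | perp A B D 0 n w < r0].
pose h r : R := lg r + C * (r < r0)%R%:R.
have mlt : measurable_fun setT (fun r : R => (r < r0)%R%:R : R).
  rewrite (_ : (fun r => _) = \1_`]-oo, r0[%classic).
    exact: measurable_indic.
  by apply/funext => r; rewrite indicE mem_setE in_itv.
have mh : measurable_fun setT (EFin \o h).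
  apply/measurable_EFinP/measurable_funD => //; apply: measurable_funM => //.
have h0 r : (0 <= (EFin \o h) r)%E by rewrite lee_fin addr_ge0// mulr_ge0.
have V0 n : (0 <= V n)%E by apply: integral_ge0 => w _; rewrite lee_fin.
(* The drift inequality is averaged over [perp 1 n], on which tuple 0 acts; by [perp_law] it may be
   replaced by [perp 0 n] on the right. *)
have step n : (V n.+1 + m%:E <= V n + C%:E * q n)%E.
  have -> : (V n + C%:E * q n = \int[P]_w (EFin \o h) (perp A B D 0 n w))%E.
    under [RHS]eq_integral do rewrite /= /h EFinD.
    rewrite ge0_integralD//=; first congr (_ + _)%E.
    - under eq_integral do rewrite EFinM.
      rewrite ge0_integralZl//; first congr (_ * _)%E.
      + rewrite /q -[in LHS](setIT [set w | _]) -integral_indic//.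
        by apply: eq_integral => w _; rewrite indicE mem_setE.
      + by apply/measurable_EFinP; apply: measurableT_comp mlt _.
    - by move=> w _; rewrite lee_fin.
    - by apply: measurableT_comp mlgE _.
    - by move=> w _; rewrite lee_fin mulr_ge0.
    - by apply/measurable_EFinP; apply: measurable_funM => //; apply: measurableT_comp mlt _.
  rewrite -(perp_law 1 n mh h0) /V.
  rewrite (perp_step (g := EFin \o lg) 0 n mlgE)//.
  have mi : measurable_fun setT (fun w => \int[P]_w' (EFin \o lg) (phi (perp A B D 1 n w) (ABD A B D 0 w')))%E.
    apply: (@measurable_fun_fubini_tonelli_F _ _ _ _ R P
      (fun x : T * T => (EFin \o lg) (phi (perp A B D 1 n x.1) (ABD A B D 0 x.2)))).
      apply: measurableT_comp mlgE _; apply: measurable_phi.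
        apply: measurableT_comp _ measurable_fst.
        apply: (measurable_from_sigmaT mmodel (I := setT)).
        by apply: measurable_perp.
      by apply: measurableT_comp _ measurable_snd; exact: measurable_ABD mmodel 0%N.
    by move=> x; rewrite lee_fin.
  have -> : (m%:E = \int[P]_w m%:E)%E.
    by rewrite integral_prob_cst.
  rewrite -ge0_integralD//=.
  - apply: ge0_le_integral => //.
    + by move=> w _; rewrite adde_ge0 ?lee_fin ?(ltW m0)//; apply: integral_ge0 => w' _; rewrite lee_fin.
    + by apply: emeasurable_funD => //; exact: measurable_cst.
    + apply: measurableT_comp mh _.
      apply: (measurable_from_sigmaT mmodel (I := setT)).
      by apply: measurable_perp.
    + move=> w _; have r_ge0 := perp_ge0 A B D 1 n w.
      apply: le_trans (_ : (ln (1 + perp A B D 1 n w) + C * (perp A B D 1 n w < r0)%R%:R)%:E <= _)%E; last by rewrite lee_fin /h lgE.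
      apply: le_trans (dr _ r_ge0); rewrite leeD2r//.
      apply: ge0_le_integral => //.
      * by move=> w' _; rewrite lee_fin.
      * apply: measurableT_comp mlgE _; apply: measurable_phi; first exact: measurable_cst.
        exact: measurable_ABD mmodel 0%N.
      * apply/measurable_EFinP; apply: measurableT_comp (@measurable_ln R) _.
        apply: measurable_funD; first exact: measurable_cst.
        by apply: measurable_funD => //; apply: measurable_funM => //; exact: measurable_cst.
      * move=> w' _; rewrite lee_fin lgE//.
        by rewrite addr_ge0// ?mulr_ge0// le_max lexx orbT.
  - by move=> w _; apply: integral_ge0 => w' _; rewrite lee_fin.
  - by move=> w _; rewrite lee_fin ltW.
have qfin n : q n \is a fin_num by rewrite fin_num_measure.
(* The recursion itself propagates finiteness, starting from [V 0 = 0]. *)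
have Vfin n : V n \is a fin_num.
  elim: n => [|n IH].
    by rewrite /V /=; under eq_integral do rewrite lgE// addr0 ln1; rewrite integral0.
  rewrite ge0_fin_numE//.
  have := step n; rewrite -(fineK IH) -(fineK (qfin n)) -EFinM -EFinD.
  by move=> st; rewrite -(@lteD2rE _ m%:E)// (le_lt_trans st)// ltry.
have qnd n j : fine (q (n + j)%N) <= fine (q n).
  rewrite fine_le//; apply: le_measure; rewrite ?inE//.
  elim: j => [|j IH]; first by rewrite addn0.
  by apply: subset_trans IH => w /=; apply: le_lt_trans; rewrite addnS; exact: perpSr.
have rstep n : fine (V n.+1) + m <= fine (V n) + C * fine (q n).
  by have := step n; rewrite -(fineK (Vfin n)) -(fineK (Vfin n.+1)) -(fineK (qfin n)) -EFinM -!EFinD lee_fin.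
have C_gt0 : 0 < C.
  rewrite lt_neqAle C0 andbT; apply/eqP => C00.
  have vj j : fine (V j) + j%:R * m <= fine (V 0%N).
    elim: j => [|j IH]; first by rewrite mul0r addr0.
    apply: le_trans IH; have := rstep j; rewrite -C00 mul0r addr0 -natr1; lra.
  have [N hN] := archi_mul (fine (V 0%N)) m0.
  by have := vj N; rewrite leNgt ltr_wpDl// fine_ge0.
exists r0, (m / C); split => //; first exact: divr_gt0.
move=> n; rewrite ler_pdivrMr// leNgt; apply/negP => lt.
have vj j : fine (V (n + j)%N) + j%:R * (m - fine (q n) * C) <= fine (V n).
  elim: j => [|j IH]; first by rewrite mul0r addr0 addn0.
  apply: le_trans IH; have := rstep (n + j)%N; rewrite addnS -natr1.
  have := qnd n j; set x := fine (q _); set y := fine (q _) => xy.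
  have : C * x <= C * y by rewrite ler_wpM2l// ltW.
  lra.
have lt' : 0 < m - fine (q n) * C by rewrite subr_gt0.
have [N hN] := archi_mul (fine (V n)) lt'.
by have := vj N; rewrite leNgt ltr_wpDl// fine_ge0.
Qed.

End Perpetuity.

(** * What class S* says about a single tail *)

Section Tails.
Context {R : realType} {d : measure_display} {T : measurableType d}.
Variable P : probability T R.
Implicit Types X : T -> R.

Lemma asym_equivP (f g : R -> R) (e : R) : asym_equiv f g -> 0 < e ->
  exists M, forall x, M < x -> `|1 - f x / g x| < e.
Proof. by move=> /cvgrPdist_lt fg e0; have [M [_ HM]] := fg _ e0; exists M => x /HM. Qed.

Lemma asym_neglP (f g : R -> R) (e : R) : asym_negl f g -> 0 < e ->
  exists M, forall x, M < x -> `|f x / g x| < e.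
Proof.
move=> /cvgrPdist_lt fg e0; have [M [_ HM]] := fg _ e0; exists M => x /HM /=.
by rewrite sub0r normrN.
Qed.

Lemma tailP_ge0 X t : measurable_fun setT X -> 0 <= tailP P X t.
Proof. by move=> mX; rewrite fine_ge0// measure_ge0. Qed.

Lemma tailPE X t : measurable_fun setT X -> P [set w | t < X w] = (tailP P X t)%:E.
Proof. by move=> mX; rewrite fineK// fin_num_measure//; exact: measurable_gtr_cst. Qed.

Lemma tailP_le1 X t : measurable_fun setT X -> tailP P X t <= 1.
Proof. by move=> mX; rewrite -lee_fin -tailPE// probability_le1//; exact: measurable_gtr_cst. Qed.

Lemma tailP_le X X' t t' : measurable_fun setT X -> measurable_fun setT X' ->
  (forall w, t < X w -> t' < X' w) -> tailP P X t <= tailP P X' t'.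
Proof.
move=> mX mX' h; rewrite -lee_fin -!tailPE//; apply: le_measure.
- by rewrite inE; exact: measurable_gtr_cst.
- by rewrite inE; exact: measurable_gtr_cst.
- by move=> w /h.
Qed.

Lemma tailP_nincr X t t' : measurable_fun setT X -> t <= t' -> tailP P X t' <= tailP P X t.
Proof. by move=> mX tt'; apply: tailP_le => // w; exact: le_lt_trans. Qed.

Lemma nincr_measurable (F : R -> R) : (forall x y, x <= y -> F y <= F x) ->
  measurable_fun setT F.
Proof.
move=> nF; rewrite (_ : F = \- (fun x => - F x)); last by apply/funext => x /=; rewrite opprK.
apply: measurableT_comp => //; apply: nondecreasing_measurable => // x y xy.
by rewrite lerN2 nF.
Qed.

Lemma measurable_tailP X : measurable_fun setT X -> measurable_fun setT (tailP P X).
Proof. by move=> mX; apply: nincr_measurable => x y; exact: tailP_nincr. Qed.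

Let mu := @lebesgue_measure R.

Lemma set_itvcc_measurable (a b : R) : measurable [set s : R | a <= s <= b].
Proof.
rewrite (_ : [set s | _] = `[a, b]%classic); first exact: measurable_itv.
by apply/seteqP; split => s /=; rewrite in_itv.
Qed.

(** A ratio within 1/2 of 1 is nonzero. Since division by zero and [fine] of an infinite integral
    both give 0, the tail must be positive and the convolution finite; a ratio below 3/2 then yields
    [K = 3 m], with [m] the mean of the positive part. *)
Lemma Sstar_conv X : measurable_fun setT X -> in_Sstar P X ->
  exists K t0 : R, [/\ 0 <= K, 0 <= t0 & forall t, t0 < t -> 0 < tailP P X t /\
   (\int[mu]_(s in [set s : R | (0 <= s <= t)%R])
      (tailP P X (t - s) * tailP P X s)%:E <= (K * tailP P X t)%:E)%E].
Proof.
move=> mX [_ ] /(asym_equivP (e := 2^-1)).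
set m := fine (\int[P]_w _)%E; rewrite invr_gt0 ltr0n => /(_ isT) [M HM].
have m0 : 0 <= m.
  by rewrite fine_ge0//; apply: integral_ge0 => w _; rewrite lee_fin le_max lexx orbT.
exists (3 * m), (Num.max M 0); split; [by rewrite mulr_ge0|by rewrite le_max lexx orbT|].
move=> t; rewrite gt_max => /andP[/HM + t0].
set I := (\int[_]_(s in _) _)%E => hI.
have I0 : (0 <= I)%E.
  by apply: integral_ge0 => s _; rewrite lee_fin mulr_ge0// tailP_ge0.
have tl0 : 0 <= tailP P X t by exact: tailP_ge0.
have [gt0|g_le0] := ltP 0 (2 * m * tailP P X t); last first.
  have g0 : 2 * m * tailP P X t = 0 by apply/eqP; rewrite eq_le g_le0 !mulr_ge0.
  by exfalso; move: hI; rewrite -/m g0 invr0 mulr0 subr0 normr1; clear I0; lra.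
have tl_gt0 : 0 < tailP P X t.
  by rewrite lt_neqAle tl0 andbT; apply: contraTneq gt0 => <-; rewrite mulr0 ltxx.
split => //.
have : fine I / (2 * m * tailP P X t) < 3 / 2 by move: hI; rewrite ltr_norml; clear I0; lra.
have fI : fine I != 0.
  by apply/negP => /eqP fI; move: hI; rewrite fI mul0r subr0 normr1; clear I0; lra.
have Ifin : I \is a fin_num by move: fI; case: (I) => //=; rewrite eqxx.
rewrite ltr_pdivrMr// => hf; rewrite -(fineK Ifin) lee_fin; move: hf; clear I0; lra.
Qed.

Lemma Sstar_tail_gt0 X t : measurable_fun setT X -> in_Sstar P X -> 0 < tailP P X t.
Proof.
move=> mX /(Sstar_conv mX)[K [t0 [_ _ H]]].
have [] := H (Num.max t t0 + 1).
  by rewrite ltr_pwDr// le_max lexx orbT.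
move=> + _; move/lt_le_trans; apply; apply: tailP_nincr => //.
by rewrite ler_wpDr// le_max lexx.
Qed.

(** In the convolution at [s + c] only [u] in [[c, c + 1]] is kept: there the integrand is at least
    [P(X > s) P(X > c + 1)]. The added 1 in the constant keeps it positive. *)
Lemma Sstar_doubling X c : measurable_fun setT X -> in_Sstar P X -> 0 <= c ->
  exists C s1 : R, 0 < C /\ forall s, s1 < s -> tailP P X s <= C * tailP P X (s + c).
Proof.
move=> mX SX c0; have [K [t0 [K0 t00 H]]] := Sstar_conv mX SX.
have tc : 0 < tailP P X (c + 1) by exact: Sstar_tail_gt0.
exists (K / tailP P X (c + 1) + 1), (t0 + c + 1); split; first by rewrite ltr_wpDl// divr_ge0// ltW.
move=> s st; have st0 : t0 < s + c by lra.
have [ts /(le_trans _) HI] := H _ st0.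
have sub : ((tailP P X s * tailP P X (c + 1))%:E <= (K * tailP P X (s + c))%:E)%E.
  apply: HI.
  pose J := [set u : R | c <= u <= c + 1].
  have mJ : measurable J by exact: set_itvcc_measurable.
  have muJ : mu J = 1%E.
    rewrite (_ : J = `[c, c + 1]%classic); last by apply/seteqP; split => u /=; rewrite in_itv.
    by rewrite /mu lebesgue_measure_itv/= lte_fin ltrDl ltr01 -EFinD addrAC subrr add0r.
  apply: (@le_trans _ _ (\int[mu]_(u in J) (tailP P X (s + c - u) * tailP P X u)%:E)%E).
    have -> : (tailP P X s * tailP P X (c + 1))%:E =
      (\int[mu]_(u in J) (tailP P X s * tailP P X (c + 1))%:E)%E.
      by rewrite integral_cst// -[LHS]mule1; congr (_ * _)%E; exact/esym/muJ.
    apply: ge0_le_integral => //.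
    - by move=> u _; rewrite lee_fin mulr_ge0// tailP_ge0.
    - apply/measurable_EFinP/measurable_funM; apply: measurable_funTS.
        apply: measurableT_comp (measurable_tailP mX) _.
        by apply: measurable_funB; [exact: measurable_cst|exact: measurable_id].
      exact: measurable_tailP.
    - move=> u /= /andP[cu uc]; rewrite lee_fin.
      by apply: ler_pM; rewrite ?tailP_ge0// tailP_nincr//; lra.
  apply: ge0_subset_integral => //.
  - exact: set_itvcc_measurable.
  - apply/measurable_EFinP/measurable_funM; apply: measurable_funTS.
      apply: measurableT_comp (measurable_tailP mX) _.
      by apply: measurable_funB; [exact: measurable_cst|exact: measurable_id].
    exact: measurable_tailP.
  - by move=> u _; rewrite lee_fin mulr_ge0// tailP_ge0.
  - by move=> u /= /andP[cu uc]; apply/andP; split; lra.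
rewrite lee_fin -ler_pdivlMr// in sub.
by apply: (le_trans sub); rewrite mulrAC; apply: ler_wpM2r; [exact: ltW|rewrite lerDl].
Qed.

(** For [u] in [[0, n]] the factor [P(X > n - u)] is at least [P(X > n)]; dividing the convolution
    bound at [n] by it bounds the integral over [[0, n]] by [K]. *)
Lemma Sstar_integral_lty X t : measurable_fun setT X -> in_Sstar P X -> 0 <= t ->
  (\int[mu]_(s in [set s : R | (t <= s)%R]) (tailP P X s)%:E < +oo)%E.
Proof.
move=> mX SX t0; have [K [u0 [K0 u00 H]]] := Sstar_conv mX SX.
have mtE (S : set R) : measurable_fun S (EFin \o tailP P X).
  by apply/measurable_EFinP; apply: measurable_funTS; exact: measurable_tailP.
have tE0 u : (0 <= (tailP P X u)%:E)%E by rewrite lee_fin tailP_ge0.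
pose F n := [set s : R | 0 <= s <= n%:R].
have mF n : measurable (F n) by exact: set_itvcc_measurable.
have ndF : {homo F : n m / (n <= m)%N >-> (n <= m)%O}.
  move=> n m nm; apply/subsetPset => s; rewrite /F/= => /andP[s0 h].
  by rewrite s0 (le_trans h)// ler_nat.
have cv := ge0_nondecreasing_set_cvg_integral (mu := mu) ndF mF
  (fun n => mtE (F n)) (fun n u _ => tE0 u).
have le_n n : u0 < n%:R -> (\int[mu]_(s in F n) (tailP P X s)%:E <= K%:E)%E.
  move=> nu; have [tn HI] := H _ nu.
  rewrite -(@lee_pmul2l _ (tailP P X n%:R)%:E) ?lte_fin// -EFinM [in leRHS]mulrC.
  apply: le_trans HI.
  rewrite -ge0_integralZl// ?lee_fin ?tailP_ge0//.
  apply: ge0_le_integral => //.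
  - exact: mF.
  - by move=> u _; rewrite -EFinM lee_fin mulr_ge0// tailP_ge0.
  - by apply: emeasurable_funM; [exact: measurable_cst|exact: mtE].
  - apply/measurable_EFinP/measurable_funM; apply: measurable_funTS.
      apply: measurableT_comp (measurable_tailP mX) _.
      by apply: measurable_funB; [exact: measurable_cst|exact: measurable_id].
    exact: measurable_tailP.
  - move=> u /= /andP[hu un]; rewrite -EFinM lee_fin ler_wpM2r ?tailP_ge0//.
    by rewrite tailP_nincr// gerBl.
  - exact: mF.
  - exact: mtE.
apply: (@le_lt_trans _ _ K%:E); last exact: ltry.
apply: (@le_trans _ _ (\int[mu]_(s in \bigcup_n F n) (tailP P X s)%:E)%E).
  apply: ge0_subset_integral => //.
  - rewrite (_ : [set s | _] = `[t, +oo[%classic); first exact: measurable_itv.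
    by apply/seteqP; split => s /=; rewrite in_itv/= andbT.
  - exact: bigcupT_measurable.
  - exact: mtE.
  - move=> s /= ts; have s0 := le_trans t0 ts; exists (Num.bound s) => //.
    by apply/andP; split => //; apply: ltW; exact: archi_boundP.
rewrite -(cvg_lim _ cv)//; apply: lime_le.
  by apply/cvg_ex; eexists; exact: cv.
exists (Num.bound u0) => // n /= un; apply: le_n.
by apply: lt_le_trans (archi_boundP u00) _; rewrite ler_nat.
Qed.

Lemma integral_nincr_le_sum (F : R -> R) (t h : R) N : (forall x, 0 <= F x) ->
  (forall x y, x <= y -> F y <= F x) -> 0 <= h ->
  (\int[mu]_(s in [set s : R | (t <= s < t + N%:R * h)%R]) (F s)%:E <=
   (h * \sum_(k < N) F (t + k%:R * h)%R)%:E)%E.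
Proof.
move=> F0 nF h0.
have mE (a b : R) : [set s : R | a <= s < b] = `[a, b[%classic.
  by apply/seteqP; split => s /=; rewrite in_itv.
have mFE (S : set R) : measurable_fun S (EFin \o F).
  by apply/measurable_EFinP; apply: measurable_funTS; exact: nincr_measurable.
elim: N => [|N IH].
  rewrite big_ord0 mulr0 mul0r addr0 (_ : [set s | _] = set0) ?integral_set0//.
  by apply/seteqP; split => // s /= /andP[ts st]; move: (le_lt_trans ts st); rewrite ltxx.
rewrite (_ : [set s | _] = [set s : R | t <= s < t + N%:R * h] `|`
   [set s : R | t + N%:R * h <= s < t + N.+1%:R * h]); last first.
  have Nh : t + N%:R * h <= t + N.+1%:R * h by rewrite lerD2l ler_wpM2r// ler_nat.
  have tN : t <= t + N%:R * h by rewrite lerDl mulr_ge0.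
  apply/seteqP; split => s /=.
    move=> /andP[ts st]; have [sN|Ns] := ltP s (t + N%:R * h); [left|right];
      by apply/andP.
  by move=> [/andP[-> st]|/andP[ts ->]]; rewrite ?(lt_le_trans st)// (le_trans tN ts).
rewrite !mE ge0_integral_setU//.
- rewrite big_ord_recr/= mulrDr EFinD; apply: leeD; first by rewrite -mE.
  have : t + N.+1%:R * h = t + N%:R * h + h by rewrite -natr1; ring.
  set p := t + N%:R * h; set q := t + N.+1%:R * h => qE.
  apply: (@le_trans _ _ (\int[mu]_(s in `[p, q[) (F p)%:E)%E).
    apply: ge0_le_integral => //.
    + by move=> s _; rewrite lee_fin.
    + exact: mFE.
    + by move=> s; rewrite /= in_itv/= => /andP[ts _]; rewrite lee_fin nF.
  have Hm : lebesgue_measure `[p, q[%classic = h%:E.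
    rewrite lebesgue_measure_itv/= lte_fin; case: ltP => [_|qp].
      by rewrite -EFinD qE addrAC subrr add0r.
    by congr (_%:E); apply/eqP; rewrite eq_le h0/=; lra.
  have -> : ((h * F p)%:E = (F p)%:E * h%:E)%E by rewrite -EFinM mulrC.
  by rewrite integral_cst// le_eqVlt; apply/orP; left; apply/eqP; congr (_ * _)%E; exact: Hm.
- exact: mFE.
- by move=> s _; rewrite lee_fin.
- apply/disj_setPS => s /= []; rewrite !in_itv/= => /andP[_ h1] /andP[h2 _].
  by move: (lt_le_trans h1 h2); rewrite ltxx.
Qed.

End Tails.

(** * Comparing the tails of the increment, of max(A, B) and of the jumps *)

Section ModelTails.
Context {R : realType} {d : measure_display} {T : measurableType d}.
Variable P : probability T R.
Variables (A B D : nat -> T -> R) (g1 g2 : R).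
Hypothesis mA : measurable_fun setT (A 0).
Hypothesis mB : measurable_fun setT (B 0).
Hypothesis mD : measurable_fun setT (D 0).
Hypothesis g1_gt0 : 0 < g1.

Let Y0 := Y A B D g1 g2 0.
Let mAB w := Num.max (A 0 w) (B 0 w).
Let mABpD w := Num.max (A 0 w) (Num.max (B 0 w) 0 + D 0 w).
Let mABD w := Num.max (A 0 w) (B 0 w - D 0 w).
Let U := tailP P mAB.
Let V := tailP P mABpD.

Hypothesis SY : in_Sstar P Y0.
Hypothesis VU : asym_equiv V U.
Hypothesis LU : asym_equiv (tailP P mABD) U.
Hypothesis NU : asym_negl (fun x => fine (P [set w | x < A 0 w /\ B 0 w - D 0 w <= - x])) U.

Lemma measurable_Y0 : measurable_fun setT Y0.
Proof.
apply: measurable_funD; last exact: measurable_cst.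
apply: measurable_maxr; last exact: measurableT_comp (@measurable_ln R) mA.
apply: measurable_funB; last exact: measurable_cst.
apply: measurable_maxr; last exact: measurable_cst.
apply: measurableT_comp (@measurable_ln R) _; apply: measurable_funD => //.
by apply: measurable_maxr => //; exact: measurable_cst.
Qed.

Let m_mAB : measurable_fun setT mAB. Proof. exact: measurable_maxr. Qed.
Let m_mABpD : measurable_fun setT mABpD.
Proof.
apply: measurable_maxr => //; apply: measurable_funD => //.
by apply: measurable_maxr => //; exact: measurable_cst.
Qed.
Let m_mABD : measurable_fun setT mABD.
Proof. by apply: measurable_maxr => //; exact: measurable_funB. Qed.

Lemma tail_Y_ge s : V (expR s) <= tailP P Y0 (s - `|g2| + g1).
Proof.
apply: tailP_le => //; first exact: measurable_Y0.
move=> w; have h := ler_norm g2; have h0 := normr_ge0 g2.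
have lns (z : R) : expR s < z -> s < ln z.
  move=> sz; rewrite -[X in X < _]expRK ltr_ln ?posrE ?expR_gt0//.
  exact: lt_trans (expR_gt0 s) sz.
rewrite /mABpD lt_max => /orP[/lns sA|/lns sB].
  by rewrite /Y0 /Y ltrD2r lt_max; apply/orP; right; lra.
rewrite /Y0 /Y ltrD2r lt_max /logp; apply/orP; left.
by rewrite ltrBrDr lt_max; apply/orP; left; lra.
Qed.

(** The two conditions on [s] make both logarithmic thresholds positive: there [logp] agrees with
    [ln], and the value 0 of [ln] at nonpositive arguments is excluded. *)
Lemma tail_Y_le s : g1 < s -> g1 - g2 < s ->
  tailP P Y0 s <= V (expR (s - g1 - `|g2|)).
Proof.
move=> s1 s2; apply: tailP_le => //; first exact: measurable_Y0.
move=> w; have h := ler_norm (- g2); rewrite normrN in h; have h0 := normr_ge0 g2.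
have lns (z t : R) : 0 < t -> s - g1 - `|g2| <= t -> t < ln z -> expR (s - g1 - `|g2|) < z.
  move=> t0 st tz; have z0 : 0 < z.
    by rewrite ltNge; apply/negP => /ln0 z0; move: (lt_trans t0 tz); rewrite z0 ltxx.
  rewrite -[X in _ < X]lnK// ltr_expR; exact: le_lt_trans tz.
rewrite /Y0 /Y -ltrBlDr lt_max /mABpD lt_max => /orP[sB|sA]; apply/orP; [right|left].
  apply: (lns _ (s - g1 + g2)); [lra|lra|].
  move: sB; rewrite ltrBrDr /logp lt_max => /orP[//|]; lra.
by apply: (lns _ (s - g1)); lra.
Qed.

Lemma VU_eventually : exists t0 : R, 0 < t0 /\ forall t, t0 < t ->
  [/\ 0 < U t, V t <= 2 * U t & U t <= 2 * V t].
Proof.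
have [M HM] := asym_equivP VU (e := 2^-1) ltac:(by rewrite invr_gt0 ltr0n).
exists (Num.max M 1); split; first by rewrite lt_max ltr01 orbT.
move=> t; rewrite gt_max => /andP[/HM h _].
have U0 : 0 <= U t by exact: tailP_ge0.
have Ut : 0 < U t.
  rewrite lt_neqAle U0 andbT; apply/eqP => e; exfalso.
  by move: h; rewrite -e invr0 mulr0 subr0 normr1; lra.
move: h; rewrite ltr_norml => /andP[h1 h2]; split => //.
  have : V t / U t <= 2 by lra.
  by rewrite ler_pdivrMr.
have : 2^-1 <= V t / U t by lra.
by rewrite ler_pdivlMr//; lra.
Qed.

(** The shifts [c], [g1] and [g2] between the two scales are absorbed by [Sstar_doubling]. *)
Lemma tail_Y_le_U c : exists C s1 : R, 0 < C /\ forall s, s1 < s ->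
  tailP P Y0 (s - c) <= C * U (expR s).
Proof.
have [t0 [t00 VUt]] := VU_eventually.
pose k := `|c| + g1 + `|g2|.
have k0 : 0 <= k by rewrite !addr_ge0// ltW.
have [C [s1 [C0 HC]]] := Sstar_doubling measurable_Y0 SY (c := k + `|c|) ltac:(by rewrite addr_ge0).
exists (2 * C), (Num.max (Num.max (s1 + `|c|) (ln t0)) (Num.max g1 (g1 - g2))); split.
  by rewrite mulr_gt0.
move=> s; rewrite !gt_max => /andP[/andP[h1 h2] /andP[h3 h4]].
have hc := ler_norm c; have hg := normr_ge0 g2; have hc' := ler_norm (- c); rewrite normrN in hc'.
apply: (le_trans (HC _ _)); first lra.
rewrite [2 * C]mulrC -mulrA; apply: ler_wpM2l; first exact: ltW.
have /VUt[_ h _] : t0 < expR s by rewrite -[X in X < _]lnK// ltr_expR.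
apply: le_trans h.
apply: (@le_trans _ _ (tailP P Y0 (s + g1 + `|g2|))).
  by apply: tailP_nincr; [exact: measurable_Y0|rewrite /k; lra].
have h5 : g1 < s + g1 + `|g2| by have := g1_gt0; lra.
have hg' := ler_norm (- g2); rewrite normrN in hg'.
have h6 : g1 - g2 < s + g1 + `|g2| by have := g1_gt0; lra.
apply: (le_trans (tail_Y_le h5 h6)).
by rewrite [X in expR X](_ : _ = s)//; lra.
Qed.

(** Scaling a level by [e] shifts its logarithm by [ln e], so the estimate for the tail of the
    increment passes to [U]. *)
Lemma U_doubling (e : R) : 0 < e -> exists C t1 : R, 0 < C /\ forall t, t1 < t ->
  U (e * t) <= C * U t.
Proof.
move=> e0; have [t0 [t00 VUt]] := VU_eventually.
have [C [s1 [C0 HC]]] := tail_Y_le_U (- ln e + `|g2| - g1).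
exists (2 * C), (Num.max (t0 / e) (expR s1)); split; first by rewrite mulr_gt0.
move=> t; rewrite gt_max => /andP[h1 h2].
have t_gt0 : 0 < t by apply: lt_trans h2; exact: expR_gt0.
have /VUt[_ _] : t0 < e * t by rewrite mulrC -ltr_pdivrMr.
move/le_trans; apply; rewrite -mulrA ler_wpM2l//.
have -> : e * t = expR (ln e + ln t) by rewrite expRD !lnK.
apply: (le_trans (tail_Y_ge _)).
rewrite (_ : _ + g1 = ln t - (- ln e + `|g2| - g1)); last lra.
by rewrite -[X in U X]lnK//; apply: HC; rewrite -[X in X < _]expRK ltr_ln ?posrE ?expR_gt0.
Qed.

Lemma U_gt0 t : 0 < U t.
Proof.
have [t0 [t00 VUt]] := VU_eventually.
have [Ut _ _] := VUt (Num.max t t0 + 1) ltac:(by rewrite ltr_pwDr// le_max lexx orbT).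
by apply: (lt_le_trans Ut); apply: tailP_nincr => //; rewrite ler_wpDr// le_max lexx.
Qed.

(** With [A > 0], [t > 0] and [0 < e <= 1], either alternative forces [A z + B - D > e t] for every
    [z >= 2 e]. *)
Definition jump_region (e t : R) : set (R * R * R) :=
  [set x | (t < x.1.2 - x.2) \/ (t < x.1.1 /\ - (e * t) < x.1.2 - x.2)].

Lemma measurable_jump_region e t : measurable (jump_region e t).
Proof.
have m1 : measurable_fun setT (fun x : R * R * R => x.1.2 - x.2).
  apply: measurable_funB; last exact: measurable_snd.
  exact: measurableT_comp measurable_snd measurable_fst.
have m2 : measurable_fun setT (fun x : R * R * R => x.1.1).
  exact: measurableT_comp measurable_fst measurable_fst.
apply: measurableU; first exact: measurable_gtr_cst.
by apply: measurableI; exact: measurable_gtr_cst.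
Qed.

(** What [max(A, B - D) > t] leaves outside the region lies in the event [A > e t],
    [B - D <= - e t], which is negligible against [U (e t) <= C U t]. The tolerances 1/4 and
    [1 / (4 C)] give 3/4 - 1/4 = 1/2. *)
Lemma jump_region_ge (e : R) : 0 < e <= 1 -> exists t1 : R, 0 < t1 /\ forall t, t1 < t ->
  ((U t / 2)%:E <= P (ABD A B D 0 @^-1` jump_region e t))%E.
Proof.
move=> /andP[e0 e1].
have [C [t1 [C0 HC]]] := U_doubling e0.
have [M HM] := asym_equivP LU (e := 4^-1) ltac:(by rewrite invr_gt0 ltr0n).
have [M' HM'] := asym_neglP NU (e := (4 * C)^-1) ltac:(by rewrite invr_gt0 mulr_gt0).
exists (Num.max (Num.max t1 1) (Num.max M (M' / e))); split.
  by rewrite !lt_max ltr01 orbT.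
move=> t; rewrite !gt_max => /andP[/andP[h1 h2] /andP[h3 h4]].
have t0 : 0 < t by exact: lt_trans h2.
have Ut := U_gt0 t; have Uet := U_gt0 (e * t).
have L : 3 / 4 * U t <= tailP P mABD t.
  have := HM _ h3; rewrite ltr_norml => /andP[_ h].
  have : 3 / 4 <= tailP P mABD t / U t by lra.
  by rewrite ler_pdivlMr.
pose N := [set w | e * t < A 0 w /\ B 0 w - D 0 w <= - (e * t)].
have mN : measurable N.
  apply: measurableI; first exact: measurable_gtr_cst.
  by apply: measurable_ler_cst; exact: measurable_funB.
have N_le : fine (P N) <= U t / 4.
  have : M' < e * t by rewrite mulrC -ltr_pdivrMr.
  move=> /HM'; rewrite -/N ltr_norml => /andP[_]; rewrite ltr_pdivrMr// => h.
  apply: (le_trans (ltW h)); rewrite mulrC ler_pdivrMr ?mulr_gt0//.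
  apply: (le_trans (HC _ h1)); lra.
have mR : measurable (ABD A B D 0 @^-1` jump_region e t).
  rewrite -[X in measurable X]setTI; apply: measurable_fun_pair => //.
    by apply: measurable_fun_pair.
  exact: measurable_jump_region.
have sub : [set w | t < mABD w] `<=` (ABD A B D 0 @^-1` jump_region e t) `|` N.
  move=> w /=; rewrite /mABD lt_max => /orP[tA|tBD]; last by left; left.
  have [h|h] := leP (B 0 w - D 0 w) (- (e * t)); [right|left; right] => //.
  by split => //; apply: le_lt_trans tA; rewrite ler_piMl// ltW.
have : (P [set w | (t < mABD w)%R] <= P (ABD A B D 0 @^-1` jump_region e t) + P N)%E.
  apply: le_trans (measureU2 _ mR mN); apply: le_measure => //; rewrite inE.
    exact: measurable_gtr_cst.
  exact: measurableU.
rewrite tailPE// -[P N]fineK ?fin_num_measure// -[P (ABD _ _ _ _ @^-1` _)]fineK ?fin_num_measure//.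
by rewrite -EFinD !lee_fin => h; lra.
Qed.

End ModelTails.

Import HBNNSimple.

(** * Integrals against a measure given by a density *)

Section Density.
Context {R : realType} d (T : measurableType d) (m1 m2 : {measure set T -> \bar R}).
Variable M : T -> R.
Hypothesis M0 : forall w, 0 <= M w.
Hypothesis mM : measurable_fun setT M.
Hypothesis m12 : forall E, measurable E -> (m1 E = \int[m2]_w (\1_E w * M w)%:E)%E.

Lemma density_integral_nnsfun (h : {nnsfun T >-> R}) :
  (\int[m1]_w (h w)%:E = \int[m2]_w (h w * M w)%:E)%E.
Proof.
have mh k : measurable (h @^-1` [set k]).
  by rewrite -[X in measurable X]setTI; exact: measurable_funP.
have mi k : measurable_fun setT (fun w => (\1_(h @^-1` [set k]) w * M w)).
  by apply: measurable_funM => //; exact: measurable_indic.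
transitivity (\sum_(k \in range h) (k%:E * \int[m1]_w (\1_(h @^-1` [set k]) w)%:E))%E.
  under eq_integral do rewrite fimfunE -fsumEFin//.
  rewrite ge0_integral_fsum//.
  - apply: eq_fsbigr => k _; under eq_integral do rewrite EFinM.
    by rewrite integralZl_indic_nnsfun//= -?integralZl_indic_nnsfun//.
  - by move=> k; apply/measurable_EFinP/measurable_funM.
  - by move=> k w _; rewrite nnfun_muleindic_ge0.
transitivity (\sum_(k \in range h) (\int[m2]_w (k * (\1_(h @^-1` [set k]) w * M w))%:E))%E.
  apply: eq_fsbigr => k; rewrite inE => -[w _ hk].
  rewrite integral_indic// setIT m12//.
  under [RHS]eq_integral do rewrite EFinM.
  rewrite ge0_integralZl//; first exact/measurable_EFinP.
    by move=> w' _; rewrite lee_fin mulr_ge0.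
  by rewrite lee_fin -hk.
rewrite -ge0_integral_fsum//.
- apply: eq_integral => w _; rewrite fsumEFin//; congr (_%:E).
  rewrite [in RHS]fimfunE; under eq_fsbigr do rewrite mulrA.
  by rewrite mulr_fsuml.
- by move=> k; apply/measurable_EFinP; apply: measurable_funM => //; exact: measurable_cst.
- move=> k w _; rewrite lee_fin mulrA mulr_ge0//.
  by have := nnfun_muleindic_ge0 h k w; rewrite -EFinM lee_fin.
Qed.

Lemma density_integral (f : T -> \bar R) : measurable_fun setT f -> (forall w, 0 <= f w)%E ->
  (\int[m1]_w f w = \int[m2]_w (f w * (M w)%:E))%E.
Proof.
move=> mf f0; pose h := nnsfun_approx measurableT mf.
have cvf w : (h n w)%:E @[n --> \oo] --> f w.
  by apply: cvg_nnsfun_approx => // w' _; exact: f0.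
have ndh w : {homo (fun n => (h n w)%:E) : n m / (n <= m)%N >-> (n <= m)%E}.
  by move=> n m nm; rewrite lee_fin; exact/lefP/nd_nnsfun_approx.
have c1 := cvg_monotone_convergence (mu := m1) measurableT
  (g' := fun n w => (h n w)%:E) _ _ _.
have {}c1 : (\int[m1]_w (h n w)%:E)%E @[n --> \oo] --> (\int[m1]_w f w)%E.
  have -> : (\int[m1]_w f w = \int[m1]_w limn (fun n => (h n w)%:E))%E.
    by apply: eq_integral => w _; apply/esym/cvg_lim => //; exact: cvf.
  apply: c1 => //.
  - by move=> n; exact/measurable_EFinP.
  - by move=> n w _; rewrite lee_fin.
have cvM w : (h n w * M w)%:E @[n --> \oo] --> (f w * (M w)%:E)%E.
  by under eq_fun do rewrite EFinM; apply: cvgeZr => //; exact: cvf.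
have c2 : (\int[m2]_w (h n w * M w)%:E)%E @[n --> \oo] --> (\int[m2]_w (f w * (M w)%:E))%E.
  have -> : (\int[m2]_w (f w * (M w)%:E) = \int[m2]_w limn (fun n => (h n w * M w)%:E))%E.
    by apply: eq_integral => w _; apply/esym/cvg_lim => //; exact: cvM.
  apply: cvg_monotone_convergence => //.
  - by move=> n; apply/measurable_EFinP; exact: measurable_funM.
  - by move=> n w _; rewrite lee_fin mulr_ge0.
  - by move=> w _ n m nm; rewrite lee_fin ler_wpM2r// -lee_fin ndh.
apply: (@cvg_unique _ _ _ _ _ _ c1); first exact: ereal_hausdorff.
have E : (fun n => \int[m1]_w (h n w)%:E)%E = (fun n => \int[m2]_w (h n w * M w)%:E)%E.
  by apply/funext => n; exact: density_integral_nnsfun.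
by rewrite /= E.
Qed.

End Density.

(** * The integrated-tail law of the increment, and [vbar], [wbar] *)

Section StationaryExcess.
Context {R : realType} {d : measure_display} {T : measurableType d}.
Variable P : probability T R.
Variables (A B D : nat -> T -> R) (g1 g2 : R).
Let Y0 := Y A B D g1 g2 0.
Hypothesis mY : measurable_fun setT Y0.
Hypothesis SY : in_Sstar P Y0.
Hypothesis EY0 : EY P A B D g1 g2 < 0.

Let Wt := Wtail P A B D g1 g2.
Let v := vbar P A B D g1 g2.
Let w_ := wbar P A B D g1 g2.
Let J (t : R) := (\int[lebesgue_measure]_(s in [set s : R | (t <= s)%R]) (tailP P Y0 s)%:E)%E.
Let kappa := - (EY P A B D g1 g2)^-1.

Let kappa_gt0 : 0 < kappa. Proof. by rewrite oppr_gt0 invr_lt0. Qed.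

Let mtail (S : set R) : measurable_fun S (EFin \o tailP P Y0).
Proof. by apply/measurable_EFinP; apply: measurable_funTS; exact: measurable_tailP. Qed.

Let mray (t : R) : measurable [set s : R | t <= s].
Proof.
rewrite (_ : [set s | _] = `[t, +oo[%classic); first exact: measurable_itv.
by apply/seteqP; split => s /=; rewrite in_itv/= andbT.
Qed.

Let J_fin t : 0 <= t -> J t \is a fin_num.
Proof.
move=> t0; rewrite ge0_fin_numE; first exact: Sstar_integral_lty.
by apply: integral_ge0 => s _; rewrite lee_fin tailP_ge0.
Qed.

Let J_nincr t t' : t <= t' -> (J t' <= J t)%E.
Proof.
move=> tt'; apply: ge0_subset_integral.
- exact: mray.
- exact: mray.
- exact: mtail.
- by move=> s _; rewrite lee_fin tailP_ge0.
- by move=> s /=; exact: le_trans.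
Qed.

Let J_gt0 t : (0 < J t)%E.
Proof.
apply: (@lt_le_trans _ _ (\int[lebesgue_measure]_(s in [set s : R | (t <= s <= t + 1)%R]) (tailP P Y0 (t + 1))%:E)%E).
  rewrite integral_cst; last exact: set_itvcc_measurable.
  have H : lebesgue_measure [set s : R | t <= s <= t + 1] = 1%E.
    rewrite (_ : [set s | _] = `[t, t + 1]%classic); last by apply/seteqP; split => u /=; rewrite in_itv.
    by rewrite lebesgue_measure_itv/= lte_fin ltrDl ltr01 -EFinD addrAC subrr add0r.
  rewrite (_ : (_ * _)%E = (tailP P Y0 (t + 1))%:E) ?lte_fin; first exact: Sstar_tail_gt0.
  by rewrite -[RHS]mule1; congr (_ * _)%E; exact: H.
apply: (@le_trans _ _ (\int[lebesgue_measure]_(s in [set s : R | (t <= s <= t + 1)%R]) (tailP P Y0 s)%:E)%E).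
  apply: ge0_le_integral.
  - exact: set_itvcc_measurable.
  - by move=> s _; rewrite lee_fin tailP_ge0.
  - exact: measurable_cst.
  - exact: mtail.
  - by move=> s /= /andP[_ st]; rewrite lee_fin tailP_nincr.
apply: ge0_subset_integral.
- exact: set_itvcc_measurable.
- exact: mray.
- exact: mtail.
- by move=> s _; rewrite lee_fin tailP_ge0.
- by move=> s /= /andP[].
Qed.

Lemma Wtail_gt0 t : 0 < Wt t.
Proof.
have [t0|t0] := ltP t 0; first by rewrite /Wt /Wtail t0.
rewrite /Wt /Wtail [t < 0]ltNge t0/= lt_min ltr01/= mulr_gt0//.
by apply: fine_gt0; rewrite J_gt0/= -ge0_fin_numE ?J_fin// ltW// J_gt0.
Qed.

Lemma Wtail_le1 t : Wt t <= 1.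
Proof. by rewrite /Wt /Wtail; case: ltP => // _; rewrite ge_min lexx. Qed.

Lemma Wtail_nincr t t' : t <= t' -> Wt t' <= Wt t.
Proof.
move=> tt'; have [t0|t0] := ltP t 0.
  by rewrite [leRHS]/Wt /Wtail t0 Wtail_le1.
rewrite /Wt /Wtail ltNge (le_trans t0 tt')/= ltNge t0/= le_min !ge_min lexx/=.
apply/orP; right; rewrite ler_wpM2l ?(ltW kappa_gt0)//.
by apply: fine_le; [apply: J_fin; exact: le_trans tt'|exact: J_fin|exact: J_nincr].
Qed.

Lemma Wtail_le t : 0 <= t -> ((Wt t)%:E <= kappa%:E * J t)%E.
Proof.
move=> t0; rewrite /Wt /Wtail ltNge t0/= -[X in (_ <= _ * X)%E]fineK ?J_fin// -EFinM.
by rewrite lee_fin ge_min lexx orbT.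
Qed.

Lemma vbar_gt0 u : 0 < v u. Proof. exact: Wtail_gt0. Qed.

Lemma vbar_le1 u : v u <= 1. Proof. exact: Wtail_le1. Qed.

Lemma vbar_pos u : 0 < u -> v u = 1.
Proof. by move=> u0; rewrite /v /vbar /Wtail oppr_lt0 u0. Qed.

Lemma vbar_ndecr u u' : u <= u' -> v u <= v u'.
Proof. by move=> uu'; apply: Wtail_nincr; rewrite lerN2. Qed.

Lemma measurable_vbar : measurable_fun setT v.
Proof. by apply: nondecreasing_measurable => // x y; exact: vbar_ndecr. Qed.

Let measurable_v_shift u : measurable_fun setT (fun w => v (u + Y0 w)).
Proof.
apply: measurableT_comp measurable_vbar _.
by apply: measurable_funD => //; exact: measurable_cst.
Qed.

Let int_v_le1 u : (\int[P]_w (v (u + Y0 w))%:E <= 1)%E.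
Proof.
rewrite -[leRHS](integral_prob_cst P 1); apply: ge0_le_integral => //.
- by move=> w _; rewrite lee_fin ltW// vbar_gt0.
- exact/measurable_EFinP.
- by move=> w _; rewrite lee_fin vbar_le1.
Qed.

Lemma wbarE u : (w_ u)%:E = (\int[P]_w (v (u + Y0 w))%:E)%E.
Proof.
rewrite fineK// ge0_fin_numE; first exact: le_lt_trans (int_v_le1 u) (ltry _).
by apply: integral_ge0 => w _; rewrite lee_fin ltW// vbar_gt0.
Qed.

Lemma wbar_ndecr u u' : u <= u' -> w_ u <= w_ u'.
Proof.
move=> uu'; rewrite -lee_fin [leLHS]wbarE [leRHS]wbarE; apply: ge0_le_integral => //.
- by move=> w _; rewrite lee_fin ltW// vbar_gt0.
- exact/measurable_EFinP.
- exact/measurable_EFinP.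
- by move=> w _; rewrite lee_fin vbar_ndecr// lerD2r.
Qed.

Lemma measurable_wbar : measurable_fun setT w_.
Proof. by apply: nondecreasing_measurable => // x y; exact: wbar_ndecr. Qed.

(** On [Y_1 > 0], an event of positive probability, [v (u + Y_1) >= v u > 0]. *)
Lemma wbar_gt0 u : 0 < w_ u.
Proof.
rewrite -lte_fin [X in (_ < X)%E]wbarE.
pose S := [set w | 0 < Y0 w].
have mS : measurable S by exact: measurable_gtr_cst.
apply: (@lt_le_trans _ _ (\int[P]_(w in S) (v u)%:E)%E).
  rewrite integral_cst// -[X in (_ * X)%E]/(P S) [P S]tailPE// -EFinM lte_fin mulr_gt0 ?vbar_gt0//.
  exact: Sstar_tail_gt0.
apply: (@le_trans _ _ (\int[P]_(w in S) (v (u + Y0 w))%:E)%E).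
  apply: ge0_le_integral => //.
  - by move=> w _; rewrite lee_fin ltW// vbar_gt0.
  - by apply/measurable_EFinP; exact: measurable_funTS.
  - by move=> w; rewrite /S /= => Yw; rewrite lee_fin vbar_ndecr// lerDl ltW.
apply: ge0_subset_integral => //.
- exact/measurable_EFinP.
- by move=> w _; rewrite lee_fin ltW// vbar_gt0.
Qed.

End StationaryExcess.

(** * The second moment of the likelihood ratio at the passage time *)

Section Supersolution.
Context {R : realType} {d : measure_display} {T : measurableType d}.
Variable P : probability T R.
Variables (Psi : nat -> T -> R -> R) (A B D : nat -> T -> R) (g1 g2 delta astar x : R).
Hypothesis mmodel : measurable_model Psi A B D.
Hypothesis iid : iid_tuples P Psi A B D.
Let Yk := Y A B D g1 g2.
Hypothesis SY : in_Sstar P (Yk 0).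
Hypothesis EY0 : EY P A B D g1 g2 < 0.
Hypothesis delta01 : 0 < delta < 1.
Hypothesis astar_le0 : astar <= 0.
Let v := vbar P A B D g1 g2.
Let w_ := wbar P A B D g1 g2.
Hypothesis v2w2 : forall u, u <= astar ->
  - delta <= (v u ^+ 2 - w_ u ^+ 2) / (tailP P (Yk 0) (- u) * w_ u).

Let S := Sw A B D g1 g2.
Let s := sx g1 g2 x.
Let u_ n w : R := S n w + astar - s.
Let before (n : nat) : set nat := [set k | (k < n)%N].
Let T_ n := sigmaT Psi A B D (before n).

(** The inverse of the martingale at the deterministic time [n]; on [hit_at n] it is the product
    that enters [LT]. *)
Definition like_ratio (n : nat) (w : T) : R :=
  \prod_(k < n) (w_ (u_ k w) / v (u_ k.+1 w)).

Definition hit_at (n : nat) : set T := [set w | tau A B D g1 g2 x w = Some n].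

Definition not_hit (n : nat) : set T := [set w | forall k, (k <= n)%N -> S k w <= s].

Let Yfun (y : R * R * R) : R :=
  Num.max (logp (Num.max y.1.2 0 + y.2) - g2) (ln y.1.1) + g1.

Let mYfun : measurable_fun setT Yfun.
Proof.
have m1 : measurable_fun setT (fun y : R * R * R => y.1.2).
  exact: measurableT_comp measurable_snd measurable_fst.
have m2 : measurable_fun setT (fun y : R * R * R => y.1.1).
  exact: measurableT_comp measurable_fst measurable_fst.
apply: measurable_funD; last exact: measurable_cst.
apply: measurable_maxr; last exact: measurableT_comp (@measurable_ln R) m2.
apply: measurable_funB; last exact: measurable_cst.
apply: measurable_maxr; last exact: measurable_cst.
apply: measurableT_comp (@measurable_ln R) _; apply: measurable_funD; last exact: measurable_snd.
by apply: measurable_maxr => //; exact: measurable_cst.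
Qed.

Let mY0 : measurable_fun setT (Yk 0).
Proof. exact: measurableT_comp mYfun (measurable_ABD mmodel 0%N). Qed.

Let v_gt0 := vbar_gt0 mY0 SY EY0.
Let w_gt0 := wbar_gt0 mY0 SY EY0.
Let mv := measurable_vbar mY0 SY EY0.
Let mw := measurable_wbar mY0 SY EY0.

Let measurable_Yk k m : (k < m)%N -> measurable_fun setT (Yk k : T_ m -> R).
Proof.
move=> km; have h : measurable_fun setT (ABD A B D k : T_ m -> R * R * R).
  exact: measurable_sigmaT_ABD.
exact: (measurableT_comp mYfun h).
Qed.

Lemma measurable_Sw n m : (n <= m)%N -> measurable_fun setT (S n : T_ m -> R).
Proof.
move=> nm; have h (k : 'I_n) : measurable_fun setT (Yk k : T_ m -> R).
  by apply: measurable_Yk; exact: leq_trans nm.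
exact: (measurable_sum (index_enum 'I_n) h).
Qed.

Let measurable_u n m : (n <= m)%N -> measurable_fun setT (u_ n : T_ m -> R).
Proof.
move=> nm; apply: measurable_funB; last exact: measurable_cst.
by apply: measurable_funD; [exact: measurable_Sw|exact: measurable_cst].
Qed.

Lemma like_ratio_gt0 n w : 0 < like_ratio n w.
Proof. by apply: prodr_gt0 => k _; rewrite divr_gt0// ?v_gt0 ?w_gt0. Qed.

Lemma measurable_like_ratio n m : (n <= m)%N ->
  measurable_fun setT (like_ratio n : T_ m -> R).
Proof.
move=> nm.
have mvV : measurable_fun setT (fun t => (v t)^-1).
  apply: nincr_measurable => t t' tt'; rewrite lef_pV2 ?posrE ?v_gt0//.
  exact: vbar_ndecr tt'.
have h (k : 'I_n) : measurable_fun setT ((fun w => w_ (u_ k w) / v (u_ k.+1 w)) : T_ m -> R).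
  have m1 : measurable_fun setT (u_ k : T_ m -> R).
    by apply: measurable_u; rewrite ltnW// (leq_trans _ nm).
  have m2 : measurable_fun setT (u_ k.+1 : T_ m -> R).
    by apply: measurable_u; exact: leq_trans nm.
  apply: measurable_funM; first exact: (measurableT_comp mw m1).
  exact: (measurableT_comp mvV m2).
by rewrite /like_ratio; apply: measurable_prod => k _; exact: h.
Qed.

Lemma hit_atP n w : hit_at n w <-> s < S n w /\ forall k, (k < n)%N -> S k w <= s.
Proof.
rewrite /hit_at /tau /first_hit/=; case: pselect => [h|h]; last first.
  by split => // -[h1 _]; exfalso; apply: h; exists n.
case: ex_minnP => m hm minm; split.
  move=> [<-]; split => // k km; rewrite leNgt; apply/negP => /minm.
  by rewrite leqNgt km.
move=> [h1 h2]; congr Some; apply/eqP; rewrite eqn_leq minm//=.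
by rewrite leqNgt; apply/negP => /h2; rewrite leNgt hm.
Qed.

Lemma measurable_hit_at n m : (n <= m)%N -> measurable (hit_at n : set (T_ m)).
Proof.
move=> nm; rewrite (_ : hit_at n = [set w | s < S n w] `&`
    \bigcap_(k in [set k | (k < n)%N]) [set w | S k w <= s]); last first.
  by apply/seteqP; split => w; rewrite hit_atP.
apply: measurableI.
  by apply: (@measurable_gtr_cst _ _ (T_ m)); exact: measurable_Sw.
apply: bigcap_measurableType => k /= kn.
apply: (@measurable_ler_cst _ _ (T_ m)); apply: measurable_Sw.
by rewrite (leq_trans _ nm)// ltnW.
Qed.

Lemma measurable_not_hit n m : (n <= m)%N -> measurable (not_hit n : set (T_ m)).
Proof.
move=> nm; rewrite (_ : not_hit n =
    \bigcap_(k in [set k | (k <= n)%N]) [set w | S k w <= s])//.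
apply: bigcap_measurableType => k /= kn.
by apply: (@measurable_ler_cst _ _ (T_ m)); apply: measurable_Sw; exact: leq_trans nm.
Qed.

(* [h] is a supersolution of the second-moment recursion: it equals the square
   of vbar up to level 0 and is lowered to 1 - delta above, which absorbs the
   defect allowed by the hypothesis on astar. *)
Let h (u : R) : R := if 0 < u then 1 - delta else v u ^+ 2.
(** This is [h / v], as [v = 1] above 0: the factor [w / v] of the likelihood ratio times [h]
    becomes [w] times [k_]. *)
Let k_ (u : R) : R := if 0 < u then 1 - delta else v u.
(** A lower bound of [h] on [[astar, +oo)], where the argument lies at the passage time. The minimum
    is taken because [h] need not be monotone across 0. *)
Let c0 : R := Num.min (1 - delta) (v astar ^+ 2).

Let delta1 : 0 < 1 - delta. Proof. by case/andP: delta01 => _; rewrite subr_gt0. Qed.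

Let h_gt0 u : 0 < h u.
Proof. by rewrite /h; case: ifP => // _; rewrite exprn_gt0. Qed.

Let k_ge0 u : 0 <= k_ u.
Proof. by rewrite /k_; case: ifP => _; rewrite ltW. Qed.

Let k_h u : h u = k_ u * v u.
Proof.
rewrite /h /k_; case: ifPn => [u0|_]; last by rewrite expr2.
by rewrite /v (vbar_pos _ _ _ _ _ _ u0) mulr1.
Qed.

Let c0_le_h u : astar <= u -> c0 <= h u.
Proof.
move=> au; rewrite /h /c0 ge_min; case: ifP => _; rewrite ?lexx// orbC.
by rewrite ler_sqr ?nnegrE ?(ltW (v_gt0 _))// (vbar_ndecr mY0 SY EY0 au).
Qed.

Let mk : measurable_fun setT k_.
Proof.
apply: measurable_fun_ifT; [|exact: measurable_cst|exact: mv].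
by apply: measurable_fun_ltr; [exact: measurable_cst|exact: measurable_id].
Qed.

(** With [t = P(Y_1 > -u)], the mean of [k_ (u + Y_1)] is [w - delta t], since [k_] is [v] lowered
    by [delta] above 0. The claim [w (w - delta t) <= v^2] is the hypothesis on [astar] with its
    denominator cleared. *)
Let one_step u : u <= astar ->
  (\int[P]_w (w_ u * k_ (u + Yk 0 w))%:E <= (h u)%:E)%E.
Proof.
move=> ua.
have mu : measurable_fun setT (fun w => u + Yk 0 w).
  by apply: measurable_funD; [exact: measurable_cst|exact: mY0].
have mku : measurable_fun setT (fun w => (k_ (u + Yk 0 w))%:E).
  by apply/measurable_EFinP; exact: (measurableT_comp mk mu).
pose t := tailP P (Yk 0) (- u).
have t0 : 0 < t by exact: Sstar_tail_gt0.
pose S0 := [set w | - u < Yk 0 w].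
have mS0 : measurable S0 by exact: measurable_gtr_cst.
have d0 : 0 <= delta by case/andP: delta01 => /ltW.
have kE : (\int[P]_w (k_ (u + Yk 0 w))%:E + (delta * t)%:E = (w_ u)%:E)%E.
  rewrite [RHS](wbarE mY0 SY EY0).
  have -> : ((delta * t)%:E = \int[P]_w (delta%:E * (\1_S0 w)%:E))%E.
    rewrite ge0_integralZl//; last by apply/measurable_EFinP; exact: measurable_indic.
    by rewrite integral_indic// setIT EFinM -tailPE.
  rewrite -ge0_integralD//.
  - apply: eq_integral => w _; rewrite -EFinM -EFinD /k_ -/v indicE; congr (_%:E).
    case: (ltP 0 (u + Yk 0 w)) => h0.
      rewrite mem_set; last by rewrite /S0/=; lra.
      by rewrite mulr1 subrK /v (vbar_pos _ _ _ _ _ _ h0).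
    rewrite memNset ?mulr0 ?addr0//; rewrite /S0/=; apply/negP; rewrite -leNgt; lra.
  - by move=> w _; rewrite lee_fin.
  - by move=> w _; rewrite -EFinM lee_fin mulr_ge0.
  - apply: emeasurable_funM; first exact: measurable_cst.
    by apply/measurable_EFinP; exact: measurable_indic.
have kfin : (\int[P]_w (k_ (u + Yk 0 w))%:E)%E \is a fin_num.
  rewrite ge0_fin_numE; last by apply: integral_ge0 => w _; rewrite lee_fin.
  apply: (@le_lt_trans _ _ (w_ u)%:E); last exact: ltry.
  by rewrite -kE leeDl// lee_fin mulr_ge0// ltW.
under eq_integral do rewrite EFinM.
rewrite ge0_integralZl//; last by rewrite lee_fin ltW// w_gt0.
  move: kE; rewrite -(fineK kfin) -EFinD -EFinM lee_fin => -[kE].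
  have -> : h u = v u ^+ 2 by rewrite /h ltNge (le_trans ua).
  have := v2w2 ua; rewrite -/t ler_pdivlMr ?mulr_gt0 ?w_gt0//.
  by rewrite -kE; set K := fine _; nra.
by move=> w _; rewrite lee_fin.
Qed.

Let mL n : measurable_fun (setT : set T) (like_ratio n).
Proof. exact: (measurable_from_sigmaT mmodel (measurable_like_ratio (leqnn n))). Qed.

Let mU n : measurable_fun (setT : set T) (u_ n).
Proof. exact: (measurable_from_sigmaT mmodel (measurable_u (leqnn n))). Qed.

Lemma measurableT_hit_at n : measurable (hit_at n).
Proof. exact: (sigma_gen_measurable mmodel (measurable_hit_at (leqnn n))). Qed.

Lemma measurableT_not_hit n : measurable (not_hit n).
Proof. exact: (sigma_gen_measurable mmodel (measurable_not_hit (leqnn n))). Qed.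

Let mh : measurable_fun setT h.
Proof.
have -> : h = (fun u => k_ u * v u) by apply/funext => u; exact: k_h.
exact: measurable_funM mk mv.
Qed.

(** The contribution still to come, as bounded by [h], from paths without a passage up to time [n];
    [a n] is what paths passing exactly at [n] contribute. *)
Let r n := (\int[P]_w (\1_(not_hit n) w * like_ratio n w * h (u_ n w))%:E)%E.
Let a n := (\int[P]_w (\1_(hit_at n) w * like_ratio n w)%:E)%E.

Let c0_gt0 : 0 < c0. Proof. by rewrite /c0 lt_min delta1 exprn_gt0. Qed.

Let split_ineq n w : c0 * (\1_(hit_at n.+1) w * like_ratio n.+1 w) +
    \1_(not_hit n.+1) w * like_ratio n.+1 w * h (u_ n.+1 w) <=
  \1_(not_hit n) w * like_ratio n.+1 w * h (u_ n.+1 w).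
Proof.
have L0 := ltW (like_ratio_gt0 n.+1 w); have h0 := ltW (h_gt0 (u_ n.+1 w)).
have [N|N] := pselect (not_hit n w); last first.
  have -> : \1_(not_hit n.+1) w = 0 :> R.
    by rewrite indicE memNset// => N'; apply: N => k kn; apply: N'; exact: leq_trans kn _.
  have -> : \1_(hit_at n.+1) w = 0 :> R.
    by rewrite indicE memNset// => /hit_atP[_ N']; apply: N => k kn; exact: N'.
  by rewrite !mul0r mulr0 addr0 -mulrA mulr_ge0// ?mulr_ge0// indicE.
rewrite [\1_(not_hit n) w]indicE mem_set// mul1r.
have [E|E] := ltP s (S n.+1 w).
  rewrite [\1_(hit_at n.+1) w]indicE mem_set; last by apply/hit_atP; split => // k kn; exact: N.
  rewrite [\1_(not_hit n.+1) w]indicE memNset; last first.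
    by move=> /(_ n.+1 (leqnn _)); rewrite leNgt E.
  rewrite !mul0r addr0 mul1r mulrC ler_wpM2l// c0_le_h// /u_; lra.
rewrite [\1_(hit_at n.+1) w]indicE memNset; last first.
  by move=> /hit_atP[]; rewrite ltNge E.
rewrite [\1_(not_hit n.+1) w]indicE mem_set; last first.
  by move=> k; rewrite leq_eqVlt => /predU1P[->//|kn]; exact: N.
by rewrite mul0r mulr0 add0r mul1r.
Qed.

Let ind_ge0 (E : set T) w : 0 <= \1_E w :> R. Proof. by rewrite indicE. Qed.

(** Freezing the first [n] tuples, [v] cancels between the last factor of the ratio and [h = k_ v].
    Absence of a passage up to [n] means [u_ n <= astar], which is where [one_step] applies. *)
Let r_step n : (c0%:E * a n.+1 + r n.+1 <= r n)%E.
Proof.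
pose F (z : T_ n * (R * R * R)) : \bar R := (\1_(not_hit n) z.1 * like_ratio n z.1 *
  (w_ (u_ n z.1) * k_ (u_ n z.1 + Yfun z.2)))%:E.
have F0 z : (0 <= F z)%E.
  by rewrite lee_fin !mulr_ge0// ?(ltW (w_gt0 _)) ?(ltW (like_ratio_gt0 _ _)).
have mF : measurable_fun setT F.
  apply/measurable_EFinP.
  have m1 : measurable_fun setT (u_ n \o fst : T_ n * (R * R * R) -> R).
    exact: (measurableT_comp (measurable_u (leqnn n)) measurable_fst).
  apply: measurable_funM.
    apply: (measurableT_comp (f := (fun w => \1_(not_hit n) w * like_ratio n w) : T_ n -> R) _ measurable_fst).
    apply: measurable_funM; last exact: measurable_like_ratio.
    by apply: measurable_indic; exact: measurable_not_hit.
  apply: measurable_funM; first exact: (measurableT_comp mw m1).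
  apply: (measurableT_comp mk); apply: measurable_funD; first exact: m1.
  exact: (measurableT_comp mYfun measurable_snd).
have nin : ~ before n n by rewrite /before /= ltnn.
have mind (E : set T) : measurable E -> measurable_fun setT (\1_E : T -> R).
  by move=> mE; exact: measurable_indic.
have := freezing mmodel iid nin mF F0.
have -> : (\int[P]_w F (w, ABD A B D n w) =
    \int[P]_w (\1_(not_hit n) w * like_ratio n.+1 w * h (u_ n.+1 w))%:E)%E.
  apply: eq_integral => w _; rewrite /F /=; congr (_%:E).
  rewrite /like_ratio big_ord_recr/= k_h -/(like_ratio n w) -/v -/w_.
  have -> : u_ n w + Yfun (ABD A B D n w) = u_ n.+1 w.
    by rewrite /u_ /S /Sw big_ord_recr/= -[Yfun _]/(Yk n w) /Yk; ring.
  have := v_gt0 (u_ n.+1 w); rewrite -/v => vn; field; exact: lt0r_neq0.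
move=> fr.
have le1 : (c0%:E * a n.+1 + r n.+1 <=
    \int[P]_w (\1_(not_hit n) w * like_ratio n.+1 w * h (u_ n.+1 w))%:E)%E.
  rewrite /a -ge0_integralZl//; last 3 first.
  - apply/measurable_EFinP/measurable_funM => //; apply: mind; exact: measurableT_hit_at.
  - by move=> w _; rewrite lee_fin mulr_ge0// (ltW (like_ratio_gt0 _ _)).
  - by rewrite lee_fin ltW.
  rewrite /r -ge0_integralD//; last 4 first.
  - by move=> w _; rewrite -EFinM lee_fin !mulr_ge0// ?(ltW (like_ratio_gt0 _ _)) ?(ltW c0_gt0).
  - apply: emeasurable_funM; first exact: measurable_cst.
    apply/measurable_EFinP/measurable_funM => //; apply: mind; exact: measurableT_hit_at.
  - by move=> w _; rewrite lee_fin !mulr_ge0// ?(ltW (like_ratio_gt0 _ _)) ?(ltW (h_gt0 _)).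
  - apply/measurable_EFinP/measurable_funM; last exact: (measurableT_comp mh).
    by apply: measurable_funM => //; apply: mind; exact: measurableT_not_hit.
  apply: ge0_le_integral => //.
  - move=> w _; rewrite -EFinM -EFinD lee_fin addr_ge0// !mulr_ge0// ?(ltW (like_ratio_gt0 _ _)) ?(ltW (h_gt0 _)) ?(ltW c0_gt0)//.
  - apply: emeasurable_funD.
      apply: emeasurable_funM; first exact: measurable_cst.
      apply/measurable_EFinP/measurable_funM => //; apply: mind; exact: measurableT_hit_at.
    apply/measurable_EFinP/measurable_funM; last exact: (measurableT_comp mh).
    by apply: measurable_funM => //; apply: mind; exact: measurableT_not_hit.
  - apply/measurable_EFinP/measurable_funM; last exact: (measurableT_comp mh).
    by apply: measurable_funM => //; apply: mind; exact: measurableT_not_hit.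
  - by move=> w _; rewrite -EFinM -EFinD lee_fin; exact: split_ineq.
apply: (le_trans le1); rewrite fr /r.
apply: ge0_le_integral => //.
- by move=> w _; apply: integral_ge0 => w' _; exact: F0.
- apply: (@measurable_fun_fubini_tonelli_F _ _ _ _ R P (fun z : T * T => F (z.1, ABD A B D 0 z.2))).
    apply: (measurableT_comp mF); apply: measurable_fun_pair.
      have h1 := measurable_to_sigmaT (I := before n) mmodel.
      have h2 : measurable_fun setT (fst : T * T -> T) by exact: measurable_fst.
      exact: (measurableT_comp h1 h2).
    exact: measurableT_comp (measurable_ABD mmodel 0%N) measurable_snd.
  by move=> z; exact: F0.
- apply/measurable_EFinP/measurable_funM; last exact: (measurableT_comp mh).
  by apply: measurable_funM => //; apply: mind; exact: measurableT_not_hit.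
- move=> w _; rewrite /F/=.
  have [N|N] := pselect (not_hit n w); last first.
    rewrite [\1_(not_hit n) w]indicE memNset// !mul0r.
    by under eq_integral do rewrite !mul0r; rewrite integral0.
  rewrite [\1_(not_hit n) w]indicE mem_set// !mul1r.
  under eq_integral do rewrite EFinM.
  rewrite ge0_integralZl//; last 3 first.
  - apply/measurable_EFinP; apply: measurable_funM; first exact: measurable_cst.
    apply: (measurableT_comp mk); apply: measurable_funD; first exact: measurable_cst.
    exact: mY0.
  - by move=> w' _; rewrite lee_fin mulr_ge0// (ltW (w_gt0 _)).
  - by rewrite lee_fin (ltW (like_ratio_gt0 _ _)).
  rewrite EFinM; apply: lee_wpmul2l; first by rewrite lee_fin (ltW (like_ratio_gt0 _ _)).
  by apply: one_step; have := N n (leqnn n); rewrite /u_; lra.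
Qed.

Let r_init : (c0%:E * a 0%N + r 0%N <= (v (astar - s) ^+ 2)%:E)%E.
Proof.
have L1 w : like_ratio 0 w = 1 by rewrite /like_ratio big_ord0.
have S0 w : S 0%N w = 0 by rewrite /S /Sw big_ord0.
(* If [s < 0] the passage occurs at time 0: [r 0] vanishes, [a 0 = 1], and [c0 <= v astar ^+ 2]
   suffices by monotonicity. Otherwise [a 0] vanishes and [r 0] is exactly the right-hand side. *)
have [s0|s0] := ltP s 0.
  have -> : r 0%N = 0%E.
    rewrite /r -[RHS](integral0 P setT); apply: eq_integral => w _.
    rewrite indicE memNset ?mul0r// => /(_ 0%N (leqnn _)).
    by rewrite S0 leNgt s0.
  have -> : a 0%N = 1%E.
    rewrite -[RHS](integral_prob_cst P 1); apply: eq_integral => w _.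
    by rewrite L1 mulr1 indicE mem_set//; apply/hit_atP; rewrite S0.
  rewrite mule1 adde0 lee_fin; apply: le_trans (_ : v astar ^+ 2 <= _).
    by rewrite /c0 ge_min lexx orbT.
  rewrite ler_sqr ?nnegrE ?(ltW (v_gt0 _))//.
  by apply: (vbar_ndecr mY0 SY EY0); lra.
have -> : a 0%N = 0%E.
  rewrite /a -[RHS](integral0 P setT); apply: eq_integral => w _.
  by rewrite indicE memNset ?mul0r// => /hit_atP[]; rewrite S0 ltNge s0.
have -> : r 0%N = (h (astar - s))%:E.
  rewrite -(integral_prob_cst P); apply: eq_integral => w _.
  rewrite L1 mulr1 indicE mem_set ?mul1r ?/u_ ?S0 ?add0r//.
  by move=> k; rewrite leqn0 => /eqP ->; rewrite S0.
rewrite mule0 add0e lee_fin /h ltNge (_ : astar - s <= 0)//.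
by have := astar_le0; lra.
Qed.

(** [r_step] telescopes from [r_init], and the remaining [r] is nonnegative. *)
Lemma second_moment_bound n :
  (c0%:E * (\sum_(k < n) \int[P]_w (\1_(hit_at k) w * like_ratio k w)%:E) <=
   (v (astar - s) ^+ 2)%:E)%E.
Proof.
have a0 k : (0 <= a k)%E.
  by apply: integral_ge0 => w _; rewrite lee_fin mulr_ge0// (ltW (like_ratio_gt0 _ _)).
have r0 k : (0 <= r k)%E.
  by apply: integral_ge0 => w _; rewrite lee_fin !mulr_ge0// ?(ltW (like_ratio_gt0 _ _)) ?(ltW (h_gt0 _)).
have c00 : (0 <= c0%:E)%E by rewrite lee_fin ltW.
have sum0 m : (0 <= \sum_(k < m) a k)%E by apply: sume_ge0 => k _.
have sumS (b : nat -> \bar R) m : (forall k, 0 <= b k)%E ->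
    (c0%:E * (\sum_(k < m.+2) b k) = c0%:E * (\sum_(k < m.+1) b k) + c0%:E * b m.+1)%E.
  by move=> b0; rewrite big_ord_recr/= ge0_muleDr// sume_ge0.
have H m : (c0%:E * (\sum_(k < m.+1) a k) + r m <= (v (astar - s) ^+ 2)%:E)%E.
  elim: m => [|m IH]; first by rewrite big_ord_recr big_ord0/= add0e.
  rewrite (sumS a m a0) -addeA; apply: le_trans IH.
  by apply: leeD2l; exact: r_step.
case: n => [|n]; first by rewrite big_ord0 mule0 lee_fin exprn_ge0// (ltW (v_gt0 _)).
by apply: le_trans (H n); rewrite leeDl.
Qed.

End Supersolution.

Section RestrictedIntegral.
Context {R : realType} d (T : measurableType d) (mu : {measure set T -> \bar R}).

Lemma integral_mrestr (D : set T) (mD : measurable D) (f : T -> \bar R) :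
  measurable_fun setT f -> (forall w, 0 <= f w)%E ->
  (\int[mrestr mu mD]_w f w = \int[mu]_w (f w * (\1_D w)%:E))%E.
Proof.
move=> mf f0; apply: density_integral => //.
- by move=> E mE; rewrite -[LHS]/(mu (E `&` D)) -[in LHS](setIT (E `&` D)) -integral_indic//;
    [apply: eq_integral => w _; rewrite indicI|exact: measurableI].
Qed.

End RestrictedIntegral.

(** * Expectations under the tilted law, written under the original one *)

Section ChangeOfMeasure.
Context {R : realType} {d : measure_display} {T : measurableType d}.
Variables (P Q : probability T R).
Variables (Psi : nat -> T -> R -> R) (A B D : nat -> T -> R) (g1 g2 astar x : R).
Hypothesis mmodel : measurable_model Psi A B D.
Hypothesis SY : in_Sstar P (Y A B D g1 g2 0).
Hypothesis EY0 : EY P A B D g1 g2 < 0.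
Hypothesis LipPsi : forall n w, (Lip (Psi n w) < +oo)%E.
Hypothesis tildeQ : is_tilde_measure P Psi A B D g1 g2 astar x Q.

Let before (n : nat) : set nat := [set k | (k < n)%N].
Let T_ n := sigmaT Psi A B D (before n).
Let L := like_ratio P A B D g1 g2 astar x.
Let E_ := hit_at A B D g1 g2 x.
Let Tf : set T := [set w | T_finite Psi x w].
Let Tf_ m : set T := [set w | exists2 k, (k <= m)%N & x < Zn Psi k w].

Let mY0 : measurable_fun setT (Y A B D g1 g2 0).
Proof. by case: mmodel => _ [? [? ?]]; exact: measurable_Y0. Qed.

Let L_gt0 n w : 0 < L n w.
Proof. exact: like_ratio_gt0 mmodel SY EY0 n w. Qed.

Let L_V n w : \prod_(k < n) (vg P A B D g1 g2 x (Sw A B D g1 g2 k.+1 w + astar) /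
   wg P A B D g1 g2 x (Sw A B D g1 g2 k w + astar)) = (L n w)^-1.
Proof.
by rewrite /L /like_ratio -prodfV; apply: eq_bigr => k _; rewrite invf_div.
Qed.

Let Mstop_hit n m w : (n <= m)%N -> E_ n w ->
  Mstop P A B D g1 g2 astar x m w = (L n w)^-1.
Proof. by move=> nm Ew; rewrite /Mstop Ew/= (minn_idPr nm) L_V. Qed.

(** For every [m >= n] the stopped martingale equals [1 / L n] on passage at [n]. Horizons beyond
    [n] are needed because finiteness of [T(x)] is not decided at the passage time. *)
Lemma tilde_integral_hit n m (f : T -> \bar R) : (n <= m)%N ->
  measurable_fun setT (f : T_ m -> \bar R) -> (forall w, 0 <= f w)%E ->
  (\int[Q]_w (f w * (\1_(E_ n) w)%:E) = \int[P]_w (f w * ((\1_(E_ n) w / L n w))%:E))%E.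
Proof.
move=> nm mf f0.
have mJ := isMeasurableFun.Build _ _ _ _ (id : T -> T_ m)
  (measurable_to_sigmaT (I := before m) mmodel).
pose J : {mfun T >-> T_ m} := HB.pack (id : T -> T_ m) mJ.
pose M (w : T_ m) : R := \1_(E_ n) w / L n w.
have mE : measurable (E_ n : set (T_ m)) by exact: measurable_hit_at.
have mL : measurable_fun setT (L n : T_ m -> R) by exact: (measurable_like_ratio _ _ mmodel SY EY0).
have mM : measurable_fun setT M.
  apply: measurable_funM; first exact: measurable_indic.
  have -> : (fun w => (L n w)^-1) = expR \o (fun w => - ln (L n w)).
    by apply/funext => w /=; rewrite expRN lnK// posrE.
  apply: measurableT_comp => //; apply: measurableT_comp => //.
  exact: measurableT_comp (@measurable_ln R) mL.
have M0 w : 0 <= M w by rewrite mulr_ge0// ?invr_ge0 ?ltW// indicE.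
have mfM : measurable_fun setT ((fun w => (f w * (M w)%:E)%E) : T_ m -> \bar R).
  by apply: emeasurable_funM => //; exact/measurable_EFinP.
have mfE : measurable_fun setT ((fun w => (f w * (\1_(E_ n) w)%:E)%E) : T_ m -> \bar R).
  by apply: emeasurable_funM => //; apply/measurable_EFinP; exact: measurable_indic.
transitivity (\int[mrestr (distribution Q J) mE]_w f w)%E.
  rewrite (integral_mrestr (distribution Q J) mE mf f0) ge0_integral_distribution//.
  by move=> w; rewrite mule_ge0// lee_fin indicE.
transitivity (\int[distribution P J]_w (f w * (M w)%:E))%E; last first.
  by rewrite ge0_integral_distribution// => w; rewrite mule_ge0// lee_fin.
apply: density_integral => // F mF.
have mFE : measurable (F `&` E_ n : set (T_ m)) by exact: measurableI.
rewrite -[LHS]/(Q (F `&` E_ n)) (tildeQ (n := m) (E := F `&` E_ n) mFE).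
rewrite ge0_integral_distribution//.
- apply: eq_integral => w _ /=; congr (_%:E); rewrite /M indicI/= -mulrA; congr (_ * _).
  rewrite [\1_(E_ n) w]indicE; have [Ew|Ew] := pselect (E_ n w).
    by rewrite mem_set// !mul1r (Mstop_hit nm Ew).
  by rewrite memNset// !mul0r.
- apply/measurable_EFinP/measurable_funM => //; exact: measurable_indic.
- by move=> w; rewrite lee_fin mulr_ge0// indicE.
Qed.

Let measurable_Zn n m : (n <= m)%N -> measurable_fun setT (Zn Psi n : T_ m -> R).
Proof.
move=> nm; apply: (measurable_Zfrom LipPsi (j := 0%N)) => k /= kn.
by rewrite /before /=; exact: leq_trans nm.
Qed.

Let measurable_Tf_ m : measurable (Tf_ m : set (T_ m)).
Proof.
rewrite (_ : Tf_ m = \bigcup_(k in [set k | (k <= m)%N]) [set w | x < Zn Psi k w]); last first.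
  by apply/seteqP; split => w [k km h]; exists k.
apply: bigcup_measurable => k /= km.
by apply: (@measurable_gtr_cst _ _ (T_ m)); exact: measurable_Zn.
Qed.

Let mTf_ m : measurable (Tf_ m).
Proof.
have H : <<s gen Psi A B D (before m) >> (Tf_ m) := @measurable_Tf_ m.
exact: (sigma_gen_measurable mmodel H).
Qed.

Lemma measurable_Tf : measurable Tf.
Proof.
rewrite (_ : Tf = \bigcup_m Tf_ m); last first.
  apply/seteqP; split => w; first by move=> [k h]; exists k => //; exists k.
  by move=> [m _ [k _ h]]; exists k.
apply: bigcupT_measurable => m.
exact: mTf_.
Qed.

Let mE n : measurable (E_ n).
Proof. exact: (measurableT_hit_at g1 g2 x mmodel). Qed.

(** Finiteness of [T(x)] is the increasing union of the events [Tf_ m], each decided at a finite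
    horizon, so both sides are monotone limits. *)
Lemma tilde_integral_hit_Tf n (f : T -> R) :
  measurable_fun setT (f : T_ n -> R) -> (forall w, 0 <= f w) ->
  (\int[Q]_(w in E_ n `&` Tf) (f w)%:E = \int[P]_(w in E_ n `&` Tf) (f w / L n w)%:E)%E.
Proof.
move=> mf f0.
pose F m := E_ n `&` Tf_ (n + m)%N.
have FU : \bigcup_m F m = E_ n `&` Tf.
  apply/seteqP; split => w.
    by move=> [m _ [Ew [k _ h]]]; split => //; exists k.
  by move=> [Ew [k h]]; exists k => //; split => //; exists k => //; rewrite leq_addl.
have mF m : measurable (F m).
  by apply: measurableI => //; exact: mTf_.
have ndF : {homo F : i j / (i <= j)%N >-> (i <= j)%O}.
  move=> i j ij; apply/subsetPset => w [Ew [k kn h]]; split => //; exists k => //.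
  by rewrite (leq_trans kn)// leq_add2l.
have mfT : measurable_fun (setT : set T) f by exact: (measurable_from_sigmaT mmodel (I := before n) (f := f)).
have mLT : measurable_fun (setT : set T) (fun w => f w / L n w).
  have mL : measurable_fun (setT : set T) (L n).
    by apply: (measurable_from_sigmaT mmodel); exact: (measurable_like_ratio _ _ mmodel SY EY0).
  apply: measurable_funM => //.
  have -> : (fun w => (L n w)^-1) = expR \o (fun w => - ln (L n w)).
    by apply/funext => w /=; rewrite expRN lnK// posrE.
  apply: measurableT_comp => //; apply: measurableT_comp => //.
  exact: measurableT_comp (@measurable_ln R) mL.
have fL0 w : 0 <= f w / L n w by rewrite divr_ge0// ltW.
have c1 := @ge0_nondecreasing_set_cvg_integral _ _ _ F (EFin \o f) Q ndF mF.
have c2 := @ge0_nondecreasing_set_cvg_integral _ _ _ F (fun w => (f w / L n w)%:E) P ndF mF.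
rewrite FU in c1, c2.
apply: (@cvg_unique _ _ _ _ _ _ (c1 _ _)); first exact: ereal_hausdorff.
- by move=> m; apply/measurable_EFinP; exact: measurable_funTS.
- by move=> m w _; rewrite lee_fin.
have -> : (fun m => \int[Q]_(w in F m) (EFin \o f) w)%E =
    (fun m => \int[P]_(w in F m) (f w / L n w)%:E)%E.
  apply/funext => m; rewrite integral_mkcond [RHS]integral_mkcond.
  rewrite !epatch_indic.
  have := @tilde_integral_hit n (n + m)%N (fun w => (f w * \1_(Tf_ (n + m)%N) w)%:E) (leq_addr _ _).
  have FI w : \1_(F m) w = \1_(E_ n) w * \1_(Tf_ (n + m)%N) w :> R by rewrite /F indicI.
  move=> h; transitivity (\int[Q]_w ((f w * \1_(Tf_ (n + m)%N) w)%:E * (\1_(E_ n) w)%:E))%E.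
    by apply: eq_integral => w _ /=; rewrite -!EFinM FI; congr (_%:E); ring.
  rewrite h.
  - by apply: eq_integral => w _ /=; rewrite -!EFinM FI; congr (_%:E); ring.
  - apply/measurable_EFinP/measurable_funM.
      apply: (measurable_sigmaT_mono (I := before n)) => // k /=.
      by rewrite /before /= => kn; rewrite (leq_trans kn)// leq_addr.
    by apply: measurable_indic; exact: measurable_Tf_.
  - by move=> w; rewrite lee_fin mulr_ge0// indicE.
apply: c2.
- by move=> m; apply/measurable_EFinP; exact: measurable_funTS.
- by move=> m w _; rewrite lee_fin.
Qed.

Let LT_hit n w : E_ n w -> LT P Psi A B D g1 g2 astar x w = \1_Tf w * L n w.
Proof.
move=> Ew; rewrite /LT indicE; case: asboolP => h.
  by rewrite mem_set// mul1r Ew.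
by rewrite memNset// mul0r.
Qed.

Let LT_nohit w : (forall n, ~ E_ n w) -> LT P Psi A B D g1 g2 astar x w = 0.
Proof.
move=> nE; rewrite /LT; case: asboolP => // h; case e : tau => [t|//].
by case: (nE t).
Qed.

Let trivE : trivIset setT E_.
Proof.
apply/trivIsetP => i j _ _ ij; apply/seteqP; split => // w /= [Ei Ej].
by move: Ei; rewrite /E_ /hit_at /= Ej => -[ji]; move: ij; rewrite ji eqxx.
Qed.

(** The density [1 / L n] on passage at [n] cancels one of the [p + 1] factors. The case [p = 0]
    gives the mean, [p = 1] the second moment. *)
Lemma tilde_integral_LT_pow p :
  (\int[Q]_w ((LT P Psi A B D g1 g2 astar x w) ^+ p.+1)%:E =
   \sum_(n <oo) \int[P]_(w in E_ n `&` Tf) ((L n w) ^+ p)%:E)%E.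
Proof.
set LTx := LT _ _ _ _ _ _ _ _ _.
have LTp n w : E_ n w -> LTx w ^+ p.+1 = \1_Tf w * L n w ^+ p.+1.
  move=> Ew; rewrite /LTx (LT_hit Ew) exprMn; congr (_ * _).
  by rewrite indicE; case: (w \in Tf); rewrite ?expr1n// expr0n.
have mLn n : measurable_fun (setT : set (T_ n)) (L n : T_ n -> R).
  exact: (measurable_like_ratio _ _ mmodel SY EY0).
have -> : (\int[Q]_w (LTx w ^+ p.+1)%:E = \int[Q]_(w in \bigcup_n E_ n) (LTx w ^+ p.+1)%:E)%E.
  rewrite [RHS]integral_mkcond; apply: eq_integral => w _; rewrite patchE.
  case: ifPn => // /negP nE; rewrite /LTx LT_nohit ?expr0n// => n Ew.
  by apply: nE; rewrite inE; exists n.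
rewrite ge0_integral_bigcup//.
- apply: eq_eseriesr => n _.
  rewrite (_ : (\int[Q]_(w in E_ n) _)%E = \int[Q]_(w in E_ n `&` Tf) (L n w ^+ p.+1)%:E)%E.
    rewrite tilde_integral_hit_Tf; last 2 first.
    - exact: (measurable_funX p.+1 (mLn n)).
    - by move=> w; apply: exprn_ge0; exact: ltW.
    apply: eq_integral => w _; congr (_%:E).
    by rewrite exprSr mulfK// gt_eqF.
  rewrite integral_mkcond [RHS]integral_mkcond; apply: eq_integral => w _.
  rewrite !patchE in_setI; case: (boolP (w \in E_ n)) => //=; rewrite inE => Ew.
  rewrite (LTp _ _ Ew) indicE; case: (w \in Tf); by rewrite ?mul1r ?mul0r.
- apply/measurable_fun_bigcup => // n.
  apply: (eq_measurable_fun (fun w => (\1_Tf w * L n w ^+ p.+1)%:E)).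
    by move=> w; rewrite inE => Ew; rewrite (LTp _ _ Ew).
  apply: measurable_funTS; apply/measurable_EFinP/measurable_funM.
    by apply: measurable_indic; exact: measurable_Tf.
  apply: (measurable_from_sigmaT mmodel (I := before n)).
  exact: (measurable_funX p.+1 (mLn n)).
- move=> w [n _ Ew]; rewrite (LTp _ _ Ew) lee_fin mulr_ge0// ?indicE//.
  by apply: exprn_ge0; exact: ltW.
Qed.

Lemma tilde_integral_LT : P (Tf `\` \bigcup_n E_ n) = 0%E ->
  (\int[Q]_w (LT P Psi A B D g1 g2 astar x w)%:E = P Tf)%E.
Proof.
move=> P0; have := tilde_integral_LT_pow 0.
under eq_integral do rewrite expr1.
move=> ->; under eq_eseriesr => n _ do under eq_integral do rewrite expr0.
have mT := measurable_Tf.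
have mU : measurable (\bigcup_n E_ n) by exact: bigcupT_measurable.
transitivity (P (\bigcup_n (E_ n `&` Tf))).
  rewrite measure_bigcup//.
  - rewrite [RHS](_ : _ = \sum_(n <oo) P (E_ n `&` Tf))%E; last first.
      by apply: eq_eseriesl => n; rewrite in_setT.
    apply: eq_eseriesr => n _; rewrite integral_cst ?mul1e//; exact: measurableI.
  - by move=> n _; exact: measurableI.
  - by apply/trivIsetP => i j _ _ ij; move/trivIsetP : trivE => /(_ i j Logic.I Logic.I ij) e;
      rewrite setIACA e set0I.
rewrite -setI_bigcupl.
rewrite setIC; apply/esym; apply: (etrans (measureDI P mT mU)).
by apply: (etrans _ (add0e _)); congr (_ + _)%E; exact: P0.
Qed.

Lemma tilde_integral_LT_sq (K : \bar R) :
  (forall n, \sum_(k < n) \int[P]_w (\1_(E_ k) w * L k w)%:E <= K)%E ->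
  (\int[Q]_w ((LT P Psi A B D g1 g2 astar x w) ^+ 2)%:E <= K)%E.
Proof.
move=> HK; rewrite tilde_integral_LT_pow.
apply: lime_le.
  by apply: is_cvg_nneseries => n _ _; apply: integral_ge0 => w _; rewrite lee_fin expr1 ltW.
apply: nearW => n; apply: le_trans (HK n); rewrite big_mkord; apply: lee_sum => k _.
have mT := measurable_Tf.
have mLk : measurable_fun (setT : set T) (L k).
  by apply: (measurable_from_sigmaT mmodel); exact: (measurable_like_ratio _ _ mmodel SY EY0).
have L0 w : 0 <= L k w by exact: ltW.
have mi (F : set T) : measurable F -> measurable_fun setT (\1_F : T -> R).
  by move=> mF; exact: measurable_indic.
rewrite integral_mkcond epatch_indic; apply: ge0_le_integral => //.
- by move=> w _; rewrite /= -EFinM lee_fin expr1 mulr_ge0// indicE.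
- apply/measurable_EFinP/measurable_funM; first by under eq_fun do rewrite expr1.
  by apply: mi; exact: measurableI.
- by apply/measurable_EFinP/measurable_funM => //; exact: mi.
- move=> w _; rewrite /= -EFinM lee_fin expr1 mulrC ler_wpM2r// indicI/=.
  by rewrite ler_piMr// indicE // lern1; case: (_ \in _).
Qed.

End ChangeOfMeasure.

(** * Comparing probabilities of events up to null sets *)

Section AlmostSure.
Context {R : realType} {d : measure_display} {T : measurableType d}.
Variable P : probability T R.

Lemma measure_ae_eq (E F : set T) : measurable E -> measurable F ->
  {ae P, forall w, E w <-> F w} -> P E = P F.
Proof.
move=> mE mF EF.
rewrite -(setIT E) -(setIT F) -!integral_indic//.
apply: ae_eq_integral => //.
- by apply/measurable_EFinP; exact: measurable_indic.
- by apply/measurable_EFinP; exact: measurable_indic.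
apply: filterS EF => w EFw _; rewrite !indicE; have [Ew|nEw] := pselect (E w).
  by rewrite !mem_set//; exact/EFw.
by rewrite !memNset// => /EFw.
Qed.

Lemma measure_ae_sub (E F : set T) : measurable E -> measurable F ->
  {ae P, forall w, E w -> F w} -> (P E <= P F)%E.
Proof.
move=> mE mF EF; rewrite -(@measure_ae_eq (E `&` F) E) ?measureIr//.
  exact: measurableI.
by apply: filterS EF => w EFw; split => [[]//|Ew]; split => //; exact: EFw.
Qed.

Lemma measure_ae0 (E : set T) : measurable E -> {ae P, forall w, ~ E w} -> P E = 0%E.
Proof.
move=> mE nE; rewrite (@measure_ae_eq E set0) ?measure0//.
by apply: filterS nE => w Ew; split.
Qed.

End AlmostSure.

(** * The walk dominates the iteration from above *)

Section Domination.
Context {R : realType} {d : measure_display} {T : measurableType d}.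
Variable P : probability T R.
Variables (Psi : nat -> T -> R -> R) (A B D : nat -> T -> R) (g1 g2 : R).
Hypothesis mmodel : measurable_model Psi A B D.
Hypothesis iid : iid_tuples P Psi A B D.
Hypothesis Psi_gt0 : forall n w t, 0 < Psi n w t.
Hypothesis LipPsi : forall n w, (Lip (Psi n w) < +oo)%E.
Hypothesis Psi_bounds : forall n, {ae P, forall w, forall z,
  A n w * z + B n w - D n w <= Psi n w z /\
  Psi n w z <= A n w * Num.max z 0 + Num.max (B n w) 0 + D n w}.
Hypothesis Zn_ndecr : {ae P, forall w, forall n, Zn Psi n w <= Zn Psi n.+1 w}.
Hypothesis A_gt0 : {ae P, forall w, 0 < A 0 w}.
Hypothesis g1_gt0 : 0 < g1.

Definition regular (w : T) : Prop := forall n, 0 < A n w /\ forall z,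
  A n w * z + B n w - D n w <= Psi n w z /\
  Psi n w z <= A n w * Num.max z 0 + Num.max (B n w) 0 + D n w.

Lemma ae_regular : {ae P, forall w, regular w}.
Proof.
apply: ae_foralln => n.
(* Positivity is assumed for tuple 0 only and is carried over by equality in law. *)
have An : {ae P, forall w, 0 < A n w}.
  pose S := [set x : R * R * R | x.1.1 <= 0].
  have mS : measurable S.
    apply: measurable_ler_cst; exact: measurableT_comp measurable_fst measurable_fst.
  have mSn k : measurable (ABD A B D k @^-1` S).
    by rewrite -[X in measurable X]setTI; exact: (measurable_ABD mmodel).
  exists (ABD A B D n @^-1` S); split => //.
    rewrite (law_ABD mmodel iid n mS); apply: measure_ae0 => //.
    by apply: filterS A_gt0 => w Aw; rewrite /S /= leNgt Aw.
  by move=> w /=; rewrite /S /= => /negP; rewrite -leNgt.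
by apply: filterS2 An (Psi_bounds n).
Qed.

Let q := expR (- g1).

Lemma Zfrom_ge0 j n w : 0 <= Zfrom Psi j n w.
Proof. by case: n => [//|n]; exact: ltW (Psi_gt0 _ _ _). Qed.

(** Removing the outermost map, [A_j <= exp(Y_j) q] and [B_j^+ + D_j <= exp(sigma + g2) q], while
    the rest of the walk stays below [sigma - Y_j]. Each level thus yields one factor
    [q = exp(-g1)], the excess built into [Y]. *)
Lemma Zfrom_le j n w sigma : regular w ->
  (forall k, (k < n)%N -> \sum_(i < k.+1) Y A B D g1 g2 (j + i)%N w <= sigma) ->
  Zfrom Psi j n w <= expR (sigma + g2) * \sum_(k < n) q ^+ k.+1.
Proof.
move=> reg; elim: n j sigma => [|n IH] j sigma Hs.
  by rewrite big_ord0 mulr0.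
have Y_j : Y A B D g1 g2 j w <= sigma.
  by have := Hs 0%N isT; rewrite big_ord_recl big_ord0 addr0 addn0.
have {}IH : Zfrom Psi j.+1 n w <= expR (sigma - Y A B D g1 g2 j w + g2) * \sum_(k < n) q ^+ k.+1.
  apply: IH => k kn; have := Hs k.+1 kn.
  rewrite big_ord_recl addn0 lerBrDr addrC.
  by under eq_bigr => i _ do rewrite lift0 addnS -addSn.
have [Aj /(_ (Zfrom Psi j.+1 n w)) [_ up]] := reg j.
have -> : Zfrom Psi j n.+1 w = Psi j w (Zfrom Psi j.+1 n w) by [].
apply: (le_trans up); rewrite -addrA max_l ?Zfrom_ge0//.
have AY : A j w <= expR (Y A B D g1 g2 j w) * q.
  rewrite /q -expRD -[leLHS]lnK// ler_expR /Y addrK le_max lexx orbT//.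
have BY : Num.max (B j w) 0 + D j w <= expR (sigma + g2) * q.
  rewrite /q -expRD; set b := _ + D j w.
  apply: (@le_trans _ _ (expR (logp b))).
    have [b0|b0] := ltP 0 b; last exact: le_trans b0 (expR_ge0 _).
    by rewrite -[leLHS]lnK// ler_expR /logp le_max lexx.
  rewrite ler_expR; move: Y_j; rewrite /Y -/b => h.
  have h2 : logp b - g2 <= Num.max (logp b - g2) (ln (A j w)) by rewrite le_max lexx.
  lra.
rewrite big_ord_recl expr1.
have -> : \sum_(i < n) q ^+ (bump 0 i).+1 = q * \sum_(k < n) q ^+ k.+1.
  by rewrite mulr_sumr; apply: eq_bigr => i _; rewrite -exprS.
set Sq := \sum_(k < n) _ in IH *.
have Sq0 : 0 <= Sq by apply: sumr_ge0 => k _; rewrite exprn_ge0// expR_ge0.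
rewrite mulrDr addrC; apply: lerD => //.
apply: (@le_trans _ _ (expR (Y A B D g1 g2 j w) * q * (expR (sigma - Y A B D g1 g2 j w + g2) * Sq))).
  apply: ler_pM => //; [exact: ltW|exact: Zfrom_ge0].
have -> : expR (sigma + g2) = expR (Y A B D g1 g2 j w) * expR (sigma - Y A B D g1 g2 j w + g2).
  by rewrite -expRD; congr expR; lra.
by rewrite le_eqVlt; apply/orP; left; apply/eqP; ring.
Qed.

(** The level [sx] satisfies [exp(sx + g2) = x (1 - q)], and [1 - q] times the geometric sum is
    [q (1 - q^n) <= 1]. *)
Lemma Zn_le_of_not_hit x n w : regular w -> 1 < x ->
  (forall k, (k <= n)%N -> Sw A B D g1 g2 k w <= sx g1 g2 x) -> Zn Psi n w <= x.
Proof.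
move=> reg x1 NH; have x0 : 0 < x by lra.
apply: (@le_trans _ _ (expR (sx g1 g2 x + g2) * \sum_(k < n) q ^+ k.+1)).
  by apply: (@Zfrom_le 0 n w) => // k kn; exact: (NH k.+1 kn).
have q01 : 0 < 1 - q by rewrite subr_gt0 /q expR_lt1 oppr_lt0.
have -> : expR (sx g1 g2 x + g2) = x * (1 - q).
  rewrite /sx addrAC addrNK addrC -/q.
  by rewrite expRD !lnK// mulrC.
rewrite -mulrA -[leRHS]mulr1 ler_wpM2l ?(ltW x0)//.
have -> : (1 - q) * \sum_(k < n) q ^+ k.+1 = q * (1 - q ^+ n).
  elim: n {NH} => [|n IH]; first by rewrite big_ord0 mulr0 expr0 subrr mulr0.
  by rewrite big_ord_recr/= mulrDr IH exprS; ring.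
have q0 : 0 <= q by exact: expR_ge0.
have qn : 0 <= q ^+ n by exact: exprn_ge0.
by nra.
Qed.

Lemma hit_before_T x : 1 < x ->
  P ([set w | T_finite Psi x w] `\` \bigcup_n hit_at A B D g1 g2 x n) = 0%E.
Proof.
move=> x1; apply: measure_ae0.
  apply: measurableD; first exact: (measurable_Tf x mmodel LipPsi).
  by apply: bigcupT_measurable => n; exact: (measurableT_hit_at g1 g2 x mmodel).
apply: filterS ae_regular => w reg [[n xn] nh].
have : Zn Psi n w <= x.
  apply: Zn_le_of_not_hit => // k _; rewrite leNgt; apply/negP => h.
  apply: nh; have ex : exists n, sx g1 g2 x < Sw A B D g1 g2 n w by exists k.
  exists (ex_minn ex) => //; apply/hit_atP; case: ex_minnP => m hm minm.
  split => // i im; rewrite leNgt; apply/negP => /minm; by rewrite leqNgt im.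
by rewrite leNgt xn.
Qed.

Lemma measure_Zlim_gt x :
  P [set w | (x%:E < Zlim Psi w)%E] = P [set w | T_finite Psi x w].
Proof.
apply: measure_ae_eq.
- apply: measurable_lt_limn => n; apply/measurable_EFinP.
  apply: (measurable_from_sigmaT mmodel (I := setT)).
  exact: (measurable_Zfrom LipPsi (j := 0%N)).
- exact: (measurable_Tf x mmodel LipPsi).
apply: filterS Zn_ndecr => w nd.
have ndZ : nondecreasing_seq (fun n => (Zn Psi n w)%:E).
  by apply/nondecreasing_seqP => n; rewrite lee_fin.
rewrite /=; have -> : Zlim Psi w = ereal_sup (range (fun n => (Zn Psi n w)%:E)).
  by apply: cvg_lim => //; exact: ereal_nondecreasing_cvgn.
split.
  by move=> /ereal_sup_gt [_ [n _ <-]]; rewrite lte_fin => h; exists n.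
move=> [n xn]; apply: (@lt_le_trans _ _ (Zn Psi n w)%:E); first by rewrite lte_fin.
by apply: ereal_sup_ubound; exists n.
Qed.

End Domination.

(** As long as [u n <= pi < p / 2], each increment of [u] is at least [q n * p / 2]. Here [u n] will
    be the probability of a success among the first [n] attempts and [q n] that of the [n]-th
    jump. *)
Lemma renewal_lower_bound {R : realType} (u q : nat -> R) (p pi : R) : 0 < p ->
  u 0%N = 0 -> (forall n, 0 <= q n) -> (forall n, u n.+1 >= u n + q n * (p - u n)) ->
  (forall n, u n <= pi) -> pi < p / 2 -> forall n, \sum_(k < n) q k <= 2 / p * pi.
Proof.
move=> p0 u0 q0 us upi pip n.
have H : p / 2 * \sum_(k < n) q k <= u n.
  elim: n => [|n IH]; first by rewrite big_ord0 mulr0 u0.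
  rewrite big_ord_recr/= mulrDr; apply: le_trans (us n); apply: lerD => //.
  by have := upi n; have := q0 n; nra.
have h2 := le_trans H (upi n).
rewrite -(@ler_pM2l _ (p / 2)) ?divr_gt0//; apply: (le_trans h2).
by rewrite mulrA mulf_div [p * 2]mulrC divff ?mul1r// mulf_neq0// gt_eqF.
Qed.

(** * Jump events that lift the iteration above a given level *)

Section LowerBound.
Context {R : realType} {d : measure_display} {T : measurableType d}.
Variable P : probability T R.
Variables (Psi : nat -> T -> R -> R) (A B D : nat -> T -> R).
Hypothesis mmodel : measurable_model Psi A B D.
Hypothesis iid : iid_tuples P Psi A B D.
Hypothesis Psi_gt0 : forall n w t, 0 < Psi n w t.
Hypothesis LipPsi : forall n w, (Lip (Psi n w) < +oo)%E.
Hypothesis Psi_bounds : forall n, {ae P, forall w, forall z,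
  A n w * z + B n w - D n w <= Psi n w z /\
  Psi n w z <= A n w * Num.max z 0 + Num.max (B n w) 0 + D n w}.
Hypothesis A_gt0 : {ae P, forall w, 0 < A 0 w}.

(** The affine lower bounds compose because each slope [A k] is positive; the accumulated losses are
    exactly the perpetuity. *)
Lemma foldr_Psi_ge w y (s : seq nat) : regular Psi A B D w ->
  (\prod_(k <- s) A k w) * y - foldr (fun k r => Num.max (A k w) 0 * r + drift_b B D k w) 0 s
   <= foldr (fun k z => Psi k w z) y s.
Proof.
move=> reg; elim: s => [|k s IH] /=; first by rewrite big_nil mul1r subr0.
have [Ak /(_ (foldr (fun k z => Psi k w z) y s)) [lo _]] := reg k.
apply: le_trans lo; rewrite big_cons max_l ?(ltW Ak)//.
have : - drift_b B D k w <= B k w - D k w.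
  by rewrite lerNl opprB /drift_b le_max lexx.
have := ler_wpM2l (ltW Ak) IH; rewrite mulrBr mulrA; lra.
Qed.

(** [freezing] with an empty index set and an integrand that ignores its first argument. *)
Lemma integral_ABD_eq (g : R * R * R -> \bar R) k : measurable_fun setT g ->
  (forall y, 0 <= g y)%E ->
  (\int[P]_w g (ABD A B D k w) = \int[P]_w g (ABD A B D 0 w))%E.
Proof.
move=> mg g0.
have nk : ~ (set0 : set nat) k by [].
have := @freezing _ _ _ P Psi A B D mmodel iid set0 k (fun x => g x.2) nk _ _.
move=> -> //=; last exact: (measurableT_comp mg measurable_snd).
rewrite integral_cst// -[RHS]mule1; congr (_ * _)%E; exact: probability_setT.
Qed.

Lemma Psi_law (r : R) k : P [set w | r <= Psi k w 0] = P [set w | r <= Psi 0 w 0].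
Proof.
have E j : [set w | r <= Psi j w 0] = cyl Psi A B D j ([:: (0, `[r, +oo[%classic)], setT, setT, setT).
  apply/seteqP; split => w /=.
    by move=> rw; split => // -[|//] _ /=; rewrite in_itv/= rw.
  by move=> [/(_ 0%N isT)] /=; rewrite in_itv/= andbT.
by rewrite !E; apply: iid.1; split => // -[|//] _ /=; exact: measurable_itv.
Qed.

(** Positivity of [Psi] puts [Psi 0 w 0] above some [2 / (n + 1)], so these countably many events
    cannot all be null. The level gives a large [A] something to multiply. *)
Lemma Psi_pos_level : exists e : R, 0 < e <= 1 /\ (0 < P [set w | (2 * e <= Psi 0 w 0)%R])%E.
Proof.
apply: contrapT => H.
have mS (r : R) : measurable [set w | r <= Psi 0 w 0].
  by apply: measurable_ger_cst; case: mmodel.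
have H0 n : P [set w | 2 * (n.+1%:R)^-1 <= Psi 0 w 0] = 0%E.
  apply/eqP; rewrite eq_le measure_ge0 andbT leNgt; apply/negP => h.
  apply: H; exists (n.+1%:R)^-1; split => //.
  by rewrite invr_gt0 ltr0n/= invf_le1 ?ltr0n// ler1n.
have PT0 : P [set: T] = 0%E.
  apply: measure_ae0 => //.
  have ae0 : {ae P, forall w, forall n : nat, ~ (2 * (n.+1%:R)^-1 <= Psi 0 w 0)}.
    apply: ae_foralln => n; exists [set w | 2 * (n.+1%:R)^-1 <= Psi 0 w 0].
    by split; [exact: mS|exact: H0|move=> w /= /contrapT].
  apply: filterS ae0 => w Hw _.
  have [N hN] := archi_mul 2 (Psi_gt0 0 w 0).
  apply: (Hw N); rewrite ler_pdivrMr ?ltr0n// mulrC; apply: ltW; apply: (lt_le_trans hN).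
  by rewrite ler_wpM2r ?(ltW (Psi_gt0 _ _ _))// ler_nat.
by have /eqP := probability_setT P; rewrite PT0 eq_sym onee_eq0.
Qed.

Section Events.
Variables (r0 p0 e C t0 : R).
Hypothesis e01 : 0 < e <= 1.
Hypothesis p0_gt0 : 0 < p0.
Hypothesis C_gt0 : 0 < C.
Hypothesis t0_gt0 : 0 < t0.
Hypothesis tight : forall n, p0 <= fine (P [set w | perp A B D 0 n w < r0]).
Hypothesis C_big : ((\int[P]_w (Num.max (- ln (A 0 w)) 0)%:E) <= (C * (p0 / 2))%:E)%E.

Let nlnA (n : nat) w : R := \sum_(k < n) Num.max (- ln (A k w)) 0.

Definition stable_prefix (k : nat) : set T :=
  [set w | perp A B D 0 (2 * k) w < r0 /\ nlnA (2 * k) w <= C * (2 * k)%:R].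

(** The exponential offsets the factor [exp(-2Ck)] that the product of the preceding [A]'s may
    cost. *)
Definition jump_level (k : nat) : R := expR (C * (2 * k)%:R) * t0.

(* Tuple 2k carries the jump; tuple 2k + 1 only ensures that the argument of
   Psi (2k) is at least 2e, so that a large A is effective. *)
Definition big_jump (k : nat) : set T :=
  (ABD A B D (2 * k) @^-1` jump_region e (jump_level k)) `&`
  [set w | 2 * e <= Psi (2 * k).+1 w 0].

Let measurable_nlnA (I : set nat) n : (forall k, (k < n)%N -> I k) ->
  measurable_fun setT (nlnA n : sigmaT Psi A B D I -> R).
Proof.
move=> In; have h (k : 'I_n) : measurable_fun setT ((fun w => Num.max (- ln (A k w)) 0) : sigmaT Psi A B D I -> R).
  have mAk : measurable_fun setT (A k : sigmaT Psi A B D I -> R).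
    by apply: measurable_sigmaT_A; exact: In.
  apply: measurable_maxr; last exact: measurable_cst.
  by apply: measurableT_comp => //; exact: (measurableT_comp (@measurable_ln R) mAk).
exact: (measurable_sum (index_enum 'I_n) h).
Qed.

Let mnlnA n : measurable_fun (setT : set T) (nlnA n).
Proof. by apply: (measurable_from_sigmaT mmodel (I := setT)); exact: measurable_nlnA. Qed.

Let mperp n : measurable_fun (setT : set T) (perp A B D 0 n).
Proof. by apply: (measurable_from_sigmaT mmodel (I := setT)); exact: measurable_perp. Qed.

Lemma sigma_stable_prefix k (I : set nat) : (forall j, (j < 2 * k)%N -> I j) ->
  <<s gen Psi A B D I >> (stable_prefix k).
Proof.
move=> Ik.
have h1 : measurable ([set w | perp A B D 0 (2 * k) w < r0] : set (sigmaT Psi A B D I)).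
  apply: (@measurable_ltr_cst _ _ (sigmaT Psi A B D I)).
  by apply: measurable_perp => j /=; exact: Ik.
have h2 : measurable ([set w | nlnA (2 * k) w <= C * (2 * k)%:R] : set (sigmaT Psi A B D I)).
  apply: (@measurable_ler_cst _ _ (sigmaT Psi A B D I)); exact: measurable_nlnA.
exact: (measurableI _ _ h1 h2).
Qed.

Lemma sigma_big_jump k (I : set nat) : I (2 * k)%N -> I (2 * k).+1 ->
  <<s gen Psi A B D I >> (big_jump k).
Proof.
move=> I1 I2.
have h1 : measurable ((ABD A B D (2 * k) @^-1` jump_region e (jump_level k)) : set (sigmaT Psi A B D I)).
  have := measurable_sigmaT_ABD (Psi := Psi) (A := A) (B := B) (D := D) I1 measurableT
    (measurable_jump_region e (jump_level k)).
  by rewrite setTI.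
have h2 : measurable ([set w | 2 * e <= Psi (2 * k).+1 w 0] : set (sigmaT Psi A B D I)).
  by apply: (@measurable_ger_cst _ _ (sigmaT Psi A B D I)); exact: measurable_sigmaT_Psi.
exact: (measurableI _ _ h1 h2).
Qed.

(** By Markov's inequality and the choice of [C], the sum of the negative parts of [ln A] exceeds
    [2Ck] with probability at most [p0 / 2]; this is subtracted from the bound [p0] for the
    perpetuity. *)
Lemma prob_stable_prefix k : p0 / 2 <= fine (P (stable_prefix k)).
Proof.
pose n := (2 * k)%N.
pose G := [set w | perp A B D 0 n w < r0].
pose N := [set w | C * n%:R < nlnA n w].
have mG : measurable G by exact: measurable_ltr_cst.
have mN : measurable N by exact: measurable_gtr_cst.
have mS : measurable (stable_prefix k).
  by apply: (sigma_gen_measurable mmodel (I := setT)); exact: sigma_stable_prefix.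
have EnlnA : (\int[P]_w (nlnA n w)%:E <= (n%:R * (C * (p0 / 2)))%:E)%E.
  have m1 j : measurable_fun (setT : set T) (fun w => Num.max (- ln (A j w)) 0).
    have [_ [mA _]] := mmodel.
    apply: measurable_maxr; last exact: measurable_cst.
    by apply: measurableT_comp => //; exact: (measurableT_comp (@measurable_ln R) (mA j)).
  rewrite /nlnA; under eq_integral do rewrite -sumEFin.
  rewrite ge0_integral_sum//; last 2 first.
  - by move=> j; apply/measurable_EFinP; exact: m1.
  - by move=> j w _; rewrite lee_fin le_max lexx orbT.
  have -> : (n%:R * (C * (p0 / 2)))%:E = (\sum_(j < n) (C * (p0 / 2))%:E)%E.
    by rewrite sumEFin sumr_const card_ord mulr_natl.
  apply: lee_sum => j _; apply: le_trans C_big.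
  pose g (y : R * R * R) := (Num.max (- ln y.1.1) 0)%:E.
  rewrite le_eqVlt; apply/orP; left; apply/eqP.
  apply: (@integral_ABD_eq g j).
    apply/measurable_EFinP; apply: measurable_maxr; last exact: measurable_cst.
    apply: measurableT_comp => //; apply: (measurableT_comp (@measurable_ln R)).
    exact: measurableT_comp measurable_fst measurable_fst.
  by move=> y; rewrite lee_fin le_max lexx orbT.
have PN : fine (P N) <= p0 / 2.
  (* Markov's inequality divides by [C n]; for [n = 0] the exceptional event is empty. *)
  have [n0|n0] := posnP n.
    rewrite (_ : N = set0); first by rewrite measure0 divr_ge0// ltW.
    by apply/seteqP; split => // w; rewrite /N /nlnA/= n0 big_ord0 mulr0 ltxx.
  have Cn : 0 < C * n%:R by rewrite mulr_gt0// ltr0n.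
  have : ((C * n%:R)%:E * P N <= (n%:R * (C * (p0 / 2)))%:E)%E.
    apply: le_trans EnlnA; rewrite -(setIT N) -integral_indic// -ge0_integralZl//; last 2 first.
    - by apply/measurable_EFinP; exact: measurable_indic.
    - by rewrite lee_fin ltW.
    have nl0 w : 0 <= nlnA n w by apply: sumr_ge0 => j _; rewrite le_max lexx orbT.
    apply: ge0_le_integral => //.
    - by move=> w _; rewrite -EFinM lee_fin mulr_ge0// ltW.
    - apply: emeasurable_funM; first exact: measurable_cst.
      by apply/measurable_EFinP; exact: measurable_indic.
    - exact/measurable_EFinP.
    - move=> w _; rewrite -EFinM lee_fin indicE; have [Nw|Nw] := pselect (N w).
        by rewrite mem_set// mulr1 ltW.
      by rewrite memNset// mulr0.
  rewrite -[P N]fineK ?fin_num_measure// -EFinM lee_fin mulrA [n%:R * C]mulrC.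
  by rewrite ler_pM2l.
have sub : G `<=` stable_prefix k `|` N.
  move=> w Gw; have [h|h] := leP (nlnA n w) (C * n%:R); [left|right] => //.
have : (P G <= P (stable_prefix k) + P N)%E.
  apply: le_trans (measureU2 _ mS mN); apply: le_measure => //; rewrite inE//.
  exact: measurableU.
rewrite -[P G]fineK ?fin_num_measure// -[P N]fineK ?fin_num_measure//.
rewrite -[P (stable_prefix k)]fineK ?fin_num_measure// -EFinD lee_fin.
by have := tight n; rewrite -/G; lra.
Qed.

Lemma prob_big_jump k : P (big_jump k) =
  (P (ABD A B D 0 @^-1` jump_region e (jump_level k)) * P [set w | (2 * e <= Psi 0 w 0)%R])%E.
Proof.
rewrite /big_jump -(law_ABD mmodel iid (2 * k)) ?measurable_jump_region//; last exact: measurable_jump_region.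
rewrite -(Psi_law (2 * e) (2 * k).+1).
apply: (sigma_gen_indep mmodel iid (I := [set (2 * k)%N]) (J := [set (2 * k).+1])).
- by move=> j /= -> /eqP; rewrite eqn_leq ltnn andbF.
- have := measurable_sigmaT_ABD (Psi := Psi) (A := A) (B := B) (D := D) (I := [set (2 * k)%N])
    (erefl : [set (2 * k)%N] (2 * k)%N) measurableT (measurable_jump_region e (jump_level k)).
  by rewrite setTI.
- by apply: (@measurable_ger_cst _ _ (sigmaT Psi A B D [set (2 * k).+1])); exact: measurable_sigmaT_Psi.
Qed.

(** After the jump the value exceeds [e * jump_level k]. The earlier tuples multiply it by at least
    [exp(-2Ck)], which leaves more than [e t0], and subtract less than [r0]. *)
Lemma big_jump_Zn k w x : regular Psi A B D w -> x + r0 <= e * t0 ->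
  stable_prefix k w -> big_jump k w -> x < Zn Psi (2 * k).+2 w.
Proof.
move=> reg xr [pr nl] [jr z2].
have [e0 e1] := andP e01.
pose y := Psi (2 * k) w (Psi (2 * k).+1 w 0).
have lv0 : 0 < jump_level k by rewrite mulr_gt0// expR_gt0.
have yge : e * jump_level k < y.
  have [A0 /(_ (Psi (2 * k).+1 w 0)) [lo _]] := reg (2 * k)%N.
  apply: lt_le_trans lo; move: z2 jr; rewrite /jump_region /ABD /=.
  have := Psi_gt0 (2 * k).+1 w 0.
  move: (Psi _ w 0) (A _ w) (B _ w) (D _ w) A0 => z a b' d' a0 z0 z2 [h|[h1 h2]].
    have : e * jump_level k <= jump_level k by rewrite ler_piMl// ltW.
    have : 0 < a * z by rewrite mulr_gt0.
    lra.
  have : jump_level k * (2 * e) <= a * z.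
    by apply: ler_pM => //; [exact: ltW|rewrite mulr_ge0// ltW|exact: ltW].
  lra.
have ZE : Zn Psi (2 * k).+2 w = foldr (fun k z => Psi k w z) y (iota 0 (2 * k)).
  by rewrite /Zn -addn2 iotaD foldr_cat/= add0n.
rewrite ZE; apply: lt_le_trans (foldr_Psi_ge y (iota 0 (2 * k)) reg).
rewrite -[X in _ - X]/(perp A B D 0 (2 * k) w).
have prodE : expR (- (C * (2 * k)%:R)) <= \prod_(j <- iota 0 (2 * k)) A j w.
  rewrite -[X in iota 0 X]subn0 -/(index_iota 0 (2 * k)) big_mkord.
  have -> : \prod_(j < 2 * k) A j w = expR (\sum_(j < 2 * k) ln (A j w)).
    by rewrite expR_sum; apply: eq_bigr => j _; rewrite lnK//; case: (reg j).
  rewrite ler_expR; apply: (@le_trans _ _ (- nlnA (2 * k) w)); first by rewrite lerN2.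
  by rewrite /nlnA -sumrN; apply: ler_sum => j _; rewrite lerNl le_max lexx.
have : e * t0 < (\prod_(j <- iota 0 (2 * k)) A j w) * y.
  apply: (@lt_le_trans _ _ (expR (- (C * (2 * k)%:R)) * y)); last first.
    by apply: ler_wpM2r => //; exact: ltW (Psi_gt0 _ _ _).
  have -> : e * t0 = expR (- (C * (2 * k)%:R)) * (e * jump_level k).
    by rewrite /jump_level expRN; field; exact: lt0r_neq0 (expR_gt0 _).
  by rewrite ltr_pM2l// expR_gt0.
lra.
Qed.

Let Good (n : nat) : set T := \bigcup_(k in [set k | (k < n)%N]) (stable_prefix k `&` big_jump k).

(** The jump of block [m] is independent both of the stable prefix and of all earlier successes,
    since these use tuples below [2m] only. The new success therefore has probability at least
    [P(jump) (p0 / 2 - P(Good m))], the recursion of [renewal_lower_bound]. *)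
Lemma sum_big_jump_le x : x + r0 <= e * t0 ->
  fine (P [set w | T_finite Psi x w]) < p0 / 4 ->
  forall n, \sum_(k < n) fine (P (big_jump k)) <=
    4 / p0 * fine (P [set w | T_finite Psi x w]).
Proof.
move=> xr lt_p n.
have sH k : <<s gen Psi A B D [set j | (j < 2 * k)%N] >> (stable_prefix k).
  by apply: sigma_stable_prefix.
have sJ k : <<s gen Psi A B D [set j | (2 * k <= j)%N] >> (big_jump k).
  by apply: sigma_big_jump => //=.
have mH k := sigma_gen_measurable mmodel (sH k).
have mJ k := sigma_gen_measurable mmodel (sJ k).
have sG m : <<s gen Psi A B D [set j | (j < 2 * m)%N] >> (Good m).
  have : measurable (Good m : set (sigmaT Psi A B D [set j | (j < 2 * m)%N])).
    apply: bigcup_measurable => k /= km.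
    have h1 : measurable (stable_prefix k : set (sigmaT Psi A B D [set j | (j < 2 * m)%N])).
      by apply: sigma_stable_prefix => j /= jk; rewrite (leq_trans jk)// leq_mul2l ltnW.
    have h2 : measurable (big_jump k : set (sigmaT Psi A B D [set j | (j < 2 * m)%N])).
      have k2 : ((2 * k).+2 <= 2 * m)%N by rewrite !mul2n -doubleS leq_double.
      by apply: sigma_big_jump => /=; rewrite ?(ltnW k2)// (leq_trans _ k2).
    exact: (measurableI _ _ h1 h2).
  by [].
have mG m := sigma_gen_measurable mmodel (sG m).
have IJ m j : [set j | (j < 2 * m)%N] j -> [set j | (2 * m <= j)%N] j -> False.
  by move=> /= h1 h2; move: (leq_trans h1 h2); rewrite ltnn.
have pf (E : set T) : measurable E -> P E = (fine (P E))%:E.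
  by move=> mE; rewrite fineK// fin_num_measure.
have G0 : Good 0 = set0 by apply/seteqP; split => // w [k].
have step m : fine (P (Good m)) + fine (P (big_jump m)) * (p0 / 2 - fine (P (Good m))) <=
    fine (P (Good m.+1)).
  have i1 := sigma_gen_indep mmodel iid (IJ m) (sH m) (sJ m).
  have i2 := sigma_gen_indep mmodel iid (IJ m) (sG m) (sJ m).
  have mHJ : measurable (stable_prefix m `&` big_jump m) by exact: measurableI.
  have mGJ : measurable (Good m `&` big_jump m) by exact: measurableI.
  have mX : measurable ((stable_prefix m `&` big_jump m) `\` Good m) by exact: measurableD.
  have GS : Good m.+1 = Good m `|` ((stable_prefix m `&` big_jump m) `\` Good m).
    apply/seteqP; split => w.
      move=> [k /=]; rewrite ltnS leq_eqVlt => /predU1P[->|km] h; last by left; exists k.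
      by have [g|g] := pselect (Good m w); [left|right].
    move=> [[k /= km h]|[h _]]; last by exists m => /=.
    by exists k => //=; exact: ltnW.
  have e1 : P (Good m.+1) = (P (Good m) + P ((stable_prefix m `&` big_jump m) `\` Good m))%E.
    by rewrite GS measureU//; apply/seteqP; split => // w [? []].
  have e2 : (P (stable_prefix m `&` big_jump m) <=
      P ((stable_prefix m `&` big_jump m) `\` Good m) + P (Good m `&` big_jump m))%E.
    apply: le_trans (measureU2 _ mX mGJ); apply: le_measure => //; rewrite ?inE//.
      exact: measurableU.
    move=> w [h j]; have [g|g] := pselect (Good m w); [right|left] => //.
  have e1' : fine (P (Good m.+1)) =
      fine (P (Good m)) + fine (P ((stable_prefix m `&` big_jump m) `\` Good m)).
    by rewrite e1 fineD// fin_num_measure.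
  have e2' : fine (P (stable_prefix m)) * fine (P (big_jump m)) <=
      fine (P ((stable_prefix m `&` big_jump m) `\` Good m)) +
      fine (P (Good m)) * fine (P (big_jump m)).
    rewrite -lee_fin EFinD !EFinM -(pf _ (mG m)) -(pf _ (mH m)) -(pf _ (mJ m)) -(pf _ mX).
    by rewrite -i1 -i2.
  rewrite e1'; have := fine_ge0 (measure_ge0 P (big_jump m)).
  have := prob_stable_prefix m; move: e2'; clear e1 e2 i1 i2 e1'.
  move: (fine (P (big_jump m))) (fine (P (stable_prefix m))) (fine (P (Good m))) (fine (P (_ `\` _))).
  move=> q y g X h1 h2 q0; have : q * (p0 / 2) <= q * y by exact: ler_wpM2l.
  by rewrite mulrBr; lra.
have Gle m : fine (P (Good m)) <= fine (P [set w | T_finite Psi x w]).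
  have mT := measurable_Tf x mmodel LipPsi.
  rewrite -lee_fin -!pf//; apply: measure_ae_sub => //.
  apply: filterS (ae_regular mmodel iid Psi_bounds A_gt0) => w reg [k _ [h j]].
  by exists (2 * k).+2; exact: big_jump_Zn.
have q0 k : 0 <= fine (P (big_jump k)) by rewrite fine_ge0.
have p2 : 0 < p0 / 2 by rewrite divr_gt0.
have lt2 : fine (P [set w | T_finite Psi x w]) < p0 / 2 / 2 by lra.
have := renewal_lower_bound p2 _ q0 step Gle lt2 n.
rewrite G0 measure0 => /(_ erefl).
by rewrite (_ : 2 / (p0 / 2) = 4 / p0)//; field; rewrite gt_eqF.
Qed.

End Events.

End LowerBound.

(** * From the mean of log Lip to the mean of ln A *)

Section LipschitzDrift.
Context {R : realType} {d : measure_display} {T : measurableType d}.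
Variable P : probability T R.

(** Meant for [elog (Lip (Psi 0 w))], a supremum over uncountably many pairs with no measurability
    at hand. Monotonicity is read off the integral as a difference of suprema over simple functions;
    this requires the inequality everywhere, so [f'] is set to [-oo] on the null set. *)
Lemma integral_le_ae_nonmeasurable (f : T -> R) (g : T -> \bar R) : measurable_fun setT f ->
  {ae P, forall w, ((f w)%:E <= g w)%E} -> (\int[P]_w (f w)%:E <= \int[P]_w g w)%E.
Proof.
move=> mf [N [mN PN0 subN]].
pose f' w := ((f w)%:E + (cst -oo \_ N) w)%E.
have f'N w : N w -> f' w = -oo%E by move=> Nw; rewrite /f' patchT ?inE.
have f'C w : ~ N w -> f' w = (f w)%:E by move=> Nw; rewrite /f' patchN ?adde0// notin_setE.
have f'g w : (f' w <= g w)%E.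
  have [Nw|Nw] := pselect (N w); first by rewrite f'N// leNye.
  by rewrite f'C//; apply: contrapT => h; exact/Nw/subN.
have -> : (\int[P]_w (f w)%:E = \int[P]_w f' w)%E.
  apply: ae_eq_integral => //.
  - exact/measurable_EFinP.
  - apply: emeasurable_funD; first exact/measurable_EFinP.
    by apply/(measurable_restrictT _ mN); exact: measurable_cst.
  - exists N; split => // w /= h; apply: contrapT => Nw; apply: h => _.
    by rewrite f'C.
pose nnint (h : T -> \bar R) := ereal_sup [set sintegral P k |
  k in [set k : {nnsfun T >-> R} | forall w, ((k w)%:E <= h w)%E]].
have mono (h1 h2 : T -> \bar R) : (forall w, (h1 w <= h2 w)%E) -> (nnint h1 <= nnint h2)%E.
  move=> h12; apply: le_ereal_sup => _ [h hh <-]; exists h => // w.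
  exact: le_trans (hh w) (h12 w).
rewrite /integral !patch_setT; apply: leeB; apply: mono => w; rewrite ?funeposE ?funenegE.
  by rewrite ge_max !le_max f'g lexx orbT.
by rewrite ge_max !le_max leeN2 f'g lexx orbT.
Qed.

(** If the Lipschitz constant [r] were below [a], then [a N + b <= f N <= f 0 + r N] would fail for
    large [N]. *)
Lemma slope_le_Lip (f : R -> R) (a b : R) : (Lip f < +oo)%E -> 0 < a ->
  (forall z, a * z + b <= f z) -> ((ln a)%:E <= elog (Lip f))%E.
Proof.
move=> Lf a0 lo.
have aL : (a%:E <= Lip f)%E.
  rewrite leNgt; apply/negP => La.
  have ub z : 0 < z -> (((f z - f 0) / z)%:E <= Lip f)%E.
    move=> z0; apply: le_trans (ereal_sup_ubound (_ : _ (`|f z - f 0| / `|z - 0|)%:E)).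
      by rewrite lee_fin subr0 (gtr0_norm z0) ler_pM2r ?invr_gt0// ler_norm.
    by exists (z, 0) => //=; rewrite gt_eqF.
  move: La ub; case: (Lip f) => [r| |]//=; last first.
    by move=> _ /(_ 1 ltr01); rewrite leeNy_eq.
  rewrite lte_fin => ra ub.
  have ar : 0 < a - r by rewrite subr_gt0.
  have [N hN] := archi_mul (`|f 0 - b|) ar.
  have N0 : 0 < N%:R :> R.
    rewrite ltr0n lt0n; apply/eqP => N0; move: hN; rewrite N0 mul0r.
    by rewrite ltNge normr_ge0.
  have := ub _ N0; rewrite lee_fin ler_pdivrMr// => h1.
  by have := lo N%:R; have := ler_norm (f 0 - b); lra.
move: aL Lf; case: (Lip f) => [r| |]//=; rewrite lee_fin => ar _.
by rewrite (lt_le_trans a0 ar) lee_fin ler_ln ?posrE// (lt_le_trans a0).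
Qed.

End LipschitzDrift.

(** * Lower bound for P(Z > x) by the integrated tail of the increment *)

Section TailComparison.
Context {R : realType} {d : measure_display} {T : measurableType d}.
Variable P : probability T R.
Variables (Psi : nat -> T -> R -> R) (A B D : nat -> T -> R) (g1 g2 astar : R).
Hypothesis mmodel : measurable_model Psi A B D.
Hypothesis iid : iid_tuples P Psi A B D.
Hypothesis Psi_gt0 : forall n w t, 0 < Psi n w t.
Hypothesis LipPsi : forall n w, (Lip (Psi n w) < +oo)%E.
Hypothesis Psi_bounds : forall n, {ae P, forall w, forall z,
  A n w * z + B n w - D n w <= Psi n w z /\
  Psi n w z <= A n w * Num.max z 0 + Num.max (B n w) 0 + D n w}.
Hypothesis A_gt0 : {ae P, forall w, 0 < A 0 w}.
Hypothesis lnA_neg : (\int[P]_w (Num.max (- ln (A 0 w)) 0)%:E < +oo)%E.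
Hypothesis lnA_pos : (\int[P]_w (Num.max (ln (A 0 w)) 0)%:E < +oo)%E.
Hypothesis lnA_mean : (\int[P]_w (ln (A 0 w))%:E < 0)%E.
Hypothesis logBD : (\int[P]_w (logp `|B 0 w - D 0 w|)%:E < +oo)%E.
Hypothesis g1_gt0 : 0 < g1.
Let Y0 := Y A B D g1 g2 0.
Hypothesis SY : in_Sstar P Y0.
Hypothesis EY0 : EY P A B D g1 g2 < 0.
Hypothesis astar_le0 : astar <= 0.
Let U := tailP P (fun w => Num.max (A 0 w) (B 0 w)).
Hypothesis VU : asym_equiv (tailP P (fun w => Num.max (A 0 w) (Num.max (B 0 w) 0 + D 0 w))) U.
Hypothesis LU : asym_equiv (tailP P (fun w => Num.max (A 0 w) (B 0 w - D 0 w))) U.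
Hypothesis NU : asym_negl (fun x => fine (P [set w | x < A 0 w /\ B 0 w - D 0 w <= - x])) U.

Let mA : measurable_fun setT (A 0). Proof. by case: mmodel => _ []. Qed.
Let mB : measurable_fun setT (B 0). Proof. by case: mmodel => _ [_ []]. Qed.
Let mD : measurable_fun setT (D 0). Proof. by case: mmodel => _ [_ []]. Qed.
Let mY : measurable_fun setT Y0. Proof. exact: measurable_Y0. Qed.

Let U_g0 t : 0 < U t. Proof. exact: (U_gt0 mA mB VU). Qed.

Let U_nincr t t' : t <= t' -> U t' <= U t.
Proof. by apply: tailP_nincr; exact: measurable_maxr. Qed.

(** Below the threshold of [tail_Y_le_U], the tail is at most 1 and [U] is bounded below by its
    value at the threshold. *)
Lemma tail_Y_le_U_all c : exists2 K : R, 0 < K &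
  forall s, tailP P Y0 (s - c) <= K * U (expR s).
Proof.
have [K [s1 [K0 HK]]] := tail_Y_le_U mA mB mD g1_gt0 SY VU c.
exists (K + (U (expR s1))^-1); first by rewrite addr_gt0// invr_gt0.
move=> s; have [s1s|ss1] := ltP s1 s.
  by apply: (le_trans (HK _ s1s)); apply: ler_wpM2r; [exact: ltW|rewrite lerDl invr_ge0 ltW].
apply: (@le_trans _ _ 1); first exact: tailP_le1.
apply: (@le_trans _ _ ((U (expR s1))^-1 * U (expR s))).
  by rewrite mulrC ler_pdivlMr// mul1r U_nincr// ler_expR.
by apply: ler_wpM2r; [exact: ltW|rewrite lerDr ltW].
Qed.

Lemma Wtail_le_of_sums (t h M : R) : 0 <= t -> 0 < h ->
  (forall N, \sum_(k < N) tailP P Y0 (t + k%:R * h) <= M) ->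
  Wtail P A B D g1 g2 t <= - (EY P A B D g1 g2)^-1 * (h * M).
Proof.
move=> t0 h0 HM.
have kappa : 0 <= - (EY P A B D g1 g2)^-1 by rewrite oppr_ge0 invr_le0 ltW.
rewrite -lee_fin; apply: (le_trans (Wtail_le mY SY t0)).
rewrite EFinM; apply: lee_wpmul2l; first by rewrite lee_fin.
pose F N := [set s : R | t <= s < t + N%:R * h].
have FE N : F N = `[t, t + N%:R * h[%classic.
  by apply/seteqP; split => s /=; rewrite in_itv.
have mF N : measurable (F N) by rewrite FE; exact: measurable_itv.
have mt (S : set R) : measurable_fun S (EFin \o tailP P Y0).
  by apply/measurable_EFinP; apply: measurable_funTS; exact: measurable_tailP.
have t_ge0 s : (0 <= (tailP P Y0 s)%:E)%E by rewrite lee_fin tailP_ge0.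
have ndF : {homo F : n m / (n <= m)%N >-> (n <= m)%O}.
  move=> n m nm; apply/subsetPset => s; rewrite /F /= => /andP[-> h1]/=.
  by apply: (lt_le_trans h1); rewrite lerD2l ler_wpM2r ?(ltW h0)// ler_nat.
have cv := ge0_nondecreasing_set_cvg_integral (mu := lebesgue_measure) ndF mF
  (fun n => mt (F n)) (fun n u _ => t_ge0 u).
have FU : \bigcup_N F N = [set s : R | t <= s].
  apply/seteqP; split => s /=; first by move=> [N _ /andP[]].
  move=> ts; have [N hN] := archi_mul (s - t) h0.
  by exists N; rewrite // /F /=; apply/andP; split=> //; rewrite -ltrBlDl.
rewrite -FU -(cvg_lim _ cv)//; apply: lime_le; first by apply/cvg_ex; eexists; exact: cv.
apply: nearW => N; apply: (@le_trans _ _ (h * \sum_(k < N) tailP P Y0 (t + k%:R * h))%:E).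
  apply: integral_nincr_le_sum; [by move=> s; exact: tailP_ge0|by move=> u v; exact: tailP_nincr|exact: ltW].
by rewrite lee_fin; apply: ler_wpM2l; [exact: ltW|exact: HM].
Qed.

Lemma tail_Z_lower_bound : exists2 K : R, 0 < K & forall x, 1 < x ->
  vbar P A B D g1 g2 (astar - sx g1 g2 x) <= K * fine (P [set w | T_finite Psi x w]).
Proof.
have [r0 [p0 [r00 p00 tight]]] := perp_tight mmodel iid A_gt0 lnA_neg lnA_pos lnA_mean logBD.
have [e [e01 ePsi]] := Psi_pos_level P mmodel Psi_gt0.
have [e0 e1] := andP e01.
have [t1 [t10 Hjump]] := jump_region_ge mA mB mD g1_gt0 SY VU LU NU e01.
set pe := P [set w | (2 * e <= Psi 0 w 0)%R] in ePsi.
have mpe : measurable [set w | 2 * e <= Psi 0 w 0].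
  by apply: measurable_ger_cst; case: mmodel.
have peE : pe = (fine pe)%:E by rewrite fineK// fin_num_measure.
have pe0 : 0 < fine pe by rewrite -lte_fin -peE.
have [m mE m0] : exists2 m : R, (\int[P]_w (Num.max (- ln (A 0 w)) 0)%:E = m%:E)%E & 0 <= m.
  have i0 : (0 <= \int[P]_w (Num.max (- ln (A 0 w)) 0)%:E)%E.
    by apply: integral_ge0 => w _; rewrite lee_fin le_max lexx orbT.
  exists (fine (\int[P]_w (Num.max (- ln (A 0 w)) 0)%:E)%E); last exact: fine_ge0.
  by rewrite fineK// ge0_fin_numE.
(* Chosen so that [C (p0 / 2)] is at least the mean [m] of the negative part; the 1 keeps [C]
   positive. *)
pose C := (m + 1) / (p0 / 2).
have p20 : 0 < p0 / 2 by rewrite divr_gt0.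
have C0 : 0 < C by rewrite divr_gt0// ltr_wpDl.
have Cbig : ((\int[P]_w (Num.max (- ln (A 0 w)) 0)%:E) <= (C * (p0 / 2))%:E)%E.
  by rewrite mE lee_fin /C divfK ?gt_eqF// lerDl.
(* With this margin [t_0 = (x + rho) / e] leaves room for the perpetuity, below [r0], and exceeds
   the threshold [t1] of the jump estimate. *)
pose rho := r0 + e * t1.
have rho0 : 0 < rho by rewrite addr_gt0// mulr_gt0.
(* Bounds the distance between [ln x] and [sx x], uniformly in [x]. *)
pose gam := `|g2| + `|ln (1 - expR (- g1))|.
have [K1 K10 HK1] := tail_Y_le_U_all (gam + ln ((1 + rho) / e)).
pose W0 := Wtail P A B D g1 g2 0.
have W00 : 0 < W0 by exact: Wtail_gt0.
pose kap := - (EY P A B D g1 g2)^-1.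
have kap0 : 0 < kap by rewrite oppr_gt0 invr_lt0.
pose K2 := kap * (2 * C * (2 * K1 / fine pe * (4 / p0))).
have K20 : 0 < K2 by do ![assumption | exact: ltr0n | apply: divr_gt0 | apply: mulr_gt0].
exists ((4 / p0 + K2) / W0); first by rewrite divr_gt0// addr_gt0// divr_gt0.
move=> x x1; set pi := fine _.
have pi0 : 0 <= pi by exact: fine_ge0.
pose t := Num.max (sx g1 g2 x - astar) 0.
have t0 : 0 <= t by rewrite le_max lexx orbT.
(* Dividing by [W0] covers levels [sx x - astar <= 0], where [vbar] may be 1 although [Wtail] at
   [t = 0] is only [W0]. *)
have W_le : vbar P A B D g1 g2 (astar - sx g1 g2 x) <= Wtail P A B D g1 g2 t / W0.
  rewrite /vbar opprB ler_pdivlMr// /t.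
  have [h|h] := leP (sx g1 g2 x - astar) 0.
    by rewrite -[leRHS]mul1r ler_wpM2r ?(ltW W00)// Wtail_le1.
  by rewrite ler_piMr ?(ltW (Wtail_gt0 _ _ _ _))// /W0 Wtail_le1.
apply: (le_trans W_le); rewrite mulrAC ler_pM2r ?invr_gt0// mulrDl.
(* When the target probability is at least [p0 / 4], the bound [Wtail <= 1] suffices; otherwise the
   jump events overlap little enough for [sum_big_jump_le]. *)
have [pl|pg] := ltP pi (p0 / 4); last first.
  apply: (@le_trans _ _ 1); first exact: Wtail_le1.
  apply: (@le_trans _ _ (4 / p0 * pi)); last by rewrite lerDl mulr_ge0// ltW.
  by rewrite -ler_pdivrMl ?divr_gt0// mulr1 invf_div.
apply: (@le_trans _ _ (K2 * pi)); last by rewrite lerDr mulr_ge0// ltW// divr_gt0.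
pose t_0 := (x + rho) / e.
have t_00 : 0 < t_0 by rewrite divr_gt0// addr_gt0//; lra.
have xr : x + r0 <= e * t_0.
  rewrite /t_0 mulrCA mulfV ?gt_eqF// mulr1 lerD2l /rho lerDl mulr_ge0//; exact: ltW.
have := @sum_big_jump_le _ _ _ P Psi A B D mmodel iid Psi_gt0 LipPsi Psi_bounds A_gt0
  r0 p0 e C t_0 e01 p00 C0 t_00 tight Cbig x xr pl.
rewrite -/pi => sums.
(* On the log scale the jump levels form an arithmetic progression of step [2 C], the mesh of the
   Riemann sum. Its starting point differs from [t] by a bounded amount in the direction needed,
   since [x + rho <= x (1 + rho)]. *)
have Jge k : fine pe / (2 * K1) * tailP P Y0 (t + k%:R * (2 * C)) <=
    fine (P (big_jump Psi A B D e C t_0 k)).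
  pose lv := jump_level C t_0 k.
  have lv_t1 : t1 < lv.
    apply: (@lt_le_trans _ _ t_0).
      by rewrite /t_0 ltr_pdivlMr// mulrC /rho; move: x1 r00; lra.
    rewrite /lv /jump_level ler_peMl ?(ltW t_00)// -expR0 ler_expR mulr_ge0 ?(ltW C0)//.
  have h1 : U lv / 2 * fine pe <= fine (P (big_jump Psi A B D e C t_0 k)).
    have mJ := measurable_jump_region e lv.
    have mABD : measurable (ABD A B D 0 @^-1` jump_region e lv).
      by rewrite -[X in measurable X]setTI; exact: (measurable_ABD mmodel).
    have := prob_big_jump mmodel iid e C t_0 k; rewrite -/lv -/pe => ->.
    rewrite fineM ?fin_num_measure//; apply: ler_wpM2r; first exact: ltW.
    by rewrite -lee_fin fineK ?fin_num_measure//; exact: Hjump.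
  have h2 : tailP P Y0 (t + k%:R * (2 * C)) <= K1 * U lv.
    have xr0 : 0 < x + rho by rewrite addr_gt0//; lra.
    have rho1 : 0 < 1 + rho by rewrite addr_gt0.
    have lv0 : 0 < lv by exact: lt_trans lv_t1.
    rewrite -[lv in leRHS]lnK ?posrE//; apply: le_trans (HK1 (ln lv)).
    apply: tailP_nincr => //.
    rewrite /lv /jump_level lnM ?posrE ?expR_gt0// expRK /t_0 !ln_div ?posrE//.
    have lnx : ln (x + rho) <= ln x + ln (1 + rho).
      rewrite -lnM ?posrE//; last by lra.
      rewrite ler_ln ?posrE// ?mulr_gt0//; last by lra.
      by rewrite mulrDr mulr1 lerD2l ler_peMl// ltW.
    have ts : sx g1 g2 x <= t by rewrite le_max lerDl oppr_ge0 astar_le0.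
    have sxx : ln x - gam <= sx g1 g2 x.
      have := ler_norm g2; have := ler_norm (- ln (1 - expR (- g1))); rewrite normrN /sx /gam; lra.
    have -> : C * (2 * k)%:R = k%:R * (2 * C) by rewrite natrM; ring.
    lra.
  apply: le_trans h1; apply: (@le_trans _ _ (fine pe / (2 * K1) * (K1 * U lv))).
    by apply: ler_wpM2l h2; rewrite divr_ge0 ?mulr_ge0// ltW.
  by rewrite le_eqVlt; apply/orP; left; apply/eqP; field; rewrite gt_eqF.
apply: (le_trans (@Wtail_le_of_sums t (2 * C) (2 * K1 / fine pe * (4 / p0) * pi) t0 _ _)).
- by rewrite mulr_gt0.
- move=> N; have h := sums N.
  have : \sum_(k < N) (fine pe / (2 * K1) * tailP P Y0 (t + k%:R * (2 * C))) <= 4 / p0 * pi.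
    by apply: le_trans h; apply: ler_sum => k _; exact: Jge.
  rewrite -mulr_sumr => h'.
  have b0 : 0 < fine pe / (2 * K1) by rewrite divr_gt0// mulr_gt0.
  rewrite -(ler_pM2l b0); apply: (le_trans h').
  rewrite le_eqVlt; apply/orP; left; apply/eqP; field.
  by rewrite !gt_eqF.
- by rewrite /K2 -/kap !mulrA.
Qed.

End TailComparison.

Theorem theorem2 (R : realType) (d : measure_display) (T : measurableType d)
  (P : probability T R)
  (Psi : nat -> T -> R -> R) (A B D : nat -> T -> R)
  (g1 g2 delta astar : R) (Q : R -> probability T R) :
  measurable_model Psi A B D ->
  iid_tuples P Psi A B D ->
  assumption2 P Psi A B D ->
  integrated_tail_subexp P A B ->
  0 < g1 ->
  in_Sstar P (Y A B D g1 g2 0) ->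
  (\int[P]_w (Y A B D g1 g2 0 w)%:E < 0)%E ->
  0 < delta < 1 ->
  astar <= 0 ->
  (forall u, u <= astar ->
     - delta <= (vbar P A B D g1 g2 u ^+ 2 - wbar P A B D g1 g2 u ^+ 2) /
                (tailP P (Y A B D g1 g2 0) (- u) * wbar P A B D g1 g2 u)) ->
  (forall x, 1 < x -> is_tilde_measure P Psi A B D g1 g2 astar x (Q x)) ->
  (forall x, 1 < x ->
     (\int[Q x]_w (LT P Psi A B D g1 g2 astar x w)%:E =
      P [set w | (x%:E < Zlim Psi w)%E])%E) /\
  (exists C : R, forall x, 1 < x ->
     (\int[Q x]_w ((LT P Psi A B D g1 g2 astar x w) ^+ 2)%:E <=
      (C * fine (P [set w | (x%:E < Zlim Psi w)%E]) ^+ 2)%:E)%E).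
Proof.
move=> mmodel iid [Psi_gt0 [LipPsi [Psi_bounds [ndZ [AD_gt0 [lnA_neg [_ [lnLip [_ [logBD
  [_ [VU [LU NU]]]]]]]]]]]]] _ g10 SY EYlt0 delta01 astar0 Hv HQ.
have A_gt0 : {ae P, forall w, 0 < A 0 w} by apply: filterS AD_gt0 => w [].
have mY : measurable_fun setT (Y A B D g1 g2 0).
  by have [_ [mA [mB mD]]] := mmodel; exact: measurable_Y0.
have mlnA : measurable_fun setT (fun w => ln (A 0 w)).
  by have [_ [mA _]] := mmodel; exact: (measurableT_comp (@measurable_ln R) (mA 0%N)).
have lnAY w : ln (A 0 w) + g1 <= Y A B D g1 g2 0 w by rewrite lerD2r le_max lexx orbT.
(* Class S* includes integrability of the positive part of [Y_1], which dominates that of [ln A]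
   because [g1 > 0]. *)
have lnA_pos : (\int[P]_w (Num.max (ln (A 0 w)) 0)%:E < +oo)%E.
  apply: le_lt_trans SY.1; apply: ge0_le_integral => //.
  - by move=> w _; rewrite lee_fin le_max lexx orbT.
  - by apply/measurable_EFinP; apply: measurable_maxr.
  - by apply/measurable_EFinP; apply: measurable_maxr.
  - move=> w _; rewrite lee_fin ge_max !le_max lexx orbT andbT.
    by rewrite (le_trans _ (lnAY w))// lerDl ltW.
have lnA_mean : (\int[P]_w (ln (A 0 w))%:E < 0)%E.
  apply: le_lt_trans lnLip; apply: integral_le_ae_nonmeasurable => //.
  apply: filterS2 A_gt0 (Psi_bounds 0%N) => w Aw bw.
  by apply: (@slope_le_Lip _ _ _ (B 0 w - D 0 w)) => // z; rewrite addrA; case: (bw z).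
(* [EY] is a [fine], which would be 0 for a mean of [-oo]; the integrable lower bound
   [ln A + g1 <= Y_1] excludes that. *)
have EY0 : EY P A B D g1 g2 < 0.
  have Yneg : (-oo < \int[P]_w (Y A B D g1 g2 0 w)%:E)%E.
    have mlnAg : measurable_fun setT (fun w => ln (A 0 w) + g1) by exact: measurable_funD.
    have ilnAg : P.-integrable setT (EFin \o (fun w => ln (A 0 w) + g1)).
      rewrite (_ : _ \o _ = (fun w => (ln (A 0 w))%:E) \+ (fun=> g1%:E))%E//.
      apply: integrableD => //; first exact: integrable_lnA mmodel lnA_neg lnA_pos.
      exact: finite_measure_integrable_cst.
    apply: (@lt_le_trans _ _ (\int[P]_w (ln (A 0 w) + g1)%:E)%E).
      by rewrite ltNye_eq; apply/orP; left; apply: integrable_fin_num.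
    by apply: integral_le_ae_nonmeasurable => //; apply: nearW => w; rewrite lee_fin.
  rewrite /EY -lte_fin fineK// fin_real// Yneg/= (lt_trans EYlt0)//.
have ZT x : P [set w | (x%:E < Zlim Psi w)%E] = P [set w | T_finite Psi x w].
  exact: (measure_Zlim_gt mmodel LipPsi ndZ).
split=> [x x1|].
  rewrite ZT; apply: tilde_integral_LT => //; first exact: HQ.
  exact: (hit_before_T g2 mmodel iid Psi_gt0 LipPsi Psi_bounds A_gt0 g10 x1).
have [K K0 HK] := @tail_Z_lower_bound _ _ _ P Psi A B D g1 g2 astar mmodel iid Psi_gt0 LipPsi
  Psi_bounds A_gt0 lnA_neg lnA_pos lnA_mean logBD g10 SY EY0 astar0 VU LU NU.
pose c0 := Num.min (1 - delta) (vbar P A B D g1 g2 astar ^+ 2).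
have c00 : 0 < c0.
  rewrite lt_min subr_gt0; case/andP: delta01 => _ ->/=.
  by rewrite exprn_gt0//; exact: Wtail_gt0.
(* The second moment is at most [vbar(astar - sx)^2 / c0], and [vbar(astar - sx) <= K P(Z > x)]. *)
exists (K ^+ 2 / c0) => x x1; rewrite ZT.
apply: (tilde_integral_LT_sq mmodel SY EY0 LipPsi (HQ _ x1)) => n.
have := second_moment_bound x mmodel iid SY EY0 delta01 astar0 Hv n; rewrite -/c0.
set S := (\sum_(k < n) _)%R => HS.
have vK : vbar P A B D g1 g2 (astar - sx g1 g2 x) ^+ 2 <=
    K ^+ 2 * fine (P [set w | T_finite Psi x w]) ^+ 2.
  rewrite -exprMn ler_pXn2r ?nnegrE ?HK//; first exact/ltW/Wtail_gt0.
  by rewrite mulr_ge0 ?(ltW K0)// fine_ge0.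
rewrite mulrAC EFinM lee_pdivlMr//.
rewrite muleC; apply: (le_trans HS); rewrite lee_fin.
exact: vK.
Qed.
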